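(* Let $q,q_1,q_2\in[1,\infty]$ and $\omega,\omega_1,\omega_2\in\mathscr P(\mathbf R^d)$ satisfy $$\frac1{q_1}+\frac1{q_2}=\frac1q\quad\text{and}\quad\omega(\xi)\le C\omega_1(\xi)\omega_2(\xi),$$ for some $C>0$ which is independent of $\xi\in\mathbf R^d$. Then the convolution map $(f_1,f_2)\mapsto f_1*f_2$ from $\mathscr S(\mathbf R^d)\times\mathscr S(\mathbf R^d)$ to $\mathscr S(\mathbf R^d)$ extends to a continuous mapping from $\mathscr FL^{q_1}_{(\omega_1)}(\mathbf R^d)\times\mathscr FL^{q_2}_{(\omega_2)}(\mathbf R^d)$ to $\mathscr FL^q_{(\omega)}(\mathbf R^d)$. This extension is unique if $q_1<\infty$ or $q_2<\infty$.
   Context: $\widehat f(\xi)=(2\pi)^{-d/2}\int f(x)e^{-i\langle x,\xi\rangle}\,dx$, extended to $\mathscr S'(\mathbf R^d)$. $\mathscr P(\mathbf R^d)$ is the set of positive $\omega\in L^\infty_{loc}(\mathbf R^d)$ for which there are a polynomial $v$ and a constant $C$ with $\omega(x+y)\le C\omega(x)v(y)$ for all $x,y\in\mathbf R^d$. For $\omega\in\mathscr P(\mathbf R^d)$ and $q\in[1,\infty]$, $\mathscr FL^q_{(\omega)}(\mathbf R^d)$ is the Banach space of all $f\in\mathscr S'(\mathbf R^d)$ with $\|f\|_{\mathscr FL^q_{(\omega)}}=\|\widehat f\,\omega\|_{L^q}<\infty$.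
   Formalization: When exactly one of q1, q2 is infinite, continuous extensions from S×S are not unique (add m(f2)f1, m vanishing on S); uniqueness is proved among extensions that also agree with the usual convolution of a Schwartz function with an element of the space with infinite exponent. *)

(* Defs.v *)
From HB Require Import structures.
From mathcomp Require Import all_boot all_order all_algebra.
From mathcomp Require Import all_classical all_reals all_analysis.
From mathcomp Require Import complex.
(* Not imported: its notations clash with those of mathcomp.analysis. *)
From mathcomp Require mpoly.

Set Implicit Arguments.
Unset Strict Implicit.
Unset Printing Implicit Defensive.

Import Order.TTheory GRing.Theory Num.Theory.
Import numFieldNormedType.Exports.

Local Open Scope classical_set_scope.
Local Open Scope ring_scope.

Section measurable_rV.
Context {R : realType} (n : nat).

Definition rV_coord (i : 'I_n) (x : 'rV[R]_n) : measurableTypeR R := x 0 i.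

Let rV_set0 : g_sigma_preimage rV_coord set0.
Proof. exact: sigma_algebra0. Qed.

Let rV_setC A : g_sigma_preimage rV_coord A -> g_sigma_preimage rV_coord (~` A).
Proof. exact: sigma_algebraC. Qed.

Let rV_bigcup (F : _^nat) : (forall i, g_sigma_preimage rV_coord (F i)) ->
  g_sigma_preimage rV_coord (\bigcup_i (F i)).
Proof. exact: sigma_algebra_bigcup. Qed.

(* The sigma-algebra generated by the coordinates, i.e. the Borel sets. *)
HB.instance Definition _ := @isMeasurable.Build default_measure_display
  'rV[R]_n (g_sigma_preimage rV_coord) rV_set0 rV_setC rV_bigcup.

Lemma measurable_rV_coord (i : 'I_n) : measurable_fun setT (rV_coord i).
Proof.
move=> _ Y mY; rewrite setTI; apply: sub_sigma_algebra => /=.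
rewrite -bigcup_seq/=; exists i => /=; first by rewrite mem_index_enum.
by exists Y => //; rewrite setTI.
Qed.

Lemma measurable_fun_rV d (T : measurableType d) (f : T -> 'rV[R]_n) :
  (forall i, measurable_fun setT (rV_coord i \o f)) -> measurable_fun setT f.
Proof.
move=> mf _ A mA; rewrite setTI.
have : g_sigma_preimage rV_coord `<=` [set B | measurable (f @^-1` B)].
  apply: smallest_sub => /=.
    split=> [|B mB|F mF]; first by rewrite /= preimage_set0.
      by rewrite setTD; exact: (measurableC mB).
    by rewrite /= preimage_bigcup; exact: bigcupT_measurable.
  rewrite -bigcup_seq => B [i _ [C mC <-]] /=.
  by rewrite setTI -comp_preimage -[X in measurable X]setTI; exact: mf.
by apply.
Qed.

End measurable_rV.

Section rV_cons.
Context {R : realType} (n : nat).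

Definition rV_cons (p : measurableTypeR R * 'rV[R]_n) : 'rV[R]_n.+1 :=
  \row_i (if unlift ord0 i is Some j then p.2 0 j else p.1).

Definition rV_uncons (x : 'rV[R]_n.+1) : measurableTypeR R * 'rV[R]_n :=
  (x 0 ord0, \row_j x 0 (lift ord0 j)).

Lemma rV_consK : cancel rV_cons rV_uncons.
Proof.
move=> [a x]; congr pair => /=; first by rewrite mxE unlift_none.
by apply/rowP => j; rewrite !mxE liftK.
Qed.

Lemma measurable_rV_cons : measurable_fun setT rV_cons.
Proof.
apply: measurable_fun_rV => i; case: (unliftP ord0 i) => [j|] ->.
- rewrite (_ : _ \o _ = rV_coord j \o snd).
    by apply: measurableT_comp => //; exact: measurable_rV_coord.
  by apply/funext => p /=; rewrite /rV_coord !mxE liftK.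
- rewrite (_ : _ \o _ = fst) //.
  by apply/funext => p /=; rewrite /rV_coord !mxE unlift_none.
Qed.

Lemma measurable_rV_uncons : measurable_fun setT rV_uncons.
Proof.
apply/measurable_fun_pairP; split.
  exact: (measurable_rV_coord (ord0 : 'I_n.+1)).
apply: measurable_fun_rV => j.
rewrite (_ : _ \o _ = rV_coord (lift ord0 j)).
  exact: measurable_rV_coord.
by apply/funext => x; rewrite /rV_coord /= mxE.
Qed.

Variable mu : {sigma_finite_measure set 'rV[R]_n -> \bar R}.

Definition rV_cons_measure : set 'rV[R]_n.+1 -> \bar R :=
  pushforward (lebesgue_measure \x mu)%E rV_cons.

Let rV_cons_measure0 : rV_cons_measure set0 = 0%E.
Proof. by have := measurable_rV_cons => mf; exact: measure0. Qed.

Let rV_cons_measure_ge0 A : (0 <= rV_cons_measure A)%E.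
Proof. by have := measurable_rV_cons => mf; exact: measure_ge0. Qed.

Let rV_cons_measure_sigma_additive : semi_sigma_additive rV_cons_measure.
Proof.
by have := measurable_rV_cons => mf; exact: measure_semi_sigma_additive.
Qed.

HB.instance Definition _ := isMeasure.Build _ _ _ rV_cons_measure
  rV_cons_measure0 rV_cons_measure_ge0 rV_cons_measure_sigma_additive.

Let rV_cons_measure_sigma_finite : sigma_finite setT rV_cons_measure.
Proof.
have /sigma_finiteP[F [TF ndF Foo]] := sigma_finiteT (@lebesgue_measure R).
have /sigma_finiteP[G [TG ndG Goo]] := sigma_finiteT mu.
exists (fun k => rV_uncons @^-1` (F k `*` G k)).
  apply/esym/seteqP; split=> // x _.
  have [n1 _ Fn1] : (\bigcup_i F i) (x 0 ord0) by rewrite -TF.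
  have [n2 _ Gn2] : (\bigcup_i G i) (\row_j x 0 (lift ord0 j)) by rewrite -TG.
  exists (maxn n1 n2) => //; split => /=.
    by move: Fn1; exact/subsetPset/ndF/leq_maxl.
  by move: Gn2; exact/subsetPset/ndG/leq_maxr.
move=> k; have [mF Fk] := Foo k; have [mG Gk] := Goo k; split.
  rewrite -[X in measurable X]setTI; apply: measurable_rV_uncons => //.
  exact: measurableX.
rewrite /rV_cons_measure /pushforward -comp_preimage.
rewrite (_ : rV_uncons \o rV_cons = id); last exact/funext/rV_consK.
by rewrite preimage_id product_measure1E// lte_mul_pinfty// ge0_fin_numE.
Qed.

HB.instance Definition _ := Measure_isSigmaFinite.Build _ _ _ rV_cons_measure
  rV_cons_measure_sigma_finite.

End rV_cons.

Fixpoint lebesgue_rV {R : realType} (n : nat) :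
    {sigma_finite_measure set 'rV[R]_n -> \bar R} :=
  match n with
  | 0 => dirac (0 : 'rV[R]_0)
  | m.+1 => rV_cons_measure (lebesgue_rV m)
  end.

Definition cnorm {R : realType} (z : R[i]) : R := Normc.normc z.

Definition cmeasurable {R : realType} {d : nat} (f : 'rV[R]_d -> R[i]) : Prop :=
  measurable_fun setT (fun x => complex.Re (f x)) /\
  measurable_fun setT (fun x => complex.Im (f x)).

Definition cintegrable {R : realType} {d : nat} (f : 'rV[R]_d -> R[i]) : Prop :=
  (lebesgue_rV d).-integrable setT (fun x => (complex.Re (f x))%:E) /\
  (lebesgue_rV d).-integrable setT (fun x => (complex.Im (f x))%:E).

Definition cintegral {R : realType} {d : nat} (f : 'rV[R]_d -> R[i]) : R[i] :=
  (\int[lebesgue_rV d]_x complex.Re (f x) +i*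
   \int[lebesgue_rV d]_x complex.Im (f x))%C.

Definition dotp {R : realType} {d : nat} (x y : 'rV[R]_d) : R :=
  \sum_(i < d) x 0 i * y 0 i.

(* e^{it} *)
Definition expi {R : realType} (t : R) : R[i] := (cos t +i* sin t)%C.

Definition fourier {R : realType} {d : nat} (f : 'rV[R]_d -> R[i])
    (xi : 'rV[R]_d) : R[i] :=
  ((2 * pi) `^ (- (d%:R / 2)))%:C%C *
    cintegral (fun x => f x * expi (- dotp x xi)).

Definition conv {R : realType} {d : nat} (f g : 'rV[R]_d -> R[i])
    (x : 'rV[R]_d) : R[i] :=
  cintegral (fun y => f (x - y) * g y).

(* [pderivs [:: i1; ..; ik] f] is the iterated partial derivative
   d_i1 ... d_ik f. *)
Definition pderivs {R : realType} {d : nat} (s : seq 'I_d)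
    (f : 'rV[R]_d -> R) : 'rV[R]_d -> R :=
  foldr (fun i g x => 'D_(delta_mx 0 i) g x) f s.

Definition smooth {R : realType} {d : nat} (f : 'rV[R]_d -> R) : Prop :=
  forall s : seq 'I_d,
    continuous (pderivs s f) /\
    (forall x i, derivable (pderivs s f) x (delta_mx 0 i)).

Definition cpderivs {R : realType} {d : nat} (s : seq 'I_d)
    (f : 'rV[R]_d -> R[i]) (x : 'rV[R]_d) : R[i] :=
  (pderivs s (fun y => complex.Re (f y)) x +i*
   pderivs s (fun y => complex.Im (f y)) x)%C.

Definition schwartz_norm {R : realType} {d : nat} (N : nat)
    (f : 'rV[R]_d -> R[i]) : \bar R :=
  ereal_sup [set ((1 + `|x|) ^+ N * cnorm (cpderivs s f x))%:E
            | s in [set s : seq 'I_d | (size s <= N)%N] & x in setT].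

Definition is_schwartz {R : realType} {d : nat} (f : 'rV[R]_d -> R[i]) : Prop :=
  [/\ smooth (fun x => complex.Re (f x)), smooth (fun x => complex.Im (f x)) &
      forall N, (schwartz_norm N f < +oo)%E].

Section schwartz_lmod.
Context {R : realType} {d : nat}.
Implicit Types (f g : 'rV[R]_d -> R) (F G : 'rV[R]_d -> R[i]) (a : R[i]).

Lemma pderivs_linear (k : R) f g (s : seq 'I_d) : smooth f -> smooth g ->
  pderivs s (fun x => k * f x + g x) =
  (fun x => k * pderivs s f x + pderivs s g x).
Proof.
move=> sf sg; elim: s => [//|i s /= ->]; apply/funext => x.
have [_ /(_ x i) df] := sf s; have [_ /(_ x i) dg] := sg s.
rewrite (_ : (fun x => _) = (k \*: pderivs s f) + pderivs s g); last first.
  by apply/funext => y; rewrite /=.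
by rewrite deriveD ?deriveZ//; exact: derivableZ.
Qed.

Lemma smooth_linear (k : R) f g : smooth f -> smooth g ->
  smooth (fun x => k * f x + g x).
Proof.
move=> sf sg s; rewrite pderivs_linear//.
have [cf df] := sf s; have [cg dg] := sg s.
split=> [x|x i].
  have Fx : Filter (nbhs (x : 'rV[R]_d)) by exact: nbhs_filter.
  exact: (cvgD (cvgMl_tmp (cf x)) (cg x)).
rewrite (_ : (fun x => _) = (k \*: pderivs s f) + pderivs s g); last first.
  by apply/funext => y; rewrite /=.
by apply: derivableD => //; exact: derivableZ.
Qed.

Lemma pderivs0 (s : seq 'I_d) : pderivs s (fun=> 0 : R) = (fun=> 0).
Proof.
elim: s => [//|i s /= ->]; apply/funext => x.
exact: (derive_cst (0 : R) x (delta_mx 0 i)).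
Qed.

Lemma smooth0 : smooth (fun _ : 'rV[R]_d => 0 : R).
Proof.
move=> s; rewrite pderivs0; split=> [|x i]; first exact: cst_continuous.
exact: (derivable_cst (0 : R)).
Qed.

Lemma schwartz_normP N F : (schwartz_norm N F < +oo)%E <->
  exists M : R, forall (s : seq 'I_d) x, (size s <= N)%N ->
    (1 + `|x|) ^+ N * cnorm (cpderivs s F x) <= M.
Proof.
split=> [h|[M hM]]; last first.
  apply: (@le_lt_trans _ _ M%:E); last exact: ltry.
  by apply: ge_ereal_sup => _ [s sN [x _ <-]]; rewrite lee_fin hM.
exists (fine (schwartz_norm N F)) => s x sN.
have le_norm : (((1 + `|x|) ^+ N * cnorm (cpderivs s F x))%:E
    <= schwartz_norm N F)%E.
  by apply: ereal_sup_ubound; exists s => //; exists x.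
rewrite -lee_fin fineK// fin_numElt h andbT.
by apply: (lt_le_trans _ le_norm); exact: ltNyr.
Qed.

Lemma cnormM (y z : R[i]) : cnorm (y * z) = cnorm y * cnorm z.
Proof. exact: Normc.normcM. Qed.

Lemma cnormD (y z : R[i]) : cnorm (y + z) <= cnorm y + cnorm z.
Proof.
suff : (cnorm (y + z))%:C%C <= (cnorm y)%:C%C + (cnorm z)%:C%C.
  by rewrite -rmorphD lecR.
exact: (ler_normD (y : R[i]) z).
Qed.

Lemma cnorm_ge0 (z : R[i]) : 0 <= cnorm z.
Proof. by case: z => x y; exact: sqrtr_ge0. Qed.

Lemma is_schwartz0 : is_schwartz (fun _ : 'rV[R]_d => 0 : R[i]).
Proof.
split; [exact: smooth0|exact: smooth0|move=> N].
apply/schwartz_normP; exists 0 => s x _.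
by rewrite /cpderivs pderivs0 /cnorm [X in _ * X]Normc.normc0 mulr0.
Qed.

Lemma is_schwartz_linear a F G : is_schwartz F -> is_schwartz G ->
  is_schwartz (fun x => a * F x + G x).
Proof.
case: a => a b [sF1 sF2 nF] [sG1 sG2 nG].
have ReE : (fun x => complex.Re ((a +i* b)%C * F x + G x)) =
    (fun x => a * complex.Re (F x) +
              ((- b) * complex.Im (F x) + complex.Re (G x))).
  by apply/funext => x; case: (F x) (G x) => [p q] [u v]; rewrite /= mulNr addrA.
have ImE : (fun x => complex.Im ((a +i* b)%C * F x + G x)) =
    (fun x => a * complex.Im (F x) +
              (b * complex.Re (F x) + complex.Im (G x))).
  by apply/funext => x; case: (F x) (G x) => [p q] [u v]; rewrite /= addrA.
split; first by rewrite ReE; do 2 apply: smooth_linear => //.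
  by rewrite ImE; do 2 apply: smooth_linear => //.
move=> N; have /schwartz_normP[M hM] := nF N.
have /schwartz_normP[M' hM'] := nG N.
apply/schwartz_normP; exists (cnorm (a +i* b)%C * M + M') => s x sN.
have -> : cpderivs s (fun x => (a +i* b)%C * F x + G x) x =
    (a +i* b)%C * cpderivs s F x + cpderivs s G x.
  rewrite /cpderivs ReE ImE !pderivs_linear//; try exact: smooth_linear.
  by simpc; congr Complex; rewrite ?mulNr addrA.
have x0 : 0 <= (1 + `|x|) ^+ N by rewrite exprn_ge0// addr_ge0.
apply: le_trans (ler_wpM2l x0 (cnormD _ _)) _.
rewrite mulrDr cnormM; apply: lerD; last exact: hM'.
by rewrite mulrCA; apply: ler_wpM2l (hM s x sN); exact: cnorm_ge0.
Qed.

Definition schwartz_pred : {pred 'rV[R]_d -> R[i]^o} :=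
  [pred f : 'rV[R]_d -> R[i]^o | `[< is_schwartz f >]].

Lemma schwartz_submod_closed : submod_closed schwartz_pred.
Proof.
split; first by rewrite inE; exact: is_schwartz0.
move=> a F G; rewrite !inE => sF sG; exact: is_schwartz_linear.
Qed.

HB.instance Definition _ := GRing.isSubmodClosed.Build R[i]
  ('rV[R]_d -> R[i]^o) schwartz_pred schwartz_submod_closed.

End schwartz_lmod.

(* The target is R[i]^o so that Schwartz functions form a vector space over
   R[i]. *)
Record schwartz (R : realType) (d : nat) := Schwartz {
  schwartz_fun :> 'rV[R]_d -> R[i]^o ;
  _ : schwartz_fun \in @schwartz_pred R d }.

HB.instance Definition _ R d := [isSub for @schwartz_fun R d].
HB.instance Definition _ R d := [Choice of schwartz R d by <:].
HB.instance Definition _ R d := [SubChoice_isSubLmodule of schwartz R d by <:].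

(* The Schwartz function with underlying function [f]; [0] if [f] is not a
   Schwartz function.  It is only used for functions that are. *)
Definition to_schwartz {R : realType} {d : nat} (f : 'rV[R]_d -> R[i]) :
  schwartz R d := insubd (0 : schwartz R d) (f : 'rV[R]_d -> R[i]^o).

Definition schwartz_conv {R : realType} {d : nat} (f g : schwartz R d) :
  schwartz R d := to_schwartz (conv f g).

Definition functional (R : realType) (d : nat) : Type :=
  schwartz R d -> R[i]^o.

Definition tempered {R : realType} {d : nat} (u : functional R d) : Prop :=
  linear u /\
  exists (N : nat) (C : R), forall phi : schwartz R d,
    ((cnorm (u phi))%:E <= C%:E * schwartz_norm N phi)%E.

Definition regular {R : realType} {d : nat} (g : 'rV[R]_d -> R[i]) :
  functional R d := fun phi => cintegral (fun x => g x * phi x).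

Definition is_density {R : realType} {d : nat} (u : functional R d)
    (g : 'rV[R]_d -> R[i]) : Prop :=
  [/\ cmeasurable g,
      forall phi : schwartz R d, cintegrable (fun x => g x * phi x) &
      u = regular g].

Definition fourier_dist {R : realType} {d : nat} (u : functional R d) :
  functional R d := fun phi => u (to_schwartz (fourier phi)).

(* f * u for f in S and u in S', by duality:
   <f * u, phi> = <u, f(- .) * phi>. *)
Definition conv_dist {R : realType} {d : nat} (f : schwartz R d)
    (u : functional R d) : functional R d :=
  fun phi => u (to_schwartz (conv (fun x => f (- x)) phi)).

Definition moderate_weight {R : realType} {d : nat} (w : 'rV[R]_d -> R) :
    Prop :=
  [/\ forall x, 0 < w x,
      measurable_fun setT w,
      forall K : set 'rV[R]_d, compact K ->
        exists M : R, {ae lebesgue_rV d, forall x, K x -> w x <= M} &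
      exists (v : mpoly.mpoly d R) (C : R), forall x y : 'rV[R]_d,
        w (x + y) <= C * w x * mpoly.meval (fun i => y 0 i) v].

(* The functions [g] representing the Fourier transform of [u] agree almost
   everywhere, so that the infimum ranges over at most one value; it is +oo if
   the Fourier transform of [u] is not a function. *)
Definition FLnorm {R : realType} {d : nat} (q : \bar R) (w : 'rV[R]_d -> R)
    (u : functional R d) : \bar R :=
  ereal_inf [set ('N[lebesgue_rV d]_q[(fun xi => (cnorm (g xi) * w xi)%:E)])%E
            | g in is_density (fourier_dist u)].

Definition FL {R : realType} {d : nat} (q : \bar R) (w : 'rV[R]_d -> R) :
    set (functional R d) :=
  [set u | tempered u /\ (FLnorm q w u < +oo)%E].

Section extension.
Context {R : realType} {d : nat}.
Variables (q1 q2 q : \bar R) (w1 w2 w : 'rV[R]_d -> R).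
Variable T : functional R d -> functional R d -> functional R d.

Definition maps_FL : Prop :=
  forall f1 f2, FL q1 w1 f1 -> FL q2 w2 f2 -> FL q w (T f1 f2).

Definition continuous_FL : Prop :=
  forall f1 f2, FL q1 w1 f1 -> FL q2 w2 f2 ->
  forall e : R, 0 < e -> exists2 delta : R, 0 < delta &
    forall g1 g2, FL q1 w1 g1 -> FL q2 w2 g2 ->
      (FLnorm q1 w1 (g1 - f1)%R < delta%:E)%E ->
      (FLnorm q2 w2 (g2 - f2)%R < delta%:E)%E ->
      (FLnorm q w (T g1 g2 - T f1 f2)%R < e%:E)%E.

Definition extends_schwartz_conv : Prop :=
  forall f1 f2 : schwartz R d,
    T (regular f1) (regular f2) = regular (schwartz_conv f1 f2).

(* S is not dense in FL^oo, so that continuity does not determine T f1 f2 for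
   f1 in S and f2 in FL^oo from its values on S x S.  There T is required to
   be the usual convolution of a Schwartz function with a tempered
   distribution: otherwise, for a nonzero continuous linear form m on FL^oo
   vanishing on S, T f1 f2 and T f1 f2 + m(f2) f1 would be two different
   extensions to FL^1 x FL^oo (with weights equal to 1), both of them
   continuous and bilinear. *)
Definition conv_extension : Prop :=
  [/\ maps_FL, continuous_FL, extends_schwartz_conv,
      q2 = +oo%E -> forall (f1 : schwartz R d) f2, FL q2 w2 f2 ->
        T (regular f1) f2 = conv_dist f1 f2 &
      q1 = +oo%E -> forall f1 (f2 : schwartz R d), FL q1 w1 f1 ->
        T f1 (regular f2) = conv_dist f2 f1].

End extension.

(* Main.v *)
From HB Require Import structures.
From mathcomp Require Import all_boot all_order all_algebra.
From mathcomp Require Import all_classical all_reals all_analysis.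
From mathcomp Require Import measurable_realfun ess_sup_inf complex.
From mathcomp Require mpoly.
From mathcomp Require Import ring lra.
Require Import Defs.

Set Implicit Arguments.
Unset Strict Implicit.
Unset Printing Implicit Defensive.

Import Order.TTheory GRing.Theory Num.Theory.
Import numFieldNormedType.Exports.
Import HBNNSimple.

(** The whole argument takes place on the Fourier side.  An element of
    FL^q_(w) is a tempered distribution whose Fourier transform is a function
    g with g w in L^q, and the Fourier transform of a convolution is
    (2 pi)^(d/2) times the product of the Fourier transforms.  Hence the
    extension can only be the distribution with Fourier transform
    (2 pi)^(d/2) g1 g2, and w <= C w1 w2 together with the inequality of
    Hoelder bounds its norm by a multiple of the product of the two norms
    (wnorm_conv_prod).  Bilinearity in (g1, g2) turns this bound into
    continuity.

    For this to make sense, the density g must be determined almost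
    everywhere by the distribution (schwartz_separating, is_density_ae), and
    conversely every g with g w in L^q must define a tempered distribution.
    The latter holds because a moderate weight is bounded below by the inverse
    of a polynomial (moderate_ge), so that pairing g with a Schwartz function
    is controlled by one of its seminorms (wnorm_pairing).  That the map
    obtained is the usual convolution, on Schwartz functions and also on
    pairs of a Schwartz function and a distribution, is the convolution
    theorem (fourier_conv, conv_dist_density); it rests on Fourier inversion
    on the Schwartz space (fourierK), which is derived from the Gaussian being
    its own transform and a dilation argument.

    Uniqueness is a density argument.  If q < oo, then Schwartz functions are
    dense in the weighted space L^q (schwartz_dense), and therefore in FL^q_(w)
    because the Fourier transform is a bijection of the Schwartz space
    (FL_schwartz_dense).  Two extensions agree on pairs of Schwartz functions
    and, when one exponent is infinite, on pairs of a Schwartz function and an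
    arbitrary element; continuity does the rest.  When q1 = oo, say, only the
    second argument is approximated.

    Both schwartz_separating and schwartz_dense are instances of one monotone
    class theorem (monotone_class): a linear class of functions that contains
    the Schwartz functions and is closed under dominated pointwise limits
    contains all measurable functions of its domain. *)

Local Open Scope classical_set_scope.
Local Open Scope ring_scope.

(** * Lebesgue measure on row vectors *)

(** Open sets are countable unions of rational boxes, which are measurable
    for the sigma-algebra generated by the coordinates. *)
Lemma open_measurable_rV (R : realType) d (U : set 'rV[R]_d) :
  open U -> measurable U.
Proof.
move=> oU.
pose box (k : 'rV[rat]_d * nat) : set 'rV[R]_d :=
  \bigcap_(i in setT) (rV_coord i @^-1` ball (ratr (k.1 0 i) : R) (k.2.+1%:R^-1)).
have mbox k : measurable (box k).
  apply: fin_bigcap_measurable => // i _.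
  rewrite -[X in measurable X]setTI; apply: measurable_rV_coord => //.
  by apply: open_measurable; exact: ball_open.
have -> : U = \bigcup_(k in [set k | box k `<=` U]) box k.
  apply/seteqP; split => [x Ux|x [k]]; last by move=> kU /kU.
  have /nbhs_ballP[e /= e0 eU] : nbhs x U by exact: open_nbhs_nbhs.
  have [n ne] : exists n : nat, n.+1%:R^-1 < e / 2.
    have [n _ hn] := near_infty_natSinv_lt (PosNum (divr_gt0 e0 (ltr0n R 2))).
    by exists n; exact: (hn n (leqnn n)).
  have hq i : exists q : rat, `|ratr q - x 0 i| < n.+1%:R^-1.
    have : x 0 i - n.+1%:R^-1 < x 0 i + n.+1%:R^-1.
      have : 0 < n.+1%:R^-1 :> R by rewrite invr_gt0.
      by set u := (_^-1) => h; lra.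
    move=> /rat_in_itvoo[q]; rewrite in_itv/= => /andP[q1 q2].
    exists q; rewrite ltr_norml; move: q1 q2; set u := (_^-1) => q1 q2.
    by apply/andP; split; lra.
  exists (\row_i projT1 (cid (hq i)), n).
    move=> y /= yb; apply: eU; split=> // i j; rewrite (ord1 i).
    have := yb j I; rewrite /= mxE; case: cid => q /= hqx.
    rewrite /ball/= /rV_coord => hy.
    have -> : x 0 j - y 0 j = (ratr q - y 0 j) - (ratr q - x 0 j) by ring.
    apply: (le_lt_trans (ler_normB _ _)).
    by move: ne hy hqx; set u := (_^-1) => *; lra.
  move=> j _ /=; rewrite mxE; case: cid => q /= hqx.
  by rewrite /ball/= /rV_coord.
rewrite bigcup_mkcond; apply: countable_bigcupT_measurable => // k.
by case: ifP => // _; exact: mbox.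
Qed.

Lemma continuous_measurable_rV (R : realType) d (f : 'rV[R]_d -> R) :
  continuous f -> measurable_fun setT f.
Proof.
move=> /continuousP cf; apply: (measurability _ (RGenOpens.measurableE R)).
move=> _ [B [a [b ->]] <-]; rewrite setTI; apply: open_measurable_rV.
exact/cf/interval_open.
Qed.

Section tonelli_step.
Context {R : realType} (n : nat).
Local Open Scope ereal_scope.

(** The measure on row vectors is defined by recursion on the dimension;
    this Tonelli step is what all computations with it are reduced to. *)
Lemma ge0_integral_rVS (f : 'rV[R]_n.+1 -> \bar R) :
  measurable_fun setT f -> (forall x, 0 <= f x) ->
  \int[lebesgue_rV n.+1]_x f x =
  \int[lebesgue_measure]_t \int[lebesgue_rV n]_x f (rV_cons (t, x)).
Proof.
move=> mf f0.
rewrite [LHS](@ge0_integral_pushforward _ _ _ _ _ _ (@measurable_rV_cons R n) _ setT f)//.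
rewrite preimage_setT fubini_tonelli1//=.
by apply: measurableT_comp => //; exact: measurable_rV_cons.
Qed.

Lemma integral_rV0 (f : 'rV[R]_0 -> \bar R) :
  measurable_fun setT f -> \int[lebesgue_rV 0]_x f x = f 0%R.
Proof. by move=> mf; rewrite integral_dirac// diracT mul1e. Qed.

End tonelli_step.

Lemma rV_cons0 (R : realType) n (p : measurableTypeR R * 'rV[R]_n) :
  rV_cons p 0 ord0 = p.1.
Proof. by rewrite mxE unlift_none. Qed.

Lemma rV_consS (R : realType) n (p : measurableTypeR R * 'rV[R]_n) i :
  rV_cons p 0 (lift ord0 i) = p.2 0 i.
Proof. by rewrite mxE liftK. Qed.

Lemma measurable_rV_consr (R : realType) n (t : measurableTypeR R) :
  measurable_fun setT (fun x : 'rV[R]_n => rV_cons (t, x)).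
Proof.
apply: measurable_fun_rV => i; case: (unliftP ord0 i) => [j|] ->.
- rewrite (_ : _ \o _ = rV_coord j); first exact: measurable_rV_coord.
  by apply/funext => p /=; rewrite /rV_coord rV_consS.
- rewrite (_ : _ \o _ = cst t) //.
  by apply/funext => p /=; rewrite /rV_coord rV_cons0.
Qed.

Section prod_integral.
Context {R : realType}.
Variable f : R -> R.
Hypotheses (mf : measurable_fun setT f) (f0 : forall t, 0 <= f t).

Lemma measurable_prod_rV d :
  measurable_fun setT (fun x : 'rV[R]_d => \prod_(i < d) f (x 0 i)).
Proof.
apply: measurable_prod => i _; apply: measurableT_comp => //.
exact: measurable_rV_coord.
Qed.

Lemma integral_prod_rV (c : R) d :
  (\int[lebesgue_measure]_t (f t)%:E = c%:E)%E ->
  (\int[lebesgue_rV d]_x (\prod_(i < d) f (x 0 i))%:E = (c ^+ d)%:E)%E.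
Proof.
move=> fc; elim: d => [|d IH].
  rewrite integral_rV0 ?big_ord0//.
  apply/measurable_EFinP; exact: measurable_prod_rV.
rewrite ge0_integral_rVS; last 2 first.
- apply/measurable_EFinP; exact: measurable_prod_rV.
- by move=> x; rewrite lee_fin prodr_ge0.
under eq_integral => t _.
  under eq_integral => x _.
    rewrite big_ord_recl rV_cons0 /= EFinM.
    under eq_bigr do rewrite rV_consS /=.
    over.
  rewrite ge0_integralZl//; last 3 first.
  - apply/measurable_EFinP; exact: measurable_prod_rV.
  - by move=> x _; rewrite lee_fin prodr_ge0.
  - by rewrite lee_fin.
  rewrite IH.
  over.
rewrite ge0_integralZr//.
- by rewrite fc exprS EFinM.
- exact/measurable_EFinP.
- by move=> t _; rewrite lee_fin.
- rewrite lee_fin exprn_ge0// -lee_fin -fc; apply: integral_ge0 => t _.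
  by rewrite lee_fin.
Qed.

End prod_integral.

Section affine.
Context {R : realType}.
Local Open Scope ereal_scope.

Let measurable_affine (a b : R) : measurable_fun setT
  (fun t : measurableTypeR R => (a * t + b)%R : measurableTypeR R).
Proof. by apply: measurable_funD => //; exact: measurable_funM. Qed.

(** Both sides, suitably normalised, are measures giving each half-open
    interval its length, so uniqueness of Lebesgue measure applies. *)
Lemma lebesgue_measure_affine (a b : R) : (a != 0)%R ->
  forall A : set (measurableTypeR R), measurable A ->
  lebesgue_measure ((fun t : measurableTypeR R => a * t + b)%R @^-1` A) =
  (`|a|^-1)%:E * lebesgue_measure A.
Proof.
move=> a0 A mA.
have na0 : (0 <= `|a|)%R by [].
pose g := (fun t : measurableTypeR R => (a * t + b)%R : measurableTypeR R).
have mg : measurable_fun setT g by exact: measurable_affine.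
suff -> : lebesgue_measure A =
    mscale (NngNum na0) (pushforward lebesgue_measure g) A.
  by rewrite /mscale/= muleA -EFinM mulVf ?mul1e// normr_eq0.
move=> m; apply: lebesgue_measure_unique => // _ [[u v] /= uv <-].
rewrite /mscale/= /pushforward.
have [a_gt0|a_le0] := ltP 0%R a.
  have -> : g @^-1` `]u, v]%classic = `]((u - b) / a)%R, ((v - b) / a)%R]%classic.
    apply/seteqP; split => t; rewrite /g/= !in_itv/=.
      by rewrite ltr_pdivrMr// ler_pdivlMr// => /andP[? ?]; apply/andP; split; lra.
    by rewrite ltr_pdivrMr// ler_pdivlMr// => /andP[? ?]; apply/andP; split; lra.
  rewrite !lebesgue_measure_itv/= !lte_fin ltr_pM2r ?invr_gt0// ltrD2r.
  case: ifPn => _; last by rewrite mule0.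
  by rewrite gtr0_norm// -!EFinB -EFinM; congr EFin; field.
have {a_le0}a_lt0 : (a < 0)%R by rewrite lt_neqAle a0.
have -> : g @^-1` `]u, v]%classic = `[((v - b) / a)%R, ((u - b) / a)%R[%classic.
  apply/seteqP; split => t; rewrite /g/= !in_itv/=.
    by rewrite ltr_ndivlMr// ler_ndivrMr// => /andP[? ?]; apply/andP; split; lra.
  by rewrite ltr_ndivlMr// ler_ndivrMr// => /andP[? ?]; apply/andP; split; lra.
rewrite !lebesgue_measure_itv/= !lte_fin ltr_nM2r ?invr_lt0// ltrD2r.
case: ifPn => _; last by rewrite mule0.
by rewrite ltr0_norm// -!EFinB -EFinM; congr EFin; field.
Qed.

Lemma ge0_integral_affine1 (a b : R) (f : measurableTypeR R -> \bar R) :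
  (a != 0)%R -> measurable_fun setT f -> (forall t, 0 <= f t) ->
  \int[lebesgue_measure]_t f (a * t + b)%R =
  (`|a|^-1)%:E * \int[lebesgue_measure]_t f t.
Proof.
move=> a0 mf f0.
pose g := (fun t : measurableTypeR R => (a * t + b)%R : measurableTypeR R).
have mg : measurable_fun setT g by exact: measurable_affine.
have ia0 : (0 <= `|a|^-1)%R by rewrite invr_ge0.
transitivity (\int[pushforward lebesgue_measure g]_t f t).
  by rewrite ge0_integral_pushforward.
rewrite -(ge0_integral_mscale lebesgue_measure measurableT (NngNum ia0))//.
by apply: eq_measure_integral => A mA _; exact: lebesgue_measure_affine.
Qed.

Lemma measurable_affine_rV d (a : R) (b : 'rV[R]_d) :
  measurable_fun setT (fun x : 'rV[R]_d => (a *: x + b)%R).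
Proof.
apply: measurable_fun_rV => i.
rewrite (_ : _ \o _ = (fun t => a * t + b ord0 i)%R \o rV_coord i); last first.
  by apply/funext => x; rewrite /rV_coord/= !mxE.
apply: measurableT_comp; last exact: measurable_rV_coord.
exact: measurable_affine.
Qed.

Lemma rV_affine_cons n (a : R) (b : 'rV[R]_n.+1) t (x : 'rV[R]_n) :
  (a *: rV_cons (t, x) + b =
  rV_cons (a * t + b ord0 ord0, a *: x + (rV_uncons b).2))%R.
Proof.
apply/rowP => i; rewrite !mxE.
by case: (unliftP ord0 i) => [j|] -> //=; rewrite !mxE.
Qed.

Lemma ge0_integral_affine d (a : R) (b : 'rV[R]_d) (f : 'rV[R]_d -> \bar R) :
  (a != 0)%R -> measurable_fun setT f -> (forall x, 0 <= f x) ->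
  \int[lebesgue_rV d]_x f (a *: x + b)%R =
  ((`|a| ^- d)%R)%:E * \int[lebesgue_rV d]_x f x.
Proof.
move=> a0; elim: d b f => [|d IH] b f mf f0.
  rewrite !integral_rV0//; first by rewrite expr0 invr1 mul1e; congr f; apply/rowP => -[].
  exact: (measurableT_comp mf (measurable_affine_rV _ _)).
have ia0 n : (0 <= `|a| ^- n)%R by rewrite invr_ge0 exprn_ge0.
rewrite !ge0_integral_rVS//; last first.
  exact: (measurableT_comp mf (measurable_affine_rV _ _)).
pose F t := \int[lebesgue_rV d]_x f (rV_cons (t, x)).
have mF : measurable_fun setT F.
  apply: (@measurable_fun_fubini_tonelli_F _ _ _ _ _ _ (f \o (@rV_cons R d))) => //.
    by apply: measurableT_comp => //; exact: measurable_rV_cons.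
  by move=> x; exact: f0.
have F0 t : 0 <= F t by exact: integral_ge0.
under eq_integral => t _.
  under eq_integral do rewrite rV_affine_cons.
  rewrite (IH _ (fun x => f (rV_cons (_, x))))//; last first.
    by apply: measurableT_comp => //; exact: measurable_rV_consr.
  over.
rewrite (@ge0_integralZl_EFin _ _ _ lebesgue_measure _ measurableT
  (fun t => F (a * t + b ord0 ord0)%R) (fun t _ => F0 _) _ _ (ia0 d))//; last first.
  exact: (measurableT_comp mF (measurable_affine _ _)).
rewrite (ge0_integral_affine1 _ _ mF)// muleA -EFinM.
by rewrite exprS invfM mulrC.
Qed.

Lemma integrable_affine d (a : R) (b : 'rV[R]_d) (f : 'rV[R]_d -> \bar R) :
  (a != 0)%R -> (lebesgue_rV d).-integrable setT f ->
  (lebesgue_rV d).-integrable setT (fun x => f (a *: x + b)%R).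
Proof.
move=> a0 /integrableP[mf foo]; apply/integrableP; split.
  exact: (measurableT_comp mf (measurable_affine_rV _ _)).
rewrite (ge0_integral_affine _ a0 (measurableT_comp (@abse_measurable _ setT) mf))//.
  by rewrite lte_mul_pinfty// lee_fin invr_ge0 exprn_ge0.
by move=> x; exact: abse_ge0.
Qed.

Lemma integral_affine d (a : R) (b : 'rV[R]_d) (f : 'rV[R]_d -> \bar R) :
  (a != 0)%R -> (lebesgue_rV d).-integrable setT f ->
  \int[lebesgue_rV d]_x f (a *: x + b)%R =
  ((`|a| ^- d)%R)%:E * \int[lebesgue_rV d]_x f x.
Proof.
move=> a0 fi; have /integrableP[mf foo] := fi.
rewrite integralE.
under eq_integral do rewrite funepos_comp/=.
under [X in _ - X]eq_integral do rewrite funeneg_comp/=.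
rewrite (ge0_integral_affine _ a0 (measurable_funepos mf))//.
rewrite (ge0_integral_affine _ a0 (measurable_funeneg mf))//.
rewrite -muleBr//; first by rewrite -integralE.
exact: integrable_add_def.
Qed.

End affine.

Section decay.
Context {R : realType} (d : nat).

(** An integrable weight that is a product of one-variable functions, so
    that its integral is computed coordinatewise, and that is bounded below
    by a negative power of 1 + |x|. *)
Definition decay (x : 'rV[R]_d) : R := \prod_(i < d) (1 + x 0 i ^+ 2)^-1.

Lemma decay_gt0 x : 0 < decay x.
Proof. by apply: prodr_gt0 => i _; rewrite invr_gt0 ltr_wpDr ?sqr_ge0. Qed.

Lemma integrable_decay : (lebesgue_rV d).-integrable setT (EFin \o decay).
Proof.
have mf : measurable_fun setT (fun t : R => (1 + t ^+ 2)^-1).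
  apply: continuous_measurable_fun => x.
  exact: (@continuous_oneDsqrV R x).
have f0 (t : R) : 0 <= (1 + t ^+ 2)^-1 by rewrite invr_ge0 addr_ge0 ?sqr_ge0.
apply/integrableP; split.
  by apply/measurable_EFinP; exact: (measurable_prod_rV mf).
under eq_integral do rewrite gee0_abs ?lee_fin ?ltW ?decay_gt0//.
rewrite (@integral_prod_rV _ _ mf f0 pi) ?ltry//.
rewrite (ge0_symfun_integralT _)//=; last 2 first.
- by move=> x; exact: (@continuous_oneDsqrV R x).
- by move=> x; rewrite /= sqrrN.
rewrite (_ : [set x | _] = `[0, +oo[%classic); last first.
  by apply/seteqP; split => x/=; rewrite in_itv/= andbT.
have := @integral0y_oneDsqr R; rewrite /oneDsqr => ->.
by rewrite -EFinM mulrC divfK ?ltry.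
Qed.

Lemma measurable_decay : measurable_fun setT (decay).
Proof. by have /integrableP[/measurable_EFinP] := integrable_decay. Qed.

Lemma decay_le1 x : decay x <= 1.
Proof.
apply: prodr_ile1 => i _; have h : 0 < 1 + x 0 i ^+ 2 by rewrite ltr_wpDr ?sqr_ge0.
by rewrite invr_ge0 (ltW h) invf_le1// lerDl sqr_ge0.
Qed.

Lemma normrV_coord (x : 'rV[R]_d) i : `|x 0 i| <= `|x|.
Proof.
rewrite [leRHS]mx_normrE.
exact: (le_bigmax 0 (fun ij => `|x ij.1 ij.2|) (ord0, i)).
Qed.

Lemma decay_ge (x : 'rV[R]_d) : 1 <= (1 + `|x|) ^+ (2 * d) * decay x.
Proof.
rewrite /decay exprM -[X in _ ^+ X]card_ord -prodr_const -big_split/=.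
apply: (big_ind (fun t => 1 <= t)) => // [u v|i _]; first exact: mulr_ege1.
have h : 0 < 1 + x 0 i ^+ 2 by rewrite ltr_wpDr ?sqr_ge0.
rewrite ler_pdivlMr// mul1r -[x 0 i ^+ 2]real_normK ?num_real//.
have := normrV_coord x i; have := normr_ge0 (x 0 i); nra.
Qed.

End decay.

(** * Complex-valued functions and their integrals *)

Section cplx.
Context {R : realType}.
Implicit Types (z w : R[i]) (r : R).

Lemma cReM z w : complex.Re (z * w) =
  complex.Re z * complex.Re w - complex.Im z * complex.Im w.
Proof. by case: z w => a b [c e]. Qed.

Lemma cImM z w : complex.Im (z * w) =
  complex.Re z * complex.Im w + complex.Im z * complex.Re w.
Proof. by case: z w => a b [c e]. Qed.

Lemma cReD z w : complex.Re (z + w) = complex.Re z + complex.Re w.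
Proof. by case: z w => a b [c e]. Qed.

Lemma cImD z w : complex.Im (z + w) = complex.Im z + complex.Im w.
Proof. by case: z w => a b [c e]. Qed.

Lemma cReN z : complex.Re (- z) = - complex.Re z.
Proof. by case: z. Qed.

Lemma cImN z : complex.Im (- z) = - complex.Im z.
Proof. by case: z. Qed.

Lemma complexP z w :
  complex.Re z = complex.Re w -> complex.Im z = complex.Im w -> z = w.
Proof. by case: z w => a b [c e] /= -> ->. Qed.

Lemma cnormE z : cnorm z = Num.sqrt (complex.Re z ^+ 2 + complex.Im z ^+ 2).
Proof. by case: z. Qed.

Lemma normr_Re_le z : `|complex.Re z| <= cnorm z.
Proof.
by rewrite cnormE -sqrtr_sqr ler_sqrt ?addr_ge0 ?sqr_ge0// lerDl sqr_ge0.
Qed.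

Lemma normr_Im_le z : `|complex.Im z| <= cnorm z.
Proof.
by rewrite cnormE -sqrtr_sqr ler_sqrt ?addr_ge0 ?sqr_ge0// lerDr sqr_ge0.
Qed.

Lemma cnorm_real r : cnorm r%:C%C = `|r|.
Proof. by rewrite cnormE/= expr0n addr0 sqrtr_sqr. Qed.

Lemma cnorm_le z : cnorm z <= `|complex.Re z| + `|complex.Im z|.
Proof.
have zE : z = (complex.Re z)%:C%C + (complex.Im z)%:C%C * ('i)%C.
  by case: z => a b; apply: complexP => /=; rewrite ?cReD ?cImD ?cReM ?cImM/=; ring.
rewrite [z in cnorm z]zE.
apply: le_trans (cnormD _ _) _; rewrite cnormM !cnorm_real.
have -> : cnorm ('i)%C = 1 :> R by rewrite cnormE/= expr0n add0r expr1n sqrtr1.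
by rewrite mulr1.
Qed.

Lemma cnorm0 : cnorm (0 : R[i]) = 0.
Proof. exact: Normc.normc0. Qed.

Lemma cnorm_eq0 z : cnorm z = 0 -> z = 0.
Proof. exact: Normc.eq0_normc. Qed.

Lemma cnormN z : cnorm (- z) = cnorm z.
Proof. by case: z => a b; rewrite !cnormE /= !sqrrN. Qed.

Lemma cnorm_distC z w : cnorm (z - w) = cnorm (w - z).
Proof. by rewrite -cnormN opprB. Qed.

Lemma cnorm1 : cnorm (1 : R[i]) = 1.
Proof. exact: Normc.normc1. Qed.

Lemma expiD (s t : R) : expi (s + t) = expi s * expi t.
Proof.
apply: complexP; rewrite ?cReM ?cImM/=; first by rewrite cosD.
by rewrite sinD addrC.
Qed.

Lemma expi0 : expi (0 : R) = 1.
Proof. by rewrite /expi cos0 sin0. Qed.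

Lemma cnorm_expi (t : R) : cnorm (expi t) = 1.
Proof. by rewrite cnormE/= cos2Dsin2 sqrtr1. Qed.

End cplx.

Section cmeasurable_theory.
Context d (T : measurableType d) {R : realType}.

(** The notion cmeasurable on an arbitrary measurable domain; products of
    two spaces of row vectors are needed for the theorem of Fubini. *)
Definition cmeasurableT (f : T -> R[i]) : Prop :=
  measurable_fun setT (fun x => complex.Re (f x)) /\
  measurable_fun setT (fun x => complex.Im (f x)).

Lemma cmeasurable_cst (c : R[i]) : cmeasurableT (fun=> c).
Proof. by split; exact: measurable_cst. Qed.

Lemma cmeasurableD f g : cmeasurableT f -> cmeasurableT g ->
  cmeasurableT (fun x => f x + g x).
Proof.
move=> [f1 f2] [g1 g2]; split.
  by under eq_fun do rewrite cReD; exact: measurable_funD.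
by under eq_fun do rewrite cImD; exact: measurable_funD.
Qed.

Lemma cmeasurableM f g : cmeasurableT f -> cmeasurableT g ->
  cmeasurableT (fun x => f x * g x).
Proof.
move=> [f1 f2] [g1 g2]; split.
  by under eq_fun do rewrite cReM; apply: measurable_funB; exact: measurable_funM.
by under eq_fun do rewrite cImM; apply: measurable_funD; exact: measurable_funM.
Qed.

Lemma cmeasurable_real (f : T -> R) : measurable_fun setT f ->
  cmeasurableT (fun x => (f x)%:C%C).
Proof. by move=> mf; split => //=; exact: measurable_cst. Qed.

Lemma cmeasurableN f : cmeasurableT f -> cmeasurableT (fun x => - f x).
Proof.
move=> mf; under eq_fun do rewrite -mulN1r.
by apply: cmeasurableM => //; exact: cmeasurable_cst.
Qed.

Lemma cmeasurableB f g : cmeasurableT f -> cmeasurableT g ->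
  cmeasurableT (fun x => f x - g x).
Proof. by move=> mf mg; apply: cmeasurableD => //; exact: cmeasurableN. Qed.

Lemma measurable_cnorm (f : T -> R[i]) : cmeasurableT f ->
  measurable_fun setT (fun x => cnorm (f x)).
Proof.
move=> [f1 f2].
rewrite (_ : (fun x => _) = Num.sqrt \o
  (fun x => complex.Re (f x) ^+ 2 + complex.Im (f x) ^+ 2)); last first.
  by apply/funext => x; rewrite cnormE.
apply: measurableT_comp.
  by apply: continuous_measurable_fun; exact: sqrt_continuous.
by apply: measurable_funD; exact: measurable_funX.
Qed.

Lemma cmeasurable_expi (f : T -> R) : measurable_fun setT f ->
  cmeasurableT (fun x => expi (f x)).
Proof.
by move=> mf; split => /=; apply: measurableT_comp => //;
  apply: continuous_measurable_fun; [exact: continuous_cos|exact: continuous_sin].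
Qed.

Lemma cmeasurable_comp d' (T' : measurableType d') (f : T -> R[i])
    (h : T' -> T) : cmeasurableT f -> measurable_fun setT h ->
  measurable_fun setT (fun x => complex.Re (f (h x))) /\
  measurable_fun setT (fun x => complex.Im (f (h x))).
Proof.
by move=> [f1 f2] mh; split; [apply: (measurableT_comp f1)|apply: (measurableT_comp f2)].
Qed.

End cmeasurable_theory.

Section cintegral_theory.
Context {R : realType} {d : nat}.
Local Notation mu := (@lebesgue_rV R d).
Implicit Types (f g : 'rV[R]_d -> R[i]).

Lemma cintegrable_measurable f : cintegrable f -> cmeasurable f.
Proof.
by move=> [/integrableP[/measurable_EFinP f1 _] /integrableP[/measurable_EFinP f2 _]].
Qed.

Lemma cintegrable_le f (b : 'rV[R]_d -> R) : cmeasurable f ->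
  mu.-integrable setT (EFin \o b) -> (forall x, cnorm (f x) <= b x) ->
  cintegrable f.
Proof.
move=> [f1 f2] bi fb; split; apply: (le_integrable measurableT _ _ bi).
- exact/measurable_EFinP.
- move=> x _; rewrite /= lee_fin; apply: le_trans (normr_Re_le _) _.
  exact: (le_trans (fb x) (ler_norm _)).
- exact/measurable_EFinP.
- move=> x _; rewrite /= lee_fin; apply: le_trans (normr_Im_le _) _.
  exact: (le_trans (fb x) (ler_norm _)).
Qed.

Lemma integrable_cnorm f : cintegrable f ->
  mu.-integrable setT (fun x => (cnorm (f x))%:E).
Proof.
move=> fi; have mf := cintegrable_measurable fi; have [i1 i2] := fi.
have := integrableD measurableT (integrable_norm i1) (integrable_norm i2).
apply: le_integrable => //; first exact/measurable_EFinP/measurable_cnorm.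
move=> x _; rewrite /= lee_fin ger0_norm ?cnorm_ge0// ger0_norm ?addr_ge0//.
exact: cnorm_le.
Qed.

Lemma cintegrable_linear (a : R[i]) f g : cintegrable f -> cintegrable g ->
  cintegrable (fun x => a * f x + g x).
Proof.
move=> fi gi.
apply: (@cintegrable_le _ (fun x => cnorm a * cnorm (f x) + cnorm (g x))).
- apply: cmeasurableD; last exact: cintegrable_measurable.
  apply: cmeasurableM; first exact: cmeasurable_cst.
  exact: cintegrable_measurable.
- have := integrableD measurableT (integrableZl measurableT (cnorm a) (integrable_cnorm fi)) (integrable_cnorm gi).
  by [].
- by move=> x; rewrite -cnormM; exact: cnormD.
Qed.

Lemma cintegrableZ (a : R[i]) f : cintegrable f ->
  cintegrable (fun x => a * f x).
Proof.
move=> fi; have := cintegrable_linear a fi (cintegrable_linear (-1) fi fi).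
by under eq_fun do rewrite mulN1r addNr addr0.
Qed.

Lemma cintegrable_eq f g : f =1 g -> cintegrable f -> cintegrable g.
Proof. by move=> /funext ->. Qed.

Lemma eq_cintegral f g : f =1 g -> cintegral f = cintegral g.
Proof. by move=> /funext ->. Qed.

Lemma cintegral_linear (a : R[i]) f g : cintegrable f -> cintegrable g ->
  cintegral (fun x => a * f x + g x) = a * cintegral f + cintegral g.
Proof.
move=> [f1 f2] [g1 g2].
have Z (r : R) (h : 'rV[R]_d -> R) : mu.-integrable setT (EFin \o h) ->
    mu.-integrable setT (EFin \o (fun x => r * h x)).
  by move=> hi; exact: (integrableZl measurableT r hi).
apply: complexP.
  rewrite cReD cReM /=; under eq_Rintegral do rewrite cReD cReM.
  have i1 := Z (complex.Re a) _ f1; have i2 := Z (complex.Im a) _ f2.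
  rewrite RintegralD//; last exact: (integrableB measurableT i1 i2).
  by rewrite RintegralB// !RintegralZl.
rewrite cImD cImM /=; under eq_Rintegral do rewrite cImD cImM.
have i1 := Z (complex.Re a) _ f2; have i2 := Z (complex.Im a) _ f1.
rewrite RintegralD//; last exact: (integrableD measurableT i1 i2).
by rewrite RintegralD// !RintegralZl.
Qed.

Lemma cintegral0 : cintegral (fun _ : 'rV[R]_d => 0 : R[i]) = 0.
Proof. by rewrite /cintegral/= Rintegral_cst// mul0r. Qed.

Lemma cintegrable0 : cintegrable (fun _ : 'rV[R]_d => 0 : R[i]).
Proof. by split; exact: integrable0. Qed.

Lemma cintegralZ (a : R[i]) f : cintegrable f ->
  cintegral (fun x => a * f x) = a * cintegral f.
Proof.
move=> fi; rewrite -[RHS]addr0 -cintegral0 -cintegral_linear//; last exact: cintegrable0.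
by under [in RHS]eq_fun do rewrite addr0.
Qed.

Lemma cintegralB f g : cintegrable f -> cintegrable g ->
  cintegral (fun x => f x - g x) = cintegral f - cintegral g.
Proof.
move=> fi gi; rewrite addrC -mulN1r -cintegral_linear//.
by under [in RHS]eq_fun do rewrite mulN1r addrC.
Qed.

(** Bounding real and imaginary parts separately costs the factor 2, which
    is harmless for every use made of this estimate. *)
Lemma cnorm_cintegral_le f (b : 'rV[R]_d -> R) : cintegrable f ->
  mu.-integrable setT (EFin \o b) -> (forall x, cnorm (f x) <= b x) ->
  cnorm (cintegral f) <= 2 * \int[mu]_x b x.
Proof.
move=> [f1 f2] bi fb; apply: le_trans (cnorm_le _) _.
rewrite mulr2n mulrDl mul1r lerD//=.
  apply: le_trans (le_normr_Rintegral _ _) _ => //.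
  apply: le_Rintegral => //; first exact: integrable_norm.
  by move=> x _; exact: le_trans (normr_Re_le _) (fb x).
apply: le_trans (le_normr_Rintegral _ _) _ => //.
apply: le_Rintegral => //; first exact: integrable_norm.
by move=> x _; exact: le_trans (normr_Im_le _) (fb x).
Qed.

Lemma ae_eq_cintegral f g : cmeasurable f -> cmeasurable g ->
  {ae mu, forall x, f x = g x} -> cintegral f = cintegral g.
Proof.
move=> [f1 f2] [g1 g2] fg; apply: complexP => /=; congr fine.
  apply: ae_eq_integral => //; [exact/measurable_EFinP..|].
  by apply: filterS fg => x ->.
apply: ae_eq_integral => //; [exact/measurable_EFinP..|].
by apply: filterS fg => x ->.
Qed.

Lemma cintegrable_affine (a : R) b f : a != 0 -> cintegrable f ->
  cintegrable (fun x => f (a *: x + b)).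
Proof. by move=> a0 [f1 f2]; split; [apply: (integrable_affine _ a0 f1)|apply: (integrable_affine _ a0 f2)]. Qed.

Lemma cintegral_affine (a : R) b f : a != 0 -> cintegrable f ->
  cintegral (fun x => f (a *: x + b)) = (`|a| ^- d)%:C%C * cintegral f.
Proof.
move=> a0 [f1 f2]; apply: complexP; rewrite ?cReM ?cImM/= mul0r ?subr0 ?addr0.
  rewrite /Rintegral (integral_affine _ a0 f1) fineM//.
  exact: integrable_fin_num.
rewrite /Rintegral (integral_affine _ a0 f2) fineM//.
exact: integrable_fin_num.
Qed.

Section fubini.
Variables (a b : 'rV[R]_d -> R).
Hypotheses (ai : mu.-integrable setT (EFin \o a))
  (bi : mu.-integrable setT (EFin \o b)).
Hypotheses (a0 : forall x, 0 <= a x) (b0 : forall x, 0 <= b x).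

(** All double integrals below have kernels dominated by a product of two
    integrable functions, which makes integrability on the product space
    automatic. *)
Lemma Rintegral_Fubini (k : 'rV[R]_d -> 'rV[R]_d -> R) :
  measurable_fun setT (fun p : 'rV[R]_d * 'rV[R]_d => k p.1 p.2) ->
  (forall x y, `|k x y| <= a x * b y) ->
  mu.-integrable setT (fun x => (\int[mu]_y k x y)%:E) /\
  \int[mu]_x \int[mu]_y k x y = \int[mu]_y \int[mu]_x k x y.
Proof.
move=> mk kab.
pose K (p : 'rV[R]_d * 'rV[R]_d) := (k p.1 p.2)%:E.
have mK : measurable_fun setT K by exact/measurable_EFinP.
have i1 x : mu.-integrable setT (fun y => (k x y)%:E).
  apply: (le_integrable measurableT _ _ (integrableZl measurableT (a x) bi)).
    exact: (measurableT_comp mK (pair1_measurable x)).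
  by move=> y _; rewrite /= lee_fin (le_trans (kab x y)) ?ler_norm.
have i2 y : mu.-integrable setT (fun x => (k x y)%:E).
  apply: (le_integrable measurableT _ _ (integrableZr measurableT (b y) ai)).
    exact: (measurableT_comp mK (pair2_measurable y)).
  by move=> x _; rewrite /= lee_fin (le_trans (kab x y)) ?ler_norm.
have Ki : (mu \x mu)%E.-integrable setT K.
  apply/integrable12ltyP => //.
  have [ma mb] : measurable_fun setT a /\ measurable_fun setT b.
    by split; apply/measurable_EFinP; [case/integrableP: ai|case/integrableP: bi].
  pose ib : R := \int[mu]_y b y.
  have ibE : (\int[mu]_y (b y)%:E = ib%:E)%E.
    by rewrite /ib /Rintegral fineK//; exact: integrable_fin_num.
  apply: (@le_lt_trans _ _ (\int[mu]_x (ib%:E * (a x)%:E))%E); last first.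
    rewrite integralZl// lte_mul_pinfty ?lee_fin//.
    - by apply: Rintegral_ge0 => x _; exact: b0.
    - exact: integrable_lty.
  apply: ge0_le_integral => //.
  - by move=> x _; exact: integral_ge0.
  - apply: (@measurable_fun_fubini_tonelli_F _ _ _ _ _ _ (abse \o K)) => //.
    + exact: measurableT_comp.
    + by move=> x; exact: abse_ge0.
  - by apply: measurable_funeM; exact/measurable_EFinP.
  move=> x _; rewrite -ibE muleC -ge0_integralZl//; last 3 first.
  - exact/measurable_EFinP.
  - by move=> y _; rewrite lee_fin.
  - by rewrite lee_fin.
  apply: ge0_le_integral => //.
  - apply: measurableT_comp => //; exact: (measurableT_comp mK (pair1_measurable x)).
  - by apply: measurable_funeM; exact/measurable_EFinP.
  - by move=> y _; rewrite /= lee_fin.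
have FE x : (\int[mu]_y k x y)%:E = (\int[mu]_y K (x, y))%E.
  by rewrite /Rintegral fineK//; exact: integrable_fin_num.
have GE y : (\int[mu]_x k x y)%:E = (\int[mu]_x K (x, y))%E.
  by rewrite /Rintegral fineK//; exact: integrable_fin_num.
split.
  under eq_fun do rewrite FE.
  exact: (integrable_fubini_F Ki).
rewrite {1}/Rintegral [in RHS]/Rintegral.
under eq_integral do rewrite FE.
under [in RHS]eq_integral do rewrite GE.
by congr fine; exact: Fubini.
Qed.

Lemma cintegral_Fubini (k : 'rV[R]_d -> 'rV[R]_d -> R[i]) :
  cmeasurableT (fun p : 'rV[R]_d * 'rV[R]_d => k p.1 p.2) ->
  (forall x y, cnorm (k x y) <= a x * b y) ->
  cintegrable (fun x => cintegral (k x)) /\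
  cintegral (fun x => cintegral (k x)) =
  cintegral (fun y => cintegral (fun x => k x y)).
Proof.
move=> [k1 k2] kab.
have [|i1 e1] := @Rintegral_Fubini (fun x y => complex.Re (k x y)) k1.
  by move=> x y; exact: le_trans (normr_Re_le _) (kab x y).
have [|i2 e2] := @Rintegral_Fubini (fun x y => complex.Im (k x y)) k2.
  by move=> x y; exact: le_trans (normr_Im_le _) (kab x y).
by split; [split|rewrite /cintegral/= e1 e2].
Qed.

End fubini.

Lemma Rintegral_dct (f_ : nat -> 'rV[R]_d -> R) (f b : 'rV[R]_d -> R) :
  (forall n, measurable_fun setT (f_ n)) ->
  (forall x, f_ n x @[n --> \oo] --> f x) ->
  mu.-integrable setT (EFin \o b) -> (forall n x, `|f_ n x| <= b x) ->
  \int[mu]_x f_ n x @[n --> \oo] --> \int[mu]_x f x.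
Proof.
move=> mf cf bi fb.
have h : (\int[mu]_x (f_ n x)%:E)%E @[n --> \oo] --> (\int[mu]_x (f x)%:E)%E.
  apply: (@dominated_cvg _ _ _ mu setT measurableT _ _ (EFin \o b)) => //.
  - by move=> n; exact/measurable_EFinP.
  - by move=> x _; apply/fine_cvgP; split; [exact: nearW|exact: cf].
  - by move=> n x _; rewrite /= lee_fin.
apply: fine_cvg; rewrite /Rintegral fineK//.
have mlim : measurable_fun setT f.
  by apply: (measurable_fun_cvg (h := f_)) => // x _; exact: cf.
apply: integrable_fin_num => //.
apply: (le_integrable measurableT _ _ bi); first exact/measurable_EFinP.
move=> x _; rewrite /= lee_fin; apply: le_trans (ler_norm _).
have cn : `|f_ n x| @[n --> \oo] --> `|f x| by apply: cvg_norm; exact: cf.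
rewrite -(cvg_lim _ cn)//; apply: limr_le; first exact: cvgP cn.
exact: nearW.
Qed.

Lemma cvg_cnormP (u : nat -> R[i]) l :
  cnorm (u n - l) @[n --> \oo] --> 0 <->
  complex.Re (u n) @[n --> \oo] --> complex.Re l /\
  complex.Im (u n) @[n --> \oo] --> complex.Im l.
Proof.
split=> [/cvgrPdist_le h|[/cvgrPdist_le h1 /cvgrPdist_le h2]].
  split; apply/cvgrPdist_le => e /h; apply: filterS => n;
    rewrite sub0r normrN ger0_norm ?cnorm_ge0// cnorm_distC; apply: le_trans.
    by rewrite -cReN -cReD; exact: normr_Re_le.
  by rewrite -cImN -cImD; exact: normr_Im_le.
apply/cvgrPdist_le => e e0; have e2 : 0 < e / 2 by rewrite divr_gt0.
near=> n; rewrite sub0r normrN ger0_norm ?cnorm_ge0// cnorm_distC.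
apply: (le_trans (cnorm_le _)); rewrite cReD cImD cReN cImN (splitr e) lerD//.
  by near: n; exact: h1.
by near: n; exact: h2.
Unshelve. all: by end_near. Qed.

Lemma cintegral_dct (f_ : nat -> 'rV[R]_d -> R[i]) f (b : 'rV[R]_d -> R) :
  (forall n, cmeasurable (f_ n)) ->
  (forall x, cnorm (f_ n x - f x) @[n --> \oo] --> 0) ->
  mu.-integrable setT (EFin \o b) -> (forall n x, cnorm (f_ n x) <= b x) ->
  cnorm (cintegral (f_ n) - cintegral f) @[n --> \oo] --> 0.
Proof.
move=> mf cf bi fb; apply/cvg_cnormP; split.
  apply: (Rintegral_dct _ _ bi) => [n|x|n x]; first by case: (mf n).
    by have /cvg_cnormP[] := cf x.
  exact: le_trans (normr_Re_le _) (fb n x).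
apply: (Rintegral_dct _ _ bi) => [n|x|n x]; first by case: (mf n).
  by have /cvg_cnormP[] := cf x.
exact: le_trans (normr_Im_le _) (fb n x).
Qed.

Lemma cnorm_cvg_unique (u : nat -> R[i]) l l' :
  cnorm (u n - l) @[n --> \oo] --> 0 -> cnorm (u n - l') @[n --> \oo] --> 0 ->
  l = l'.
Proof.
move=> /cvg_cnormP[a1 a2] /cvg_cnormP[b1 b2]; apply: complexP.
  exact: (cvg_unique _ a1 b1).
exact: (cvg_unique _ a2 b2).
Qed.

Lemma ler_cnorm_dist (a b : R[i]) : `|cnorm a - cnorm b| <= cnorm (a - b).
Proof.
have h1 := cnormD (b - a) a; have h2 := cnormD (a - b) b.
rewrite !subrK in h1 h2; rewrite cnorm_distC in h1.
by rewrite ler_norml; apply/andP; split; lra.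
Qed.

Lemma cvg_cnorm (u : nat -> R[i]) l : cnorm (u n - l) @[n --> \oo] --> 0 ->
  cnorm (u n) @[n --> \oo] --> cnorm l.
Proof.
move=> /cvgrPdist_le h; apply/cvgrPdist_le => e /h; apply: filterS => n.
rewrite sub0r normrN ger0_norm ?cnorm_ge0//; apply: le_trans.
by rewrite distrC; exact: ler_cnorm_dist.
Qed.

Lemma cmeasurable_lim (f_ : nat -> 'rV[R]_d -> R[i]) f :
  (forall n, cmeasurable (f_ n)) ->
  (forall x, cnorm (f_ n x - f x) @[n --> \oo] --> 0) -> cmeasurable f.
Proof.
move=> mf cf; split.
  apply: (measurable_fun_cvg (h := fun n x => complex.Re (f_ n x))) => [n|x _].
    by case: (mf n).
  by have /cvg_cnormP[] := cf x.
apply: (measurable_fun_cvg (h := fun n x => complex.Im (f_ n x))) => [n|x _].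
  by case: (mf n).
by have /cvg_cnormP[] := cf x.
Qed.

End cintegral_theory.

(** * Derivatives along a line *)

Section directional.
Context {R : realType} {d : nat}.
Implicit Types (f g : 'rV[R]_d -> R) (x v : 'rV[R]_d).

Lemma mean_value0 (F dF : R -> R) : (forall t : R, is_derive t (1 : R) F (dF t)) ->
  forall h : R, exists2 u : R, `|u| <= `|h| & F h - F 0 = h * dF u.
Proof.
move=> FdF h.
have G t : is_derive t (1 : R) (fun s : R => F (s * h)) (dF (t * h) * h).
  apply: (@is_derive1_comp _ F (fun s => s * h)).
  apply: is_derive_eq; rewrite /GRing.scale/= ?mulr0 ?addr0 ?add0r ?mulr1//.
have [|c c01] := @MVT_segment R _ (fun t => dF (t * h) * h) 0 1 ler01 (fun t _ => G t).
  by apply: derivable_within_continuous => t _; case: (G t).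
rewrite mul1r mul0r subr0 mulr1 => E.
exists (c * h); last by rewrite E mulrC.
move: c01; rewrite in_itv/= => /andP[c0 c1].
by rewrite normrM ger0_norm// ler_piMl.
Qed.

Lemma is_derive_line f x v (t l : R) : is_derive (x + t *: v) v f l ->
  is_derive t 1 (fun s : R => f (x + s *: v)) l.
Proof.
move=> [df fl].
have E : (fun h : R => h^-1 *: (((fun s : R => f (x + s *: v)) \o shift t) (h *: 1) - f (x + t *: v)))
   = (fun h : R => h^-1 *: ((f \o shift (x + t *: v)) (h *: v) - f (x + t *: v))).
  apply/funext => h /=; congr (_ *: (f _ - _)).
  have -> : h%:A = h :> R by rewrite /GRing.scale/= mulr1.
  by rewrite scalerDl addrCA.
split; first by rewrite /derivable E.
by rewrite /derive E.
Qed.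

Lemma line_is_derive f x v (l : R) :
  is_derive (0 : R) 1 (fun s : R => f (x + s *: v)) l ->
  is_derive x v f l.
Proof.
move=> [df fl].
have E : (fun h : R => h^-1 *: ((f \o shift x) (h *: v) - f x)) =
  (fun h : R => h^-1 *: (((fun s : R => f (x + s *: v)) \o shift 0) (h *: 1) - f (x + 0 *: v))).
  apply/funext => h /=; have -> : h%:A = h :> R by rewrite /GRing.scale/= mulr1.
  by rewrite scale0r !addr0 [x + _]addrC.
split; first by rewrite /derivable E.
by rewrite /derive E.
Qed.

Lemma mean_value_line f (df : 'rV[R]_d -> R) v :
  (forall x, is_derive x v f (df x)) -> forall x (h : R),
  exists2 u : R, `|u| <= `|h| & f (x + h *: v) - f x = h * df (x + u *: v).
Proof.
move=> fdf x h.
have [|u uh E] := @mean_value0 (fun s => f (x + s *: v))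
    (fun s => df (x + s *: v)) _ h.
  by move=> t; exact: is_derive_line.
by exists u => //; rewrite -E scale0r addr0.
Qed.

(** A quadratic remainder bound is the form in which derivatives under the
    integral sign are established. *)
Lemma is_derive_quad f x v (l C : R) :
  (forall h : R, `|h| <= 1 -> `|f (x + h *: v) - f x - h * l| <= C * h ^+ 2) ->
  is_derive x v f l.
Proof.
move=> H.
have C0 : 0 <= C.
  by have := H 1; rewrite normr1 expr1n mulr1 => /(_ (lexx _)); apply: le_trans.
have cv : h^-1 *: ((f \o shift x) (h *: v) - f x) @[h --> 0^'] --> l.
  apply/cvgrPdist_le => e e0; near=> h.
  have h0 : h != 0 by near: h; exact: nbhs_dnbhs_neq.
  have h1 : `|h| <= 1 by near: h; apply: dnbhs0_le.
  have he : `|h| <= e / (C + 1) by near: h; apply: dnbhs0_le; rewrite divr_gt0// ltr_wpDl.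
  rewrite /= [_ *: v + x]addrC.
  have -> : l - h^-1 *: (f (x + h *: v) - f x) = - h^-1 * (f (x + h *: v) - f x - h * l).
    by rewrite -[h^-1 *: _]/(h^-1 * _); field.
  rewrite normrM normrN normfV ler_pdivrMl ?normr_gt0//.
  apply: (le_trans (H h h1)).
  rewrite -real_normK ?num_real// expr2 mulrA mulrC ler_pM2l ?normr_gt0//.
  move: he; rewrite ler_pdivlMr ?ltr_wpDl// => he.
  apply: le_trans he; rewrite mulrDr mulr1 mulrC lerDl//.
split; first by apply/cvg_ex; exists l.
exact: cvg_lim cv.
Unshelve. all: by end_near. Qed.

Lemma lipschitz_continuous f (C : R) :
  (forall x y, `|f x - f y| <= C * `|x - y|) -> continuous f.
Proof.
move=> H x; have Fx : Filter (nbhs (x : 'rV[R]_d)) by exact: nbhs_filter.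
apply/cvgrPdist_le => e e0; near=> y.
apply: (le_trans (H x y)).
have xy : `|x - y| <= e / (`|C| + 1).
  near: y; apply: cvgr_dist_le; first exact: cvg_id.
  by rewrite divr_gt0// ltr_wpDl.
move: xy; rewrite ler_pdivlMr ?ltr_wpDl// => xy.
apply: le_trans xy; rewrite mulrDr mulr1 mulrC.
apply: (@le_trans _ _ (`|x - y| * `|C|)); last by rewrite lerDl.
by rewrite ler_wpM2l// ler_norm.
Unshelve. all: by end_near. Qed.

End directional.

(** * Recognising Schwartz functions *)

Section pd.
Context {R : realType} {d : nat}.
Implicit Types (f g : 'rV[R]_d -> R[i]) (x : 'rV[R]_d).

(** The relation that g is the i-th partial derivative of f. As a relation
    it is stable under the algebraic operations without any side condition
    of differentiability. *)
Definition is_pd (i : 'I_d) f g : Prop := forall x,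
  is_derive x (delta_mx 0 i) (fun y => complex.Re (f y)) (complex.Re (g x)) /\
  is_derive x (delta_mx 0 i) (fun y => complex.Im (f y)) (complex.Im (g x)).

Definition ccontinuous f : Prop :=
  continuous (fun x => complex.Re (f x)) /\
  continuous (fun x => complex.Im (f x)).

Definition rapid f : Prop := forall N, exists M : R, forall x,
  (1 + `|x|) ^+ N * cnorm (f x) <= M.

Lemma ccontinuous_measurable f : ccontinuous f -> cmeasurable f.
Proof. by move=> [f1 f2]; split; exact: continuous_measurable_rV. Qed.

Lemma is_pdD i f f' g g' : is_pd i f f' -> is_pd i g g' ->
  is_pd i (fun x => f x + g x) (fun x => f' x + g' x).
Proof.
move=> hf hg x; have [f1 f2] := hf x; have [g1 g2] := hg x.
rewrite cReD cImD; split.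
  by under eq_fun do rewrite cReD; exact: is_deriveD.
by under eq_fun do rewrite cImD; exact: is_deriveD.
Qed.

Lemma is_pdM i f f' g g' : is_pd i f f' -> is_pd i g g' ->
  is_pd i (fun x => f x * g x) (fun x => f' x * g x + f x * g' x).
Proof.
move=> hf hg x; have [f1 f2] := hf x; have [g1 g2] := hg x.
rewrite cReD cImD !cReM !cImM; split.
  under eq_fun do rewrite cReM.
  apply: is_derive_eq.
  by rewrite /GRing.scale/=; ring.
under eq_fun do rewrite cImM.
apply: is_derive_eq.
by rewrite /GRing.scale/=; ring.
Qed.

Lemma is_pd_cst i (c : R[i]) : is_pd i (fun=> c) (fun=> 0).
Proof. by move=> x; split; exact: is_derive_cst. Qed.

Lemma is_pdZ i (c : R[i]) f f' : is_pd i f f' ->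
  is_pd i (fun x => c * f x) (fun x => c * f' x).
Proof.
move=> hf; have := is_pdM (is_pd_cst i c) hf.
by under [X in is_pd _ _ X]eq_fun do rewrite mul0r add0r.
Qed.

Lemma is_pd_quad i f g :
  (forall x, exists C : R, forall h : R, `|h| <= 1 ->
    cnorm (f (x + h *: delta_mx 0 i) - f x - h%:C%C * g x) <= C * h ^+ 2) ->
  is_pd i f g.
Proof.
move=> H x; have [C HC] := H x.
split; apply: is_derive_quad => h /HC; apply: le_trans.
  have -> : complex.Re (f (x + h *: delta_mx 0 i)) - complex.Re (f x) - h * complex.Re (g x) = complex.Re (f (x + h *: delta_mx 0 i) - f x - h%:C%C * g x).
    by rewrite !cReD !cReN cReM/= mul0r subr0.
  exact: normr_Re_le.
have -> : complex.Im (f (x + h *: delta_mx 0 i)) - complex.Im (f x) - h * complex.Im (g x) = complex.Im (f (x + h *: delta_mx 0 i) - f x - h%:C%C * g x).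
  by rewrite !cImD !cImN cImM/= mul0r addr0.
exact: normr_Im_le.
Qed.

Lemma ccontinuousD f g : ccontinuous f -> ccontinuous g ->
  ccontinuous (fun x => f x + g x).
Proof.
move=> [f1 f2] [g1 g2]; split=> x.
  by under eq_fun do rewrite cReD; exact: (cvgD (f1 x) (g1 x)).
by under eq_fun do rewrite cImD; exact: (cvgD (f2 x) (g2 x)).
Qed.

Lemma ccontinuousM f g : ccontinuous f -> ccontinuous g ->
  ccontinuous (fun x => f x * g x).
Proof.
move=> [f1 f2] [g1 g2]; split=> x.
  by under eq_fun do rewrite cReM; exact: (cvgB (cvgM (f1 x) (g1 x)) (cvgM (f2 x) (g2 x))).
by under eq_fun do rewrite cImM; exact: (cvgD (cvgM (f1 x) (g2 x)) (cvgM (f2 x) (g1 x))).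
Qed.

Lemma ccontinuous_cst (c : R[i]) : ccontinuous (fun=> c).
Proof. by split=> x; exact: cst_continuous. Qed.

Lemma ccontinuous_lipschitz f (C : R) :
  (forall x y, cnorm (f x - f y) <= C * `|x - y|) -> ccontinuous f.
Proof.
move=> H; split; apply: (@lipschitz_continuous _ _ _ C) => x y;
  apply: le_trans (H x y).
  by rewrite -cReN -cReD; exact: normr_Re_le.
by rewrite -cImN -cImD; exact: normr_Im_le.
Qed.

Lemma rapid_le f g (C : R) (k : nat) : rapid g ->
  (forall x, cnorm (f x) <= C * (1 + `|x|) ^+ k * cnorm (g x)) -> rapid f.
Proof.
move=> rg fg N; have [M HM] := rg (N + k)%N.
have C0 : 0 <= `|C| by [].
exists (`|C| * M) => x.
have p0 n : 0 <= (1 + `|x|) ^+ n by rewrite exprn_ge0// addr_ge0.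
apply: le_trans (ler_wpM2l (p0 N) (fg x)) _.
have -> : (1 + `|x|) ^+ N * (C * (1 + `|x|) ^+ k * cnorm (g x)) =
  C * ((1 + `|x|) ^+ (N + k) * cnorm (g x)) by rewrite exprD; ring.
apply: le_trans (ler_wpM2l C0 (HM x)).
by rewrite ler_wpM2r ?ler_norm// mulr_ge0// cnorm_ge0.
Qed.

Lemma rapidD f g : rapid f -> rapid g -> rapid (fun x => f x + g x).
Proof.
move=> rf rg N; have [M HM] := rf N; have [M' HM'] := rg N.
exists (M + M') => x; have p0 : 0 <= (1 + `|x|) ^+ N by rewrite exprn_ge0// addr_ge0.
apply: le_trans (ler_wpM2l p0 (cnormD _ _)) _.
by rewrite mulrDr lerD.
Qed.

Lemma pderivs_rcons s i (f f' : 'rV[R]_d -> R) :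
  (forall x, is_derive x (delta_mx 0 i) f (f' x)) ->
  pderivs (rcons s i) f = pderivs s f'.
Proof.
move=> ff'; rewrite /pderivs foldr_rcons; congr foldr.
by apply/funext => x; exact: derive_val.
Qed.

Lemma cpderivs_rcons s i f f' : is_pd i f f' ->
  cpderivs (rcons s i) f = cpderivs s f'.
Proof.
move=> ff'; apply/funext => x; rewrite /cpderivs.
by rewrite !(pderivs_rcons s (fun x => (ff' x).1)) !(pderivs_rcons s (fun x => (ff' x).2)).
Qed.

Lemma cpderivs_nil f : cpderivs [::] f = f.
Proof. by apply/funext => x; rewrite /cpderivs/=; case: (f x). Qed.

(** Coinduction: in a class of rapidly decreasing continuous functions that
    is stable under partial derivatives, every function is Schwartz. It
    replaces all computations of higher derivatives by one step of
    differentiation. *)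
Lemma schwartz_coind (P : ('rV[R]_d -> R[i]) -> Prop) :
  (forall f, P f -> ccontinuous f) ->
  (forall f, P f -> rapid f) ->
  (forall f i, P f -> exists2 g, P g & is_pd i f g) ->
  forall f, P f -> is_schwartz f.
Proof.
move=> Pcont Prapid Ppd.
have sm s : forall f, P f ->
    [/\ continuous (pderivs s (fun x => complex.Re (f x))),
        continuous (pderivs s (fun x => complex.Im (f x))),
        forall x i, derivable (pderivs s (fun x => complex.Re (f x))) x (delta_mx 0 i)
      & forall x i, derivable (pderivs s (fun x => complex.Im (f x))) x (delta_mx 0 i)].
  (* Induction from the right end of s, where the innermost derivative
     sits: removing it replaces f by another member of the class. *)
  elim/last_ind: s => [|s i IH] f Pf.
    have [c1 c2] := Pcont _ Pf; split => // x i.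
      by have [g _ /(_ x)[[]]] := Ppd f i Pf.
    by have [g _ /(_ x)[_ []]] := Ppd f i Pf.
  have [g Pg pg] := Ppd f i Pf.
  rewrite (pderivs_rcons s (fun x => (pg x).1)) (pderivs_rcons s (fun x => (pg x).2)).
  exact: IH.
have bd N n : forall f, P f -> exists M : R, forall s x, (size s <= n)%N ->
    (1 + `|x|) ^+ N * cnorm (cpderivs s f x) <= M.
  elim: n => [|n IH] f Pf.
    have [M HM] := Prapid _ Pf N; exists M => s x.
    by rewrite leqn0 => /eqP/size0nil ->; rewrite cpderivs_nil.
  have /choice[G HG] : forall i, exists g, P g /\ is_pd i f g.
    by move=> i; have [g Pg pg] := Ppd f i Pf; exists g.
  have /choice[B HB] : forall i, exists M : R, forall s x, (size s <= n)%N ->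
    (1 + `|x|) ^+ N * cnorm (cpderivs s (G i) x) <= M.
    by move=> i; apply: IH; have [] := HG i.
  have [M HM] := Prapid _ Pf N.
  have p0 x g : 0 <= (1 + `|x|) ^+ N * cnorm (g x : R[i]).
    by rewrite mulr_ge0 ?cnorm_ge0// exprn_ge0// addr_ge0.
  have M0 : 0 <= M by exact: le_trans (p0 0 f) (HM 0).
  have B0 i : 0 <= B i by exact: le_trans (p0 0 _) (HB i [::] 0 isT).
  exists (M + \sum_i B i) => s x; case/lastP: s => [_|s i].
    by rewrite cpderivs_nil (le_trans (HM x))// lerDl sumr_ge0.
  rewrite size_rcons ltnS => sn; rewrite (cpderivs_rcons s (HG i).2).
  apply: le_trans (HB i s x sn) _.
  rewrite (bigD1 i)//= addrCA lerDl addr_ge0// sumr_ge0// => j _.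
move=> f Pf; split.
- by move=> s; have [] := sm s f Pf.
- by move=> s; have [] := sm s f Pf.
- by move=> N; apply/schwartz_normP; exact: (bd N N f Pf).
Qed.

Lemma schwartz_bound f N : is_schwartz f -> exists M : R, forall s x,
  (size s <= N)%N -> (1 + `|x|) ^+ N * cnorm (cpderivs s f x) <= M.
Proof. by case=> _ _ /(_ N)/schwartz_normP. Qed.

Lemma schwartz_rapid f : is_schwartz f -> rapid f.
Proof.
move=> sf N; have [M HM] := schwartz_bound N sf.
by exists M => x; have := HM [::] x isT; rewrite cpderivs_nil.
Qed.

Lemma schwartz_continuous f : is_schwartz f -> ccontinuous f.
Proof. by case=> s1 s2 _; split; [case: (s1 [::])|case: (s2 [::])]. Qed.

Lemma schwartz_is_pd f i : is_schwartz f -> is_pd i f (cpderivs [:: i] f).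
Proof.
case=> s1 s2 _ x; split; apply: DeriveDef => //.
  by case: (s1 [::]) => _ /(_ x i).
by case: (s2 [::]) => _ /(_ x i).
Qed.

Lemma schwartz_pd f i : is_schwartz f -> is_schwartz (cpderivs [:: i] f).
Proof.
move=> sf; have pf := schwartz_is_pd i sf; case: (sf) => s1 s2 _; split.
- by move=> s; have := s1 (rcons s i); rewrite (pderivs_rcons s (fun x => (pf x).1)).
- by move=> s; have := s2 (rcons s i); rewrite (pderivs_rcons s (fun x => (pf x).2)).
move=> N; apply/schwartz_normP; have [M HM] := schwartz_bound N.+1 sf.
exists M => s x sN; rewrite -(cpderivs_rcons s pf).
apply: le_trans (HM (rcons s i) x _); last by rewrite size_rcons.
rewrite ler_wpM2r ?cnorm_ge0// ler_weXn2l// lerDl//.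
Qed.

Section multiplier.
Variable Mu : ('rV[R]_d -> R[i]) -> Prop.
Hypothesis Mu_cont : forall m, Mu m -> ccontinuous m.
Hypothesis Mu_poly : forall m, Mu m -> exists k (C : R), forall x,
  cnorm (m x) <= C * (1 + `|x|) ^+ k.
Hypothesis Mu_pd : forall m i, Mu m -> exists2 m', Mu m' & is_pd i m m'.

(** Multiplication by m does not preserve the products m f under
    differentiation, only their finite sums, by the Leibniz rule. *)
Inductive mulspan : ('rV[R]_d -> R[i]) -> Prop :=
| mulspan_mul m f : Mu m -> is_schwartz f -> mulspan (fun x => m x * f x)
| mulspan_add f g : mulspan f -> mulspan g -> mulspan (fun x => f x + g x).

(** One argument for multiplication by coordinates, exponentials, logistic
    functions and Schwartz functions: the finite sums of products m f are a
    class to which schwartz_coind applies. *)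
Lemma schwartz_multiplier m f : Mu m -> is_schwartz f ->
  is_schwartz (fun x => m x * f x).
Proof.
move=> Mum sf; apply: (@schwartz_coind mulspan); last exact: mulspan_mul.
- move=> h hh; elim: hh => [m0 f0 Mum0 sf0|f0 g _ cf _ cg].
    by apply: ccontinuousM; [exact: Mu_cont|exact: schwartz_continuous].
  exact: ccontinuousD.
- move=> h hh; elim: hh => [m0 f0 Mum0 sf0|f0 g _ rf _ rg]; last exact: rapidD.
  have [k [C mC]] := Mu_poly Mum0.
  apply: (@rapid_le _ f0 C k); first exact: schwartz_rapid.
  by move=> x; rewrite cnormM ler_wpM2r ?cnorm_ge0.
- move=> h i hh; elim: hh => [m0 f0 Mum0 sf0|f0 g _ [f' sf' pf] _ [g' sg' pg]].
    have [m' Mum' pm] := Mu_pd i Mum0.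
    exists (fun x => m' x * f0 x + m0 x * cpderivs [:: i] f0 x).
      by apply: mulspan_add; apply: mulspan_mul => //; exact: schwartz_pd.
    by apply: is_pdM => //; exact: schwartz_is_pd.
  exists (fun x => f' x + g' x); first exact: mulspan_add.
  exact: is_pdD.
Qed.

End multiplier.

Lemma schwartzZ (a : R[i]) f : is_schwartz f -> is_schwartz (fun x => a * f x).
Proof.
move=> sf; have := is_schwartz_linear a sf (@is_schwartz0 R d).
by under eq_fun do rewrite addr0.
Qed.

Lemma schwartzM f g : is_schwartz f -> is_schwartz g ->
  is_schwartz (fun x => f x * g x).
Proof.
move=> sf sg; apply: (@schwartz_multiplier is_schwartz) => //.
- exact: schwartz_continuous.
- move=> m sm; have [M HM] := schwartz_rapid sm 0%N.
  by exists 0%N, M => x; have := HM x; rewrite !expr0 mul1r mulr1.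
- by move=> m i sm; exists (cpderivs [:: i] m); [exact: schwartz_pd|exact: schwartz_is_pd].
Qed.

Lemma le_decay f x (M : R) : (1 + `|x|) ^+ (2 * d) * cnorm (f x) <= M ->
  cnorm (f x) <= M * decay x.
Proof.
move=> fM; have h := decay_ge x; have d0 := decay_gt0 x.
apply: le_trans (ler_wpM2r (ltW d0) fM).
by rewrite mulrAC; apply: ler_peMl h; exact: cnorm_ge0.
Qed.

Lemma schwartz_cintegrable f : is_schwartz f -> cintegrable f.
Proof.
move=> sf; have [M HM] := schwartz_rapid sf (2 * d).
apply: (@cintegrable_le _ _ _ (fun x => M * decay x)).
- by apply: ccontinuous_measurable; exact: schwartz_continuous.
- exact: (integrableZl measurableT M (@integrable_decay R d)).
- by move=> x; exact: le_decay (HM x).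
Qed.

End pd.

(** * Exponentials, Gaussians and logistic functions *)

Section dotp.
Context {R : realType} {d : nat}.
Implicit Types (x y z : 'rV[R]_d) (a : R).

Lemma dotpC x y : dotp x y = dotp y x.
Proof. by apply: eq_bigr => i _; rewrite mulrC. Qed.

Lemma dotpDl x y z : dotp (x + y) z = dotp x z + dotp y z.
Proof. by rewrite -big_split; apply: eq_bigr => i _; rewrite mxE mulrDl. Qed.

Lemma dotpZl a x y : dotp (a *: x) y = a * dotp x y.
Proof. by rewrite mulr_sumr; apply: eq_bigr => i _; rewrite mxE mulrA. Qed.

Lemma dotpDr x y z : dotp x (y + z) = dotp x y + dotp x z.
Proof. by rewrite dotpC dotpDl dotpC [dotp z x]dotpC. Qed.

Lemma dotpZr a x y : dotp x (a *: y) = a * dotp x y.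
Proof. by rewrite dotpC dotpZl dotpC. Qed.

Lemma dotpNr x y : dotp x (- y) = - dotp x y.
Proof. by rewrite -scaleN1r dotpZr mulN1r. Qed.

Lemma dotpNl x y : dotp (- x) y = - dotp x y.
Proof. by rewrite -scaleN1r dotpZl mulN1r. Qed.

Lemma dotp_delta x i : dotp x (delta_mx 0 i) = x 0 i.
Proof.
rewrite /dotp (bigD1 i)//= mxE !eqxx mulr1 big1 ?addr0// => j ji.
by rewrite mxE eqxx (negbTE ji) mulr0.
Qed.

Lemma dotp_le x y : `|dotp x y| <= d%:R * `|x| * `|y|.
Proof.
apply: (le_trans (ler_norm_sum _ _ _)).
apply: (@le_trans _ _ (\sum_(i < d) `|x| * `|y|)).
  by apply: ler_sum => i _; rewrite normrM ler_pM// normrV_coord.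
by rewrite sumr_const card_ord -mulrA mulr_natl.
Qed.

Lemma measurable_dotp : measurable_fun setT
  (fun p : 'rV[R]_d * 'rV[R]_d => dotp p.1 p.2).
Proof.
apply: measurable_sum => i; apply: measurable_funM.
  exact: (measurableT_comp (measurable_rV_coord i) measurable_fst).
exact: (measurableT_comp (measurable_rV_coord i) measurable_snd).
Qed.

Lemma measurable_dotpl y : measurable_fun setT (fun x : 'rV[R]_d => dotp x y).
Proof.
apply: measurable_sum => i; apply: measurable_funM => //.
exact: (measurable_rV_coord i).
Qed.

Lemma continuous_coord i : continuous (fun x : 'rV[R]_d => x 0 i).
Proof.
apply: (@lipschitz_continuous _ _ _ 1) => x y; rewrite mul1r.
by have := normrV_coord (x - y) i; rewrite !mxE.
Qed.

End dotp.

Section expi_bounds.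
Context {R : realType}.

Lemma normr_sin_le (t : R) : `|sin t| <= `|t|.
Proof.
have [u _] := mean_value0 (@is_derive_sin R) t.
rewrite sin0 subr0 => ->; rewrite normrM ler_piMr// ler_norml.
by rewrite cos_geN1 cos_le1.
Qed.

Lemma normr_cosB1_le (t : R) : `|cos t - 1| <= `|t|.
Proof.
have [u _] := mean_value0 (@is_derive_cos R) t.
rewrite cos0 => ->; rewrite normrM ler_piMr// normrN ler_norml.
by rewrite sin_geN1 sin_le1.
Qed.

Lemma normr_cosB1_le2 (t : R) : `|cos t - 1| <= t ^+ 2.
Proof.
have [u ut] := mean_value0 (@is_derive_cos R) t.
rewrite cos0 => ->; rewrite normrM normrN -[t ^+ 2]real_normK ?num_real// expr2.
by rewrite ler_wpM2l// (le_trans (normr_sin_le u)).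
Qed.

Lemma normr_sinB_le2 (t : R) : `|sin t - t| <= t ^+ 2.
Proof.
have [u ut] := mean_value0 (@is_derive_sin R) t.
rewrite sin0 subr0 => ->; rewrite -[X in _ - X]mulr1 -mulrBr normrM.
rewrite -[t ^+ 2]real_normK ?num_real// expr2.
by rewrite ler_wpM2l// (le_trans (normr_cosB1_le u)).
Qed.

Lemma expiB1_le (t : R) : cnorm (expi t - 1) <= 2 * `|t|.
Proof.
apply: (le_trans (cnorm_le _)); rewrite /= subr0 mulr2n mulrDl mul1r.
by rewrite lerD ?normr_cosB1_le ?normr_sin_le.
Qed.

Lemma expiB1_le2 (t : R) : cnorm (expi t - 1 - ('i)%C * t%:C%C) <= 2 * t ^+ 2.
Proof.
apply: (le_trans (cnorm_le _)); rewrite mulr2n mulrDl mul1r.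
rewrite !(cReD, cImD, cReN, cImN, cReM, cImM)/=.
have -> : cos t - 1 - (0 * t - 1 * 0) = cos t - 1 by ring.
have -> : sin t - 0 - (0 * 0 + 1 * t) = sin t - t by ring.
by rewrite lerD ?normr_cosB1_le2 ?normr_sinB_le2.
Qed.

End expi_bounds.

Section schwartz_ops.
Context {R : realType} {d : nat}.
Implicit Types (f g : 'rV[R]_d -> R[i]) (x : 'rV[R]_d).

Lemma is_pd_real i (f f' : 'rV[R]_d -> R) :
  (forall x, is_derive x (delta_mx 0 i) f (f' x)) ->
  is_pd i (fun x => (f x)%:C%C) (fun x => (f' x)%:C%C).
Proof. by move=> h x; split => //=; exact: is_derive_cst. Qed.

Lemma ccontinuous_real (f : 'rV[R]_d -> R) : continuous f ->
  ccontinuous (fun x => (f x)%:C%C).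
Proof. by move=> cf; split => //= x; exact: cst_continuous. Qed.

Lemma is_pd_coord i j : is_pd i (fun x : 'rV[R]_d => (x 0 j)%:C%C)
  (fun=> (i == j)%:R).
Proof.
have -> : (fun=> (i == j)%:R) = (fun x : 'rV[R]_d => ((i == j)%:R : R)%:C%C :> R[i]).
  by apply/funext => x; case: eqP.
apply: is_pd_real => x; apply: (@is_derive_quad _ _ _ _ _ _ 0) => h _.
rewrite !mxE eqxx/= eq_sym mul0r (addrC (x 0 j)) addrK.
by case: eqP => _; rewrite ?mulr1 ?mulr0 subrr normr0.
Qed.

Lemma schwartz_coordM (c : R[i]) j f : is_schwartz f ->
  is_schwartz (fun x => c * (x 0 j)%:C%C * f x).
Proof.
pose Mu (m : 'rV[R]_d -> R[i]) := exists a b : R[i], m = fun x => a * (x 0 j)%:C%C + b.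
move=> sf; apply: (@schwartz_multiplier _ _ Mu _ _ _ (fun x => c * (x 0 j)%:C%C)) => //.
- move=> _ [a [b ->]]; apply: ccontinuousD; last exact: ccontinuous_cst.
  apply: ccontinuousM; first exact: ccontinuous_cst.
  by apply: ccontinuous_real; exact: continuous_coord.
- move=> _ [a [b ->]]; exists 1%N, (cnorm a + cnorm b) => x.
  apply: (le_trans (cnormD _ _)); rewrite cnormM cnorm_real expr1 mulrDl.
  apply: lerD; last by rewrite ler_peMr ?cnorm_ge0// lerDl.
  by rewrite ler_wpM2l ?cnorm_ge0// (le_trans (normrV_coord _ _))// lerDr.
- move=> _ i [a [b ->]]; exists (fun=> a * (i == j)%:R).
    by exists 0, (a * (i == j)%:R); apply/funext => x; rewrite mul0r add0r.
  have := is_pdD (is_pdZ a (is_pd_coord i j)) (is_pd_cst i b).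
  by under [X in is_pd _ _ X]eq_fun do rewrite addr0.
- by exists c, 0; apply/funext => x; rewrite addr0.
Qed.

(** The function expi is known to second order at 0 (expiB1_le2), and the
    functional equation transports this to every point. *)
Lemma is_pd_expi i (y : 'rV[R]_d) :
  is_pd i (fun x => expi (- dotp x y))
    (fun x => - ('i)%C * (y 0 i)%:C%C * expi (- dotp x y)).
Proof.
apply: is_pd_quad => x; exists (2 * y 0 i ^+ 2) => h h1.
rewrite dotpDl dotpZl [dotp (delta_mx _ _) _]dotpC dotp_delta opprD expiD.
set e := expi (- dotp x y).
have -> : e * expi (- (h * y 0 i)) - e - h%:C%C * (- 'i%C * (y 0 i)%:C%C * e) =
   e * (expi (- (h * y 0 i)) - 1 - 'i%C * (- (h * y 0 i))%:C%C).
  by rewrite rmorphN rmorphM/=; ring.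
rewrite cnormM cnorm_expi mul1r; apply: (le_trans (expiB1_le2 _)).
by have -> : 2 * (- (h * y 0 i)) ^+ 2 = 2 * y 0 i ^+ 2 * h ^+ 2 by ring.
Qed.

Lemma expi_lipschitz (y x z : 'rV[R]_d) :
  cnorm (expi (- dotp x y) - expi (- dotp z y)) <= 2 * d%:R * `|y| * `|x - z|.
Proof.
have -> : - dotp x y = - dotp z y + - dotp (x - z) y.
  by rewrite dotpDl dotpNl; ring.
rewrite expiD -[X in _ - X]mulr1 -mulrBr cnormM cnorm_expi mul1r.
apply: (le_trans (expiB1_le _)); rewrite normrN.
rewrite -!mulrA ler_pM2l// (le_trans (dotp_le _ _))//.
by rewrite -mulrA [`|y| * _]mulrC.
Qed.

Lemma ccontinuous_expi (y : 'rV[R]_d) :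
  ccontinuous (fun x => expi (- dotp x y)).
Proof. exact: ccontinuous_lipschitz (expi_lipschitz y). Qed.

Lemma schwartz_expiM (y : 'rV[R]_d) f : is_schwartz f ->
  is_schwartz (fun x => f x * expi (- dotp x y)).
Proof.
pose Mu (m : 'rV[R]_d -> R[i]) := exists c : R[i], m = fun x => c * expi (- dotp x y).
move=> sf.
rewrite (_ : (fun x => _) = (fun x => expi (- dotp x y) * f x)); last first.
  by apply/funext => x; rewrite mulrC.
apply: (@schwartz_multiplier _ _ Mu) => //.
- move=> _ [c ->]; apply: ccontinuousM; first exact: ccontinuous_cst.
  exact: ccontinuous_expi.
- by move=> _ [c ->]; exists 0%N, (cnorm c) => x; rewrite cnormM cnorm_expi expr0.
- move=> _ i [c ->].
  exists (fun x => c * (- ('i)%C * (y 0 i)%:C%C * expi (- dotp x y))).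
    by exists (c * (- ('i)%C * (y 0 i)%:C%C)); apply/funext => x; rewrite !mulrA.
  by apply: is_pdZ; exact: is_pd_expi.
- by exists 1; apply/funext => x; rewrite mul1r.
Qed.

Lemma is_pd_affine i f g (a : R) b : is_pd i f g ->
  is_pd i (fun x => f (a *: x + b)) (fun x => a%:C%C * g (a *: x + b)).
Proof.
move=> pf x.
have E (F : 'rV[R]_d -> R) : (fun s : R => F (a *: (x + s *: delta_mx 0 i) + b)) =
    (fun r => F ((a *: x + b) + r *: delta_mx 0 i)) \o (fun s => s * a).
  apply/funext => s /=; congr F.
  by rewrite scalerDr scalerA addrAC [a * s]mulrC.
have D (F : 'rV[R]_d -> R) l : is_derive (a *: x + b) (delta_mx 0 i) F l ->
    is_derive x (delta_mx 0 i) (fun x => F (a *: x + b)) (a * l).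
  move=> h; apply: line_is_derive; rewrite E mulrC.
  apply: is_derive1_comp.
    by rewrite mul0r; apply: is_derive_line; rewrite scale0r addr0.
  apply: is_derive_eq; rewrite /GRing.scale/= ?mulr0 ?addr0 ?add0r ?mulr1//.
rewrite cReM cImM/= !mul0r subr0 addr0.
by have [f1 f2] := pf (a *: x + b); split; apply: D.
Qed.

(** The chain rule only produces scalar multiples of the same form, and 1 +
    |x| is bounded by a multiple of 1 + |a x + b|. *)
Lemma schwartz_affine f (a : R) b : a != 0 -> is_schwartz f ->
  is_schwartz (fun x => f (a *: x + b)).
Proof.
move=> a0 sf.
pose P (h : 'rV[R]_d -> R[i]) := exists c g, is_schwartz g /\ h = fun x => c * g (a *: x + b).
apply: (@schwartz_coind _ _ P); last by exists 1, f; split => //; apply/funext => x; rewrite mul1r.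
- move=> _ [c [g [sg ->]]]; apply: ccontinuousM; first exact: ccontinuous_cst.
  have [g1 g2] := schwartz_continuous sg.
  have ca : continuous (fun x : 'rV[R]_d => a *: x + b).
    move=> x; have Fx : Filter (nbhs (x : 'rV[R]_d)) by exact: nbhs_filter.
    by apply: cvgD; [apply: cvgZr; exact: cvg_id|exact: cvg_cst].
  by split => x; [apply: (continuous_comp (ca x) (g1 _))|apply: (continuous_comp (ca x) (g2 _))].
- move=> _ [c [g [sg ->]]] N; have [M HM] := schwartz_rapid sg N.
  pose K := 1 + (1 + `|b|) / `|a|.
  have na : 0 < `|a| by rewrite normr_gt0.
  have xK x : 1 + `|x| <= K * (1 + `|a *: x + b|).
    have h : `|a| * `|x| <= `|a *: x + b| + `|b|.
      by rewrite -normrZ -[a *: x in leLHS](addrK b) (le_trans (ler_normB _ _)).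
    have {}h : `|x| <= (`|a *: x + b| + `|b|) / `|a| by rewrite ler_pdivlMr// mulrC.
    apply: (le_trans (lerD (lexx 1) h)).
    rewrite /K; set u := `|a *: x + b|.
    have -> : (1 + (1 + `|b|) / `|a|) * (1 + u) =
        (1 + (u + `|b|) / `|a|) + (u + 1 / `|a| + u * (`|b| / `|a|)).
      by field; rewrite gt_eqF.
    by rewrite lerDl !addr_ge0 ?mulr_ge0 ?divr_ge0// normr_ge0.
  exists (K ^+ N * cnorm c * M) => x; rewrite cnormM.
  have K0 : 0 <= K by rewrite addr_ge0// divr_ge0// addr_ge0.
  have h : (1 + `|x|) ^+ N <= K ^+ N * (1 + `|a *: x + b|) ^+ N.
    by rewrite -exprMn lerXn2r// nnegrE ?mulr_ge0// addr_ge0.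
  apply: (@le_trans _ _ (K ^+ N * (1 + `|a *: x + b|) ^+ N * (cnorm c * cnorm (g (a *: x + b))))).
    by rewrite ler_wpM2r// mulr_ge0 ?cnorm_ge0.
  have := ler_wpM2l (mulr_ge0 (exprn_ge0 N K0) (cnorm_ge0 c)) (HM (a *: x + b)).
  by apply: le_trans; rewrite le_eqVlt; apply/orP; left; apply/eqP; ring.
- move=> _ i [c [g [sg ->]]].
  exists (fun x => c * (a%:C%C * cpderivs [:: i] g (a *: x + b))).
    exists (c * a%:C%C), (cpderivs [:: i] g); split; first exact: schwartz_pd.
    by apply/funext => x; rewrite mulrA.
  by apply: is_pdZ; apply: is_pd_affine; exact: schwartz_is_pd.
Qed.

Lemma schwartz_opp f : is_schwartz f -> is_schwartz (fun x => f (- x)).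
Proof.
move=> sf; have n0 : -1 != 0 :> R by rewrite oppr_eq0 oner_eq0.
have := schwartz_affine 0 n0 sf.
by under eq_fun do rewrite scaleN1r addr0.
Qed.

Lemma schwartz_translate f y : is_schwartz f -> is_schwartz (fun x => f (x + y)).
Proof.
move=> sf; have := schwartz_affine y (oner_neq0 R) sf.
by under eq_fun do rewrite scale1r.
Qed.

Definition gauss x : R := expR (- (\sum_(i < d) x 0 i ^+ 2) / 2).

Lemma gauss_gt0 x : 0 < gauss x. Proof. exact: expR_gt0. Qed.

Lemma is_derive_gauss (s : R) i x :
  is_derive x (delta_mx 0 i)
    (fun y : 'rV[R]_d => expR (s * (- (\sum_(i < d) y 0 i ^+ 2) / 2)))
    (- s * x 0 i * expR (s * (- (\sum_(i < d) x 0 i ^+ 2) / 2))).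
Proof.
apply: line_is_derive.
set q := fun y : 'rV[R]_d => \sum_(i < d) y 0 i ^+ 2.
have -> : (fun t => expR (s * (- (\sum_(i0 < d) (x + t *: delta_mx 0 i) 0 i0 ^+ 2) / 2))) =
  (expR : R -> R) \o (fun t : R => s * (- q x / 2) - (s * x 0 i) * t - (s / 2) * t ^+ 2).
  apply/funext => t /=; congr expR.
  have -> : \sum_(i0 < d) (x + t *: delta_mx 0 i) 0 i0 ^+ 2 = q x + 2 * t * x 0 i + t ^+ 2.
    rewrite /q (bigD1 i)//= [X in _ = X + _ + _](bigD1 i)//= !mxE !eqxx/=.
    under eq_bigr => j ji do rewrite !mxE (negbTE ji) andbF mulr0 addr0.
    ring.
  by field.
apply: is_derive_eq; rewrite /GRing.scale/= ?mulr0 ?mulr1 ?expr0n/= ?mulr0 ?subr0 ?addr0 ?add0r.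
rewrite mulrC; congr (_ * _).
ring.
Qed.

Lemma is_pd_gauss i : is_pd i (fun x => (gauss x)%:C%C)
  (fun x => (- x 0 i * gauss x)%:C%C).
Proof.
apply: is_pd_real => x; have := is_derive_gauss 1 i x.
rewrite mulN1r mul1r; congr is_derive.
by apply/funext => y; rewrite mul1r.
Qed.

Lemma continuous_gauss : continuous gauss.
Proof.
have cs (s : seq 'I_d) : continuous (fun x : 'rV[R]_d => \sum_(i <- s) x 0 i ^+ 2).
  elim: s => [|i s IH].
    by under eq_fun do rewrite big_nil; exact: cst_continuous.
  move=> x; have Fx : Filter (nbhs (x : 'rV[R]_d)) by exact: nbhs_filter.
  under eq_fun do rewrite big_cons expr2.
  apply: cvgD; last exact: IH.
  by apply: cvgM; exact: continuous_coord.
move=> x; have Fx : Filter (nbhs (x : 'rV[R]_d)) by exact: nbhs_filter.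
apply: (@continuous_comp _ _ _ (fun x : 'rV[R]_d => - (\sum_(i < d) x 0 i ^+ 2) / 2) expR).
  by apply: cvgM; [apply: cvgN; exact: cs|exact: cvg_cst].
exact: continuous_expR.
Qed.

Lemma norm2_le_sum x : `|x| ^+ 2 <= \sum_(i < d) x 0 i ^+ 2.
Proof.
have [->|x0] := eqVneq x 0.
  by rewrite normr0 expr0n sumr_ge0// => i _; exact: sqr_ge0.
have [|[i0 i] /= E] := @mx_norm_neq0 _ _ _ x.
  by rewrite -[mx_norm x]/(`|x|) normr_eq0.
rewrite -[mx_norm x]/(`|x|) in E.
rewrite E ord1 (bigD1 i)//= real_normK ?num_real// lerDl sumr_ge0// => j _.
exact: sqr_ge0.
Qed.

(** Since (1 + r)^N <= e^(N r), completing the square in N r - r^2 / 2 gives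
    the constant e^(N^2 / 2). *)
Lemma rapid_gauss : rapid (fun x => (gauss x)%:C%C).
Proof.
move=> N; exists (expR (N%:R ^+ 2 / 2)) => x.
rewrite cnorm_real gtr0_norm ?gauss_gt0//.
apply: (@le_trans _ _ (expR (N%:R * `|x|) * gauss x)).
  rewrite ler_wpM2r ?(ltW (gauss_gt0 _))// expRM_natl.
  by rewrite lerXn2r ?nnegrE ?addr_ge0 ?expR_ge0// expR_ge1Dx.
rewrite /gauss -expRD ler_expR.
have := norm2_le_sum x; have := sqr_ge0 (N%:R - `|x|).
set S := \sum_(_ < _) _; set n := `|x|; set k : R := N%:R.
nra.
Qed.

(** The products of the Gaussian with polynomials: differentiating the
    Gaussian multiplies it by - x_i. *)
Inductive gauss_class : ('rV[R]_d -> R[i]) -> Prop :=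
| gauss_class_base : gauss_class (fun x => (gauss x)%:C%C)
| gauss_class_coord i f : gauss_class f -> gauss_class (fun x => (x 0 i)%:C%C * f x)
| gauss_class_scale c f : gauss_class f -> gauss_class (fun x => c * f x)
| gauss_class_add f g : gauss_class f -> gauss_class g ->
    gauss_class (fun x => f x + g x).

Lemma schwartz_gauss : is_schwartz (fun x => (gauss x)%:C%C).
Proof.
apply: (@schwartz_coind _ _ gauss_class); last exact: gauss_class_base.
- move=> f; elim => [|i g _ cg|c g _ cg|g h _ cg _ ch].
  + by apply: ccontinuous_real; exact: continuous_gauss.
  + by apply: ccontinuousM => //; apply: ccontinuous_real; exact: continuous_coord.
  + by apply: ccontinuousM => //; exact: ccontinuous_cst.
  + exact: ccontinuousD.
- move=> f; elim => [|i g _ rg|c g _ rg|g h _ rg _ rh].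
  + exact: rapid_gauss.
  + apply: (@rapid_le _ _ _ g 1 1 rg) => x; rewrite cnormM cnorm_real mul1r expr1.
    by rewrite ler_wpM2r ?cnorm_ge0// (le_trans (normrV_coord _ _))// lerDr.
  + by apply: (@rapid_le _ _ _ g (cnorm c) 0 rg) => x; rewrite cnormM expr0 mulr1.
  + exact: rapidD.
- move=> f i; elim => [|j g Gg [g' Gg' pg]|c g _ [g' Gg' pg]|g h _ [g' Gg' pg] _ [h' Gh' ph]].
  + exists (fun x => -1 * ((x 0 i)%:C%C * (gauss x)%:C%C)).
      by apply: gauss_class_scale; apply: gauss_class_coord; exact: gauss_class_base.
    have := is_pd_gauss i; congr is_pd; apply/funext => x.
    by rewrite rmorphM rmorphN/= mulN1r mulNr.
  + exists (fun x => (i == j)%:R * g x + (x 0 j)%:C%C * g' x).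
      apply: gauss_class_add; last exact: gauss_class_coord.
      exact: gauss_class_scale.
    exact: is_pdM (is_pd_coord i j) pg.
  + exists (fun x => c * g' x); first exact: gauss_class_scale.
    exact: is_pdZ.
  + exists (fun x => g' x + h' x); first exact: gauss_class_add.
    exact: is_pdD.
Qed.

(** A smooth step function. The identity l' = l - l^2 makes the polynomials
    in l a class stable under differentiation, which makes it easier to
    handle than a compactly supported cut-off. *)
Definition logistic (t : R) : R := (1 + expR (- t))^-1.

Lemma logistic_gt0 t : 0 < logistic t.
Proof. by rewrite invr_gt0 addr_gt0 ?expR_gt0. Qed.

Lemma logistic_le1 t : logistic t <= 1.
Proof. by rewrite invf_le1 ?addr_gt0 ?expR_gt0// lerDl expR_ge0. Qed.

Lemma logistic_ge (t : R) : 1 - logistic t <= expR (- t).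
Proof.
have h : 0 < 1 + expR (- t) by rewrite addr_gt0 ?expR_gt0.
have -> : 1 - logistic t = expR (- t) / (1 + expR (- t)).
  by rewrite /logistic; field; rewrite gt_eqF.
by rewrite ler_pdivrMr// ler_peMr ?expR_ge0// lerDl expR_ge0.
Qed.

Lemma logistic_le (t : R) : logistic t <= expR t.
Proof.
rewrite /logistic -[leRHS]invrK -expRN lef_pV2 ?posrE ?expR_gt0//.
  by rewrite lerDr.
Qed.

Lemma is_derive_logistic (t : R) :
  is_derive t (1 : R) logistic (logistic t - logistic t ^+ 2).
Proof.
have t0 : 1 + expR (- t) != 0 by rewrite gt_eqF// addr_gt0 ?expR_gt0.
have D : is_derive t (1 : R) (fun t : R => 1 + expR (- t)) (- expR (- t)).
  by apply: is_derive_eq; rewrite /GRing.scale/=; ring.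
have := @is_deriveV R (fun t : R => 1 + expR (- t)) t _ 1 t0 D.
rewrite /logistic; congr is_derive.
by rewrite /GRing.scale/=; field.
Qed.

(** Polynomials in one logistic function of the j-th coordinate. *)
Inductive logistic_class (a b : R) (j : 'I_d) : ('rV[R]_d -> R[i]) -> Prop :=
| logistic_class_base : logistic_class a b j (fun x => (logistic (a * x 0 j + b))%:C%C)
| logistic_class_cst c : logistic_class a b j (fun=> c)
| logistic_class_mul f g : logistic_class a b j f -> logistic_class a b j g ->
    logistic_class a b j (fun x => f x * g x)
| logistic_class_add f g : logistic_class a b j f -> logistic_class a b j g ->
    logistic_class a b j (fun x => f x + g x).

Lemma is_pd_logistic a b i j :
  is_pd i (fun x => (logistic (a * x 0 j + b))%:C%C)
    (fun x => (a * (i == j)%:R)%:C%C * ((logistic (a * x 0 j + b))%:C%C +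
       -1 * ((logistic (a * x 0 j + b))%:C%C * (logistic (a * x 0 j + b))%:C%C))).
Proof.
have -> : (fun x => (a * (i == j)%:R)%:C%C * ((logistic (a * x 0 j + b))%:C%C +
       -1 * ((logistic (a * x 0 j + b))%:C%C * (logistic (a * x 0 j + b))%:C%C))) =
    (fun x : 'rV[R]_d => ((logistic (a * x 0 j + b) - logistic (a * x 0 j + b) ^+ 2)
       * (a * (i == j)%:R))%:C%C).
  apply/funext => x.
  by rewrite [in RHS]rmorphM [in RHS]rmorphB rmorphXn/=; ring.
apply: is_pd_real => x; apply: line_is_derive.
have -> : (fun s => logistic (a * (x + s *: delta_mx 0 i) 0 j + b)) =
   logistic \o (fun s => (a * x 0 j + b) + s * (a * (i == j)%:R)).
  by apply/funext => s /=; rewrite !mxE eqxx/= eq_sym; congr logistic; ring.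
apply: is_derive1_comp.
  by rewrite mul0r addr0; exact: is_derive_logistic.
by apply: is_derive_eq; rewrite /GRing.scale/=; ring.
Qed.

Lemma schwartz_logisticM a b j f : is_schwartz f ->
  is_schwartz (fun x => (logistic (a * x 0 j + b))%:C%C * f x).
Proof.
move=> sf.
apply: (@schwartz_multiplier _ _ (logistic_class a b j) _ _ _
  (fun x => (logistic (a * x 0 j + b))%:C%C)) => //; last exact: logistic_class_base.
- move=> m; elim => [|c|g h _ cg _ ch|g h _ cg _ ch].
  + apply: ccontinuous_real => x.
    have Fx : Filter (nbhs (x : 'rV[R]_d)) by exact: nbhs_filter.
    apply: (continuous_comp (f := fun x : 'rV[R]_d => a * x 0 j + b)).
      apply: cvgD; last exact: cvg_cst.
      by apply: cvgM; [exact: cvg_cst|exact: continuous_coord].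
    apply: differentiable_continuous; apply/derivable1_diffP.
    by case: (is_derive_logistic (a * x 0 j + b)).
  + exact: ccontinuous_cst.
  + exact: ccontinuousM.
  + exact: ccontinuousD.
- move=> m h; suff [C HC] : exists C : R, forall x, cnorm (m x) <= C.
    by exists 0%N, C => x; rewrite expr0 mulr1.
  elim: h => [|c|g h _ [C HC] _ [C' HC']|g h _ [C HC] _ [C' HC']].
  + by exists 1 => x; rewrite cnorm_real gtr0_norm ?logistic_gt0 ?logistic_le1.
  + by exists (cnorm c).
  + by exists (C * C') => x; rewrite cnormM ler_pM ?cnorm_ge0.
  + by exists (C + C') => x; rewrite (le_trans (cnormD _ _))// lerD.
- move=> m i; elim => [|c|g h Lg [g' Lg' pg] Lh [h' Lh' ph]|g h _ [g' Lg' pg] _ [h' Lh' ph]].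
  + eexists; last exact: is_pd_logistic.
    apply: logistic_class_mul; first exact: logistic_class_cst.
    apply: logistic_class_add; first exact: logistic_class_base.
    apply: logistic_class_mul; first exact: logistic_class_cst.
    by apply: logistic_class_mul; exact: logistic_class_base.
  + by exists (fun=> 0); [exact: logistic_class_cst|exact: is_pd_cst].
  + exists (fun x => g' x * h x + g x * h' x); last exact: is_pdM.
    by apply: logistic_class_add; exact: logistic_class_mul.
  + exists (fun x => g' x + h' x); last exact: is_pdD.
    exact: logistic_class_add.
Qed.

End schwartz_ops.

(** * The Fourier transform of a Schwartz function *)

Section fourier_basic.
Context {R : realType} {d : nat}.
Local Notation mu := (@lebesgue_rV R d).
Implicit Types (f g phi psi : 'rV[R]_d -> R[i]) (x y xi : 'rV[R]_d).

(** The normalising factor of the Fourier transform. *)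
Definition fconst : R := (2 * pi) `^ (- (d%:R / 2)).

Lemma fconst_gt0 : 0 < fconst.
Proof. by rewrite powR_gt0// mulr_gt0// pi_gt0. Qed.

Lemma fourierE f xi : fourier f xi =
  fconst%:C%C * cintegral (fun x => f x * expi (- dotp x xi)).
Proof. by []. Qed.

Lemma cintegrable_expiM f y : cintegrable f ->
  cintegrable (fun x => f x * expi (- dotp x y)).
Proof.
move=> fi; apply: cintegrable_le (integrable_cnorm fi) _.
  apply: cmeasurableM; first exact: cintegrable_measurable.
  apply: cmeasurable_expi; apply: measurableT_comp => //.
  exact: measurable_dotpl.
by move=> x; rewrite cnormM cnorm_expi mulr1.
Qed.

Lemma fourier_linear (a : R[i]) f g : cintegrable f -> cintegrable g ->
  fourier (fun x => a * f x + g x) = (fun xi => a * fourier f xi + fourier g xi).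
Proof.
move=> fi gi; apply/funext => xi; rewrite !fourierE.
under eq_fun do rewrite mulrDl -mulrA.
by rewrite cintegral_linear//; [ring|exact: cintegrable_expiM..].
Qed.

Lemma fourierZ (a : R[i]) f : cintegrable f ->
  fourier (fun x => a * f x) = (fun xi => a * fourier f xi).
Proof.
move=> fi; apply/funext => xi; rewrite !fourierE.
under eq_fun do rewrite -mulrA.
by rewrite cintegralZ//; [ring|exact: cintegrable_expiM].
Qed.

Definition decay_mass : R := \int[mu]_x decay x.

Lemma cintegral_decay f (M : R) : cintegrable f ->
  (forall x, (1 + `|x|) ^+ (2 * d) * cnorm (f x) <= M) ->
  cnorm (cintegral f) <= 2 * (M * decay_mass).
Proof.
move=> fi fM.
rewrite -RintegralZl//; last exact: integrable_decay.
apply: cnorm_cintegral_le => //.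
- exact: (integrableZl measurableT M (@integrable_decay R d)).
- by move=> x; exact: le_decay.
Qed.

Lemma fourier_bound f (M : R) xi : cintegrable f ->
  (forall x, (1 + `|x|) ^+ (2 * d) * cnorm (f x) <= M) ->
  cnorm (fourier f xi) <= fconst * (2 * (M * decay_mass)).
Proof.
move=> fi fM; rewrite fourierE cnormM cnorm_real gtr0_norm ?fconst_gt0//.
rewrite ler_wpM2l ?(ltW fconst_gt0)//; apply: cintegral_decay.
  exact: cintegrable_expiM.
by move=> x; rewrite cnormM cnorm_expi mulr1.
Qed.

(** The exponential is Lipschitz with a constant linear in |x|, and f
    absorbs this factor. *)
Lemma fourierB_le f : is_schwartz f -> exists C : R, forall xi eta,
  cnorm (fourier f xi - fourier f eta) <= C * `|xi - eta|.
Proof.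
move=> sf; have [M HM] := schwartz_rapid sf (2 * d).+1.
exists (fconst * (2 * (2 * d%:R * M * decay_mass))) => xi eta.
rewrite !fourierE -mulrBr -cintegralB; [|exact/cintegrable_expiM/schwartz_cintegrable..].
rewrite cnormM cnorm_real gtr0_norm ?fconst_gt0// -[leRHS]mulrA.
rewrite ler_wpM2l ?(ltW fconst_gt0)//.
have -> : 2 * (2 * d%:R * M * decay_mass) * `|xi - eta| = 2 * ((2 * d%:R * M * `|xi - eta|) * decay_mass).
  by ring.
apply: cintegral_decay.
  have h := cintegrable_linear (-1) (cintegrable_expiM eta (schwartz_cintegrable sf))
    (cintegrable_expiM xi (schwartz_cintegrable sf)).
  by move: h; under eq_fun do rewrite mulN1r addrC.
move=> x; rewrite -mulrBr cnormM.
have := expi_lipschitz x xi eta; rewrite dotpC [dotp eta _]dotpC => h.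
have p0 : 0 <= (1 + `|x|) ^+ (2 * d) by rewrite exprn_ge0// addr_ge0.
apply: (@le_trans _ _ ((1 + `|x|) ^+ (2 * d) * (cnorm (f x) * (2 * d%:R * `|x| * `|xi - eta|)))).
  by rewrite ler_wpM2l// ler_wpM2l ?cnorm_ge0.
have {}HM : (1 + `|x|) ^+ (2 * d) * (`|x| * cnorm (f x)) <= M.
  apply: le_trans (HM x); rewrite exprSr -mulrA ler_wpM2l//.
  by rewrite ler_wpM2r ?cnorm_ge0// lerDr.
have c0 : 0 <= 2 * d%:R * `|xi - eta| by rewrite !mulr_ge0.
have := ler_wpM2l c0 HM.
have -> : 2 * d%:R * `|xi - eta| * ((1 + `|x|) ^+ (2 * d) * (`|x| * cnorm (f x))) =
  (1 + `|x|) ^+ (2 * d) * (cnorm (f x) * (2 * d%:R * `|x| * `|xi - eta|)) by ring.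
by rewrite [2 * d%:R * _ * M]mulrAC.
Qed.

(** Differentiation under the integral sign, by the second order expansion
    of the exponential: the remainder is quadratic in h with a factor |x|^2
    that f absorbs. *)
Lemma is_pd_fourier f i : is_schwartz f ->
  is_pd i (fourier f) (fourier (fun x => - ('i)%C * (x 0 i)%:C%C * f x)).
Proof.
move=> sf; have sxf := schwartz_coordM (- ('i)%C) i sf.
have [M HM] := schwartz_rapid sf (2 * d).+2.
apply: is_pd_quad => xi; exists (fconst * (2 * ((2 * M) * decay_mass))) => h h1.
have e1 y := cintegrable_expiM y (schwartz_cintegrable sf).
have e2 y := cintegrable_expiM y (schwartz_cintegrable sxf).
rewrite !fourierE.
set I1 := cintegral _; set I0 := cintegral _; set J := cintegral _.
have -> : fconst%:C%C * I1 - fconst%:C%C * I0 - h%:C%C * (fconst%:C%C * J) =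
  fconst%:C%C * (- h%:C%C * J + (-1 * I0 + I1)) by ring.
rewrite cnormM cnorm_real gtr0_norm ?fconst_gt0// -[leRHS]mulrA.
rewrite ler_wpM2l ?(ltW fconst_gt0)//.
rewrite /I1 /I0 /J -!cintegral_linear//; last exact: cintegrable_linear.
have -> : 2 * (2 * M * decay_mass) * h ^+ 2 = 2 * ((2 * M * h ^+ 2) * decay_mass) by ring.
apply: cintegral_decay; first by do 2!apply: cintegrable_linear => //.
move=> x.
rewrite dotpDr dotpZr dotp_delta opprD expiD.
set e := expi (- dotp x xi).
have -> : - h%:C%C * (- 'i%C * (x 0 i)%:C%C * f x * e) +
      (-1 * (f x * e) + f x * (e * expi (- (h * x 0 i)))) =
   f x * e * (expi (- (h * x 0 i)) - 1 - 'i%C * (- (h * x 0 i))%:C%C).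
  by rewrite rmorphN rmorphM/=; ring.
rewrite !cnormM cnorm_expi mulr1.
have p0 : 0 <= (1 + `|x|) ^+ (2 * d) by rewrite exprn_ge0// addr_ge0.
apply: (@le_trans _ _ ((1 + `|x|) ^+ (2 * d) * (cnorm (f x) * (2 * (- (h * x 0 i)) ^+ 2)))).
  by rewrite ler_wpM2l// ler_wpM2l ?cnorm_ge0// expiB1_le2.
have {}HM : (1 + `|x|) ^+ (2 * d) * (x 0 i ^+ 2 * cnorm (f x)) <= M.
  apply: le_trans (HM x); rewrite -[(2 * d).+2]addn2 exprD -mulrA ler_wpM2l//.
  rewrite ler_wpM2r ?cnorm_ge0// -[x 0 i ^+ 2]real_normK ?num_real//.
  by rewrite lerXn2r ?nnegrE ?addr_ge0// (le_trans (normrV_coord x i))// lerDr.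
have c0 : 0 <= 2 * h ^+ 2 by rewrite mulr_ge0// sqr_ge0.
have := ler_wpM2l c0 HM.
have -> : 2 * h ^+ 2 * ((1 + `|x|) ^+ (2 * d) * (x 0 i ^+ 2 * cnorm (f x))) =
   (1 + `|x|) ^+ (2 * d) * (cnorm (f x) * (2 * (- (h * x 0 i)) ^+ 2)) by ring.
by rewrite [2 * h ^+ 2 * M]mulrAC.
Qed.

(** The remainder of the first order expansion decays in x, uniformly for
    |h| <= 1, because a shift by at most 1 changes 1 + |x| by a factor at
    most 2. *)
Lemma schwartz_taylor f i : is_schwartz f -> exists C : R, forall x (h : R), `|h| <= 1 ->
  (1 + `|x|) ^+ (2 * d) * cnorm (f (x + h *: delta_mx 0 i) - f x - h%:C%C * cpderivs [:: i] f x)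
    <= C * h ^+ 2.
Proof.
move=> sf; have p1 := schwartz_is_pd i sf; have s1 := schwartz_pd i sf.
have p2 := schwartz_is_pd i s1; have s2 := schwartz_pd i s1.
set g := cpderivs [:: i] f in p1 s1 p2 s2 *.
set k := cpderivs [:: i] g in p2 s2.
have [M HM] := schwartz_rapid s2 (2 * d).
exists (2 * (2 ^+ (2 * d) * M)) => x h h1.
set e : 'rV[R]_d := delta_mx 0 i.
have ne : `|e| <= 1.
  rewrite [leLHS]mx_normrE; apply: bigmax_le => // -[a b] _.
  by rewrite /e mxE; case: (_ && _); rewrite ?normr1 ?normr0.
(* The mean value theorem holds for real functions only, whence the separate
   treatment of the real and imaginary parts. *)
have comp (F G K : 'rV[R]_d -> R) : (forall x, is_derive x e F (G x)) ->
    (forall x, is_derive x e G (K x)) -> (forall x, `|K x| <= cnorm (k x)) ->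
    (1 + `|x|) ^+ (2 * d) * `|F (x + h *: e) - F x - h * G x| <= 2 ^+ (2 * d) * M * h ^+ 2.
  move=> FG GK Kk.
  have [u uh E1] := mean_value_line FG x h.
  have [v vu E2] := mean_value_line GK x u.
  have -> : F (x + h *: e) - F x - h * G x = h * (u * K (x + v *: e)).
    by rewrite E1 -mulrBr E2.
  rewrite normrM normrM.
  have v1 : `|v| <= 1 by rewrite (le_trans vu)// (le_trans uh).
  have xv : 1 + `|x| <= 2 * (1 + `|x + v *: e|).
    have : `|x| <= `|x + v *: e| + `|v *: e|.
      by rewrite -[x in leLHS](addrK (v *: e)) (le_trans (ler_normB _ _)).
    rewrite normrZ; have : `|v| * `|e| <= 1 by rewrite mulr_ile1.
    have := normr_ge0 (x + v *: e); lra.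
  have xv' : (1 + `|x|) ^+ (2 * d) <= 2 ^+ (2 * d) * (1 + `|x + v *: e|) ^+ (2 * d).
    by rewrite -exprMn lerXn2r// nnegrE ?mulr_ge0// addr_ge0.
  have KM := le_trans (ler_wpM2l (exprn_ge0 (2 * d) (addr_ge0 ler01 (normr_ge0 (x + v *: e)))) (Kk _)) (HM (x + v *: e)).
  have P0 : 0 <= (2 : R) ^+ (2 * d) by rewrite exprn_ge0.
  have {}KM : (1 + `|x|) ^+ (2 * d) * `|K (x + v *: e)| <= 2 ^+ (2 * d) * M.
    apply: le_trans (ler_wpM2l P0 KM); rewrite mulrA ler_wpM2r//.
  have hu : `|h| * `|u| <= h ^+ 2.
    by rewrite -[h ^+ 2]real_normK ?num_real// expr2 ler_wpM2l.
  have := ler_pM (mulr_ge0 (exprn_ge0 (2 * d) (addr_ge0 ler01 (normr_ge0 x))) (normr_ge0 (K (x + v *: e)))) (mulr_ge0 (normr_ge0 h) (normr_ge0 u)) KM hu.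
  by apply: le_trans; rewrite le_eqVlt; apply/orP; left; apply/eqP; ring.
have := comp _ _ _ (fun x => (p1 x).1) (fun x => (p2 x).1) (fun x => normr_Re_le (k x)).
have := comp _ _ _ (fun x => (p1 x).2) (fun x => (p2 x).2) (fun x => normr_Im_le (k x)).
move=> c2 c1.
have p0 : 0 <= (1 + `|x|) ^+ (2 * d) by rewrite exprn_ge0// addr_ge0.
apply: le_trans (ler_wpM2l p0 (cnorm_le _)) _.
rewrite !(cReD, cImD, cReN, cImN, cReM, cImM)/= !mul0r subr0 addr0.
rewrite mulrDr mulr2n !mulrDl mul1r; exact: lerD.
Qed.

(** Integration by parts without boundary terms: the integral of f(x + h e)
    does not depend on h, so h times the integral of the derivative is
    bounded by the integral of the Taylor remainder, of order h^2. *)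
Lemma cintegral_pd0 f i : is_schwartz f -> cintegral (cpderivs [:: i] f) = 0.
Proof.
move=> sf; have [C HC] := schwartz_taylor i sf.
have s1 := schwartz_pd i sf.
have fi := schwartz_cintegrable sf; have gi := schwartz_cintegrable s1.
set e : 'rV[R]_d := delta_mx 0 i.
set I := cintegral _.
apply: cnorm_eq0; apply/eqP; rewrite eq_le cnorm_ge0 andbT.
have trf h : cintegral (fun x => f (x + h *: e)) = cintegral f.
  have := cintegral_affine (h *: e) (oner_neq0 R) fi.
  under eq_fun do rewrite scale1r.
  by rewrite normr1 expr1n invr1 mul1r.
have tri h : cintegrable (fun x => f (x + h *: e)).
  have := cintegrable_affine (h *: e) (oner_neq0 R) fi.
  by under eq_fun do rewrite scale1r.
have K h : 0 < h <= 1 -> cnorm I <= 2 * (C * decay_mass) * h.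
  move=> /andP[h0 h1].
  have -> : cnorm I = h^-1 * cnorm (- h%:C%C * I + (-1 * cintegral f + cintegral (fun x => f (x + h *: e)))).
    rewrite trf mulN1r addNr addr0 cnormM cnormN cnorm_real gtr0_norm//.
    by rewrite mulKf// gt_eqF.
  rewrite mulrC ler_pdivrMr// -!cintegral_linear//; last exact: cintegrable_linear.
  have -> : 2 * (C * decay_mass) * h * h = 2 * (C * h ^+ 2 * decay_mass) by ring.
  apply: cintegral_decay; first by do 2!apply: cintegrable_linear => //.
  move=> x; have := HC x h; rewrite gtr0_norm// => /(_ h1).
  congr (_ * cnorm _ <= _); rewrite -/e; ring.
set B := 2 * (C * decay_mass) in K.
rewrite leNgt; apply/negP => I0.
have B0 : 0 < B.
  by have := K 1; rewrite ltr01 lexx mulr1 => /(_ isT); exact: lt_le_trans.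
(* At this h the bound |I| <= B h gives |I| <= |I| / 2. *)
pose h := Num.min 1 (cnorm I / (2 * B)).
have h0 : 0 < h by rewrite lt_min ltr01 divr_gt0// mulr_gt0.
have h1 : h <= 1 by rewrite ge_min lexx.
have h2 : h <= cnorm I / (2 * B) by rewrite ge_min lexx orbT.
have := K h; rewrite h0 h1 => /(_ isT); apply/negP; rewrite -ltNge.
apply: (@le_lt_trans _ _ (B * (cnorm I / (2 * B)))); first by rewrite ler_pM2l.
have -> : B * (cnorm I / (2 * B)) = cnorm I / 2 by field; rewrite gt_eqF.
by rewrite ltr_pdivrMr// ltr_pMr// ltr1n.
Qed.

Lemma is_pd_cpderivs i f g : is_pd i f g -> cpderivs [:: i] f = g.
Proof. by move=> h; rewrite (cpderivs_rcons [::] h) cpderivs_nil. Qed.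

(** The derivative of f(x) e^(-i x xi) has integral 0; expand it by the
    Leibniz rule. *)
Lemma fourier_pd f i xi : is_schwartz f ->
  fourier (cpderivs [:: i] f) xi = ('i)%C * (xi 0 i)%:C%C * fourier f xi.
Proof.
move=> sf; have s1 := schwartz_pd i sf.
have se := schwartz_expiM xi sf.
have h := is_pdM (schwartz_is_pd i sf) (is_pd_expi i xi).
have E : cpderivs [:: i] (fun x => f x * expi (- dotp x xi)) =
    (fun x => - (('i)%C * (xi 0 i)%:C%C) * (f x * expi (- dotp x xi)) + cpderivs [:: i] f x * expi (- dotp x xi)).
  by rewrite (is_pd_cpderivs h); apply/funext => x; ring.
have := cintegral_pd0 i se; rewrite E cintegral_linear; last 2 first.
- exact: cintegrable_expiM (schwartz_cintegrable sf).
- exact: cintegrable_expiM (schwartz_cintegrable s1).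
move/eqP; rewrite addrC addr_eq0 mulNr opprK => /eqP E2.
by rewrite !fourierE E2; ring.
Qed.

Lemma cpderivs_nseqS i n f : is_schwartz f ->
  cpderivs (nseq n.+1 i) f = cpderivs (nseq n i) (cpderivs [:: i] f).
Proof.
move=> sf; rewrite -(cpderivs_rcons _ (schwartz_is_pd i sf)); congr cpderivs.
by elim: n => //= n ->.
Qed.

Lemma schwartz_pdn i n f : is_schwartz f -> is_schwartz (cpderivs (nseq n i) f).
Proof.
elim: n f => [|n IH] f sf; first by rewrite cpderivs_nil.
by rewrite cpderivs_nseqS//; apply: IH; exact: schwartz_pd.
Qed.

Lemma fourier_pdn i n f xi : is_schwartz f ->
  fourier (cpderivs (nseq n i) f) xi = (('i)%C * (xi 0 i)%:C%C) ^+ n * fourier f xi.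
Proof.
elim: n f => [|n IH] f sf; first by rewrite cpderivs_nil mul1r.
by rewrite cpderivs_nseqS// IH ?fourier_pd// ?exprSr ?mulrA//; exact: schwartz_pd.
Qed.

(** Multiplying the transform by xi_i^N amounts to differentiating f N
    times, and it suffices to do this for a coordinate i with |xi_i| = |xi|.
    The constant does not depend on f, so that the transform is continuous
    on the Schwartz space and inverse transforms of distributions are
    tempered. *)
Lemma fourier_decay N : exists C : R, forall f M, is_schwartz f ->
  (forall s x, (size s <= N + 2 * d)%N ->
     (1 + `|x|) ^+ (N + 2 * d) * cnorm (cpderivs s f x) <= M) ->
  forall xi, (1 + `|xi|) ^+ N * cnorm (fourier f xi) <= C * M.
Proof.
exists (2 ^+ N * (2 * (fconst * (2 * decay_mass)))) => f M sf HM xi.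
have HM' s : (size s <= N)%N -> forall x, (1 + `|x|) ^+ (2 * d) * cnorm (cpderivs s f x) <= M.
  move=> sN x; apply: le_trans (HM s x (leq_trans sN (leq_addr _ _))).
  by rewrite ler_wpM2r ?cnorm_ge0// ler_weXn2l ?lerDl// leq_addl.
set B := fconst * (2 * (M * decay_mass)).
have B1 : cnorm (fourier f xi) <= B.
  apply: fourier_bound; first exact: schwartz_cintegrable.
  by move=> x; have := HM' [::] isT x; rewrite cpderivs_nil.
have B2 i : `|xi 0 i| ^+ N * cnorm (fourier f xi) <= B.
  have -> : `|xi 0 i| ^+ N * cnorm (fourier f xi) = cnorm (fourier (cpderivs (nseq N i) f) xi).
    rewrite fourier_pdn// cnormM; congr (_ * _).
    elim: N {HM HM' B B1} => [|n IH]; first by rewrite !expr0 cnorm1.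
    rewrite !exprS IH cnormM; congr (_ * _); rewrite cnormM cnorm_real.
    by rewrite cnormE/= expr0n expr1n add0r sqrtr1 mul1r.
  apply: fourier_bound; first exact/schwartz_cintegrable/schwartz_pdn.
  by apply: HM'; rewrite size_nseq.
have B0 : 0 <= B by exact: le_trans (cnorm_ge0 _) B1.
have -> : 2 ^+ N * (2 * (fconst * (2 * decay_mass))) * M = 2 ^+ N * (2 * B).
  by rewrite /B; ring.
have T0 : (0 : R) <= 2 ^+ N by rewrite exprn_ge0.
have pw (t : R) : 0 <= t -> (1 + t) ^+ N <= 2 ^+ N * (1 + t ^+ N).
  move=> t0; have [t1|t1] := leP t 1.
    apply: (@le_trans _ _ (2 ^+ N)); last by rewrite ler_peMr// lerDl exprn_ge0.
    by rewrite lerXn2r ?nnegrE ?addr_ge0//; lra.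
  apply: (@le_trans _ _ (2 ^+ N * t ^+ N)); last by rewrite ler_wpM2l// lerDr.
  by rewrite -exprMn lerXn2r ?nnegrE ?addr_ge0 ?mulr_ge0//; lra.
have [->|x0] := eqVneq xi 0.
  rewrite normr0 addr0 expr1n mul1r.
  have {}B1 : cnorm (fourier f 0) <= B.
    apply: fourier_bound; first exact: schwartz_cintegrable.
    by move=> x; have := HM' [::] isT x; rewrite cpderivs_nil.
  apply: (le_trans B1); apply: (@le_trans _ _ (2 * B)); first by rewrite ler_peMl// ler1n.
  by apply: ler_peMl; [rewrite mulr_ge0|rewrite exprn_ege1// ler1n].
have [|[i0 i] E] := @mx_norm_neq0 _ _ _ xi.
  by rewrite -[mx_norm xi]/(`|xi|) normr_eq0.
rewrite -[mx_norm xi]/(`|xi|) /= ord1 in E; rewrite E.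
apply: le_trans (ler_wpM2r (cnorm_ge0 _) (pw _ (normr_ge0 _))) _.
rewrite -mulrA ler_wpM2l// mulrDl mul1r mulr2n mulrDl mul1r.
exact: lerD.
Qed.

Lemma schwartz_fourier f : is_schwartz f -> is_schwartz (fourier f).
Proof.
pose P (h : 'rV[R]_d -> R[i]) := exists2 f, is_schwartz f & h = fourier f.
move=> sf; apply: (@schwartz_coind _ _ P); last by exists f.
- move=> _ [g sg ->]; have [C HC] := fourierB_le sg.
  exact: ccontinuous_lipschitz HC.
- move=> _ [g sg ->] N; have [C HC] := fourier_decay N.
  have [M HM] := schwartz_bound (N + 2 * d) sg.
  by exists (C * M) => x; exact: HC.
- move=> _ i [g sg ->]; exists (fourier (fun x => - ('i)%C * (x 0 i)%:C%C * g x)).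
    by eexists; last reflexivity; exact: schwartz_coordM.
  exact: is_pd_fourier.
Qed.

Lemma cmeasurable_kernel : cmeasurableT
  (fun p : 'rV[R]_d * 'rV[R]_d => expi (- dotp p.1 p.2)).
Proof.
apply: cmeasurable_expi; apply: measurableT_comp => //.
exact: measurable_dotp.
Qed.

(** Fubini: both sides are the double integral of f(x) g(y) e^(-i x y). *)
Lemma fourier_dual f g : cintegrable f -> cintegrable g ->
  cintegral (fun x => fourier f x * g x) = cintegral (fun x => f x * fourier g x).
Proof.
move=> fi gi.
have fm := cintegrable_measurable fi; have gm := cintegrable_measurable gi.
pose k x y := f x * (g y * expi (- dotp x y)).
have [||i1 E] := @cintegral_Fubini _ _ _ _ (integrable_cnorm fi) (integrable_cnorm gi)
    (fun x => cnorm_ge0 _) (fun x => cnorm_ge0 _) k.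
- apply: cmeasurableM; first exact: cmeasurable_comp fm measurable_fst.
  apply: cmeasurableM; first exact: cmeasurable_comp gm measurable_snd.
  exact: cmeasurable_kernel.
- by move=> x y; rewrite /k cnormM cnormM cnorm_expi mulr1.
have L x : f x * fourier g x = fconst%:C%C * cintegral (k x).
  have -> : cintegral (k x) = f x * cintegral (fun y => g y * expi (- dotp y x)).
    rewrite -cintegralZ; last exact: cintegrable_expiM.
    by apply: eq_cintegral => y; rewrite /k dotpC.
  by rewrite fourierE; ring.
have L' y : fourier f y * g y = fconst%:C%C * cintegral (fun x => k x y).
  rewrite fourierE -mulrA; congr (_ * _).
  rewrite mulrC -cintegralZ; last exact: cintegrable_expiM.
  by apply: eq_cintegral => x; rewrite /k; ring.
under eq_fun do rewrite L'.
under [in RHS]eq_fun do rewrite L.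
have kab : cmeasurableT (fun p : 'rV[R]_d * 'rV[R]_d => k p.2 p.1).
  apply: cmeasurableM; first exact: cmeasurable_comp fm measurable_snd.
  apply: cmeasurableM; first exact: cmeasurable_comp gm measurable_fst.
  under eq_fun do rewrite dotpC; exact: cmeasurable_kernel.
have kle y x : cnorm (k x y) <= cnorm (g y) * cnorm (f x).
  by rewrite /k !cnormM cnorm_expi mulr1 mulrC.
pose k' y x := k x y.
have [i2 _] := @cintegral_Fubini _ _ _ _ (integrable_cnorm gi) (integrable_cnorm fi)
  (fun x => cnorm_ge0 _) (fun x => cnorm_ge0 _) k' kab kle.
have i2' : cintegrable (fun y => cintegral (fun x => k x y)) := i2.
by rewrite (cintegralZ _ i2') (cintegralZ _ i1) E.
Qed.

Lemma fourier_translate f y xi : cintegrable f ->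
  fourier (fun x => f (x + y)) xi = expi (dotp y xi) * fourier f xi.
Proof.
move=> fi; rewrite !fourierE mulrCA; congr (_ * _).
have ei := cintegrable_expiM xi fi.
have := cintegral_affine y (oner_neq0 R) (cintegrableZ (expi (dotp y xi)) ei).
rewrite normr1 expr1n invr1 mul1r => E; rewrite -cintegralZ// -E.
apply: eq_cintegral => x; rewrite scale1r mulrCA; congr (_ * _).
by rewrite -expiD dotpDl; congr expi; ring.
Qed.

Lemma fourier_scale f (a : R) xi : a != 0 -> cintegrable f ->
  fourier (fun x => f (a *: x)) xi = (`|a| ^- d)%:C%C * fourier f (a^-1 *: xi).
Proof.
move=> a0 fi; rewrite !fourierE mulrCA; congr (_ * _).
rewrite -(cintegral_affine 0 a0); last exact: cintegrable_expiM.
apply: eq_cintegral => x; rewrite addr0; congr (_ * expi (- _)).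
by rewrite dotpZl dotpZr mulrA divff// mul1r.
Qed.

Lemma fourier_opp f xi : cintegrable f ->
  fourier (fun x => f (- x)) xi = fourier f (- xi).
Proof.
move=> fi; have n0 : -1 != 0 :> R by rewrite oppr_eq0 oner_eq0.
have := fourier_scale xi n0 fi.
under eq_fun do rewrite scaleN1r; move=> ->.
by rewrite invrN1 scaleN1r normrN1 expr1n invr1 mul1r.
Qed.

End fourier_basic.

(** * Fourier inversion and the convolution theorem *)

Section gauss_integral.
Context {R : realType}.

(** A dilation of the integral of e^(-t^2), so as to match the normalisation
    for which the Gaussian is its own transform. *)
Lemma integral_gauss1 :
  (\int[lebesgue_measure]_t (expR (- (t ^+ 2) / 2))%:E = (Num.sqrt (2 * pi) : R)%:E)%E.
Proof.
have a0 : (Num.sqrt 2)^-1 != 0 :> R by rewrite invr_eq0 sqrtr_eq0 -ltNge.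
have := @ge0_integral_affine1 R _ 0 (EFin \o gauss_fun) a0.
move=> /(_ _ _) E; rewrite (_ : (fun t => _) = (fun t : R => (EFin \o gauss_fun) ((Num.sqrt 2)^-1 * t + 0))); last first.
  apply/funext => t /=; rewrite /gauss_fun addr0 exprMn exprVn sqr_sqrtr//.
  by congr (expR _)%:E; rewrite mulNr mulrC.
rewrite E; last 2 first.
- by apply/measurable_EFinP; exact: measurable_gauss_fun.
- by move=> t; rewrite lee_fin gauss_fun_ge0.
rewrite integralT_gauss normfV invrK -EFinM ger0_norm ?sqrtr_ge0//.
by rewrite sqrtrM.
Qed.

Lemma integral_gauss d : (\int[lebesgue_rV d]_x (gauss x)%:E =
  ((Num.sqrt (2 * pi) : R) ^+ d)%:E)%E.
Proof.
rewrite -(integral_prod_rV _ _ _ integral_gauss1).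
- apply: eq_integral => x _; rewrite /gauss -expR_sum; congr (expR _)%:E.
  by rewrite -mulr_suml sumrN.
- apply: measurableT_comp => //; apply: measurable_funM => //.
  by apply: measurableT_comp => //; exact: measurable_funX.
- by move=> t; exact: expR_ge0.
Qed.

Lemma fconst_gauss d : @fconst R d * Num.sqrt (2 * pi) ^+ d = 1 :> R.
Proof.
have p0 : 0 < 2 * pi :> R by rewrite mulr_gt0 ?pi_gt0.
rewrite -powR12_sqrt ?ltW// -powR_mulrn ?powR_ge0// -powRrM.
rewrite /fconst -powRD; last by rewrite (gt_eqF p0) implybT.
by rewrite (_ : - _ + _ = 0) ?powRr0//; field.
Qed.

Lemma cintegral_gauss d : cintegral (fun x : 'rV[R]_d => (gauss x)%:C%C) =
  ((@fconst R d)^-1)%:C%C.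
Proof.
apply: complexP => /=; last by rewrite Rintegral_cst// mul0r.
rewrite /Rintegral integral_gauss /=.
apply: (mulfI (lt0r_neq0 (@fconst_gt0 R d))).
by rewrite fconst_gauss mulfV// gt_eqF// fconst_gt0.
Qed.

End gauss_integral.

Section inversion.
Context {R : realType} {d : nat}.
Local Notation mu := (@lebesgue_rV R d).
Implicit Types (f g phi psi : 'rV[R]_d -> R[i]) (x y xi : 'rV[R]_d).

Lemma is_pd0_cst f : (forall i, is_pd i f (fun=> 0)) -> forall x, f x = f 0.
Proof.
move=> h x; rewrite [x in LHS]row_sum_delta.
elim: (index_enum _) => [|i s IH]; first by rewrite big_nil.
rewrite big_cons addrC -[RHS]IH; set y := \sum_(_ <- s) _.
apply: complexP.
  have [u _] := mean_value_line (fun x => (h i x).1) y (x 0 i).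
  by rewrite /= mulr0 => /eqP; rewrite subr_eq0 => /eqP.
have [u _] := mean_value_line (fun x => (h i x).2) y (x 0 i).
by rewrite /= mulr0 => /eqP; rewrite subr_eq0 => /eqP.
Qed.

(** Both the Gaussian and its transform satisfy d_i u = - x_i u, so their
    quotient has vanishing derivatives and is constant; the value at 0 is
    the integral of the Gaussian. *)
Lemma fourier_gauss : fourier (fun x : 'rV[R]_d => (gauss x)%:C%C) =
  (fun x => (gauss x)%:C%C).
Proof.
set G := fun x : 'rV[R]_d => (gauss x)%:C%C.
have sG : is_schwartz G := schwartz_gauss.
(* The reciprocal of the Gaussian. *)
pose W := fun x : 'rV[R]_d => (expR (-1 * (- (\sum_(i < d) x 0 i ^+ 2) / 2)))%:C%C : R[i].
have WG x : W x * G x = 1.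
  by rewrite /W /G -rmorphM -expRD mulN1r addNr expR0.
have pW i : is_pd i W (fun x => (x 0 i)%:C%C * W x).
  have := @is_pd_real R d i _ _ (is_derive_gauss (-1) i).
  congr is_pd; apply/funext => x.
  by rewrite opprK mul1r rmorphM.
have pG i : is_pd i (fourier G) (fun xi => - (xi 0 i)%:C%C * fourier G xi).
  have := is_pd_fourier i sG; congr is_pd; apply/funext => xi.
  have -> : (fun x => - 'i%C * (x 0 i)%:C%C * G x) = (fun x => 'i%C * cpderivs [:: i] G x).
    rewrite (is_pd_cpderivs (is_pd_gauss i)); apply/funext => x.
    by rewrite rmorphM rmorphN/= /G; ring.
  rewrite fourierZ; last exact/schwartz_cintegrable/schwartz_pd.
  rewrite fourier_pd// !mulrA.
  have -> : 'i%C * 'i%C = -1 :> R[i] by apply: complexP; rewrite ?cReM ?cImM/=; ring.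
  by rewrite mulN1r.
have H : forall x, fourier G x * W x = fourier G 0 * W 0.
  apply: is_pd0_cst => i; have := is_pdM (pG i) (pW i).
  congr is_pd; apply/funext => x; ring.
have G0 : fourier G 0 = 1.
  have E0 x : G x * expi (- dotp x 0) = G x.
    by rewrite /dotp big1 ?oppr0 ?expi0 ?mulr1// => i _; rewrite mxE mulr0.
  rewrite fourierE (eq_cintegral E0).
  rewrite cintegral_gauss -rmorphM mulfV ?rmorph1// gt_eqF//; exact: fconst_gt0.
apply/funext => x; rewrite -[LHS]mulr1 -(WG x) mulrA H G0 mul1r.
have -> : W 0 = 1.
  rewrite /W big1 ?oppr0 ?mul0r ?mulr0 ?expR0// => i _.
  by rewrite mxE expr0n.
by rewrite mul1r.
Qed.

(** With G the Gaussian and F the transform, duality and a change of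
    variables show that the integral of (F f)(xi) G(e xi) equals that of f(e
    x) G(x). Let e tend to 0 on both sides, by dominated convergence. *)
Lemma fourier_inversion0 f : is_schwartz f ->
  (@fconst R d)%:C%C * cintegral (fourier f) = f 0.
Proof.
move=> sf; set G := fun x : 'rV[R]_d => (gauss x)%:C%C : R[i].
have sG : is_schwartz G := schwartz_gauss.
have sF := schwartz_fourier sf.
have g0 : gauss (0 : 'rV[R]_d) = 1.
  rewrite /gauss big1 ?oppr0 ?mul0r ?expR0// => i _.
  by rewrite mxE expr0n.
have gle1 x : gauss (x : 'rV[R]_d) <= 1.
  rewrite /gauss -expR0 ler_expR mulNr oppr_le0 divr_ge0// sumr_ge0// => i _.
  exact: sqr_ge0.
pose e (n : nat) : R := n.+1%:R^-1.
have e0 n : e n != 0 by rewrite invr_eq0.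
have ce : e n @[n --> \oo] --> (0 : R) by exact: cvg_harmonic.
have cex x : e n *: x @[n --> \oo] --> (0 : 'rV[R]_d).
  by rewrite -[X in _ --> X](scale0r x); apply: cvgZr_tmp.
have comp (F : 'rV[R]_d -> R) x : continuous F -> F (e n *: x) @[n --> \oo] --> F 0.
  by move=> cF; apply: (cvg_comp _ _ (cex x)); exact: cF.
have KE n : cintegral (fun xi => fourier f xi * G (e n *: xi)) =
    cintegral (fun x => f (e n *: x) * G x).
  have Gi : cintegrable (fun x => G (e n *: x)).
    have := cintegrable_affine 0 (e0 n) (schwartz_cintegrable sG).
    by under eq_fun do rewrite addr0.
  rewrite (fourier_dual (schwartz_cintegrable sf) Gi).
  have -> : fourier (fun x => G (e n *: x)) =
      (fun x => (`|e n| ^- d)%:C%C * G ((e n)^-1 *: x)).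
    apply/funext => x; rewrite (fourier_scale x (e0 n) (schwartz_cintegrable sG)).
    by rewrite fourier_gauss.
  have sp := schwartz_cintegrable (schwartzM (schwartz_affine 0 (e0 n) sf) sG).
  have E := cintegral_affine 0 (invr_neq0 (e0 n)) sp.
  have H := cintegrable_affine 0 (invr_neq0 (e0 n)) sp.
  have fE x : f (e n *: ((e n)^-1 *: x + 0) + 0) * G ((e n)^-1 *: x + 0) =
      f x * G ((e n)^-1 *: x).
    by rewrite !addr0 scalerA mulfV// scale1r.
  have {}H : cintegrable (fun x => f x * G ((e n)^-1 *: x)).
    by apply: cintegrable_eq H => x; exact: fE.
  have -> : cintegral (fun x => f x * ((`|e n| ^- d)%:C%C * G ((e n)^-1 *: x))) =
      (`|e n| ^- d)%:C%C * cintegral (fun x => f x * G ((e n)^-1 *: x)).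
    by rewrite -(cintegralZ _ H); apply: eq_cintegral => x; rewrite mulrCA.
  rewrite -(eq_cintegral fE) E mulrA -rmorphM.
  have -> : `|e n| ^- d / `|(e n)^-1| ^+ d = 1.
    move: (e n) (e0 n) => a a0.
    by rewrite normfV exprVn divff// invr_eq0 expf_neq0// normr_eq0.
  rewrite rmorph1 mul1r.
  by apply: eq_cintegral => x; rewrite addr0.
have L1 : cnorm (cintegral (fun xi => fourier f xi * G (e n *: xi)) - cintegral (fourier f)) @[n --> \oo] --> 0.
  apply: cintegral_dct (integrable_cnorm (schwartz_cintegrable sF)) _.
  - move=> n; apply: ccontinuous_measurable; apply: schwartz_continuous.
    apply: (schwartzM sF).
    have := schwartz_affine 0 (e0 n) sG.
    by under eq_fun do rewrite addr0.
  - move=> x; have cg := comp _ x (@continuous_gauss R d); rewrite g0 in cg.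
    apply/cvg_cnormP; split.
      under eq_fun do rewrite cReM/= mulr0 subr0.
      have : complex.Re (fourier f x) * gauss (e n *: x) @[n --> \oo] --> complex.Re (fourier f x) * 1.
        by apply: cvgM => //; exact: cvg_cst.
      by rewrite mulr1.
    under eq_fun do rewrite cImM/= mulr0 add0r.
      have : complex.Im (fourier f x) * gauss (e n *: x) @[n --> \oo] --> complex.Im (fourier f x) * 1.
        by apply: cvgM => //; exact: cvg_cst.
      by rewrite mulr1.
  - move=> n x; rewrite cnormM cnorm_real gtr0_norm ?gauss_gt0//.
    by rewrite ler_piMr ?cnorm_ge0.
have [M HM] := schwartz_rapid sf 0.
have L2 : cnorm (cintegral (fun x => f (e n *: x) * G x) - cintegral (fun x => f 0 * G x)) @[n --> \oo] --> 0.
  apply: (@cintegral_dct _ _ _ _ (fun x => M * cnorm (G x))).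
  - move=> n; apply: ccontinuous_measurable; apply: schwartz_continuous.
    apply: (fun h => schwartzM h sG).
    have := schwartz_affine 0 (e0 n) sf.
    by under eq_fun do rewrite addr0.
  - move=> x; have [c1 c2] := schwartz_continuous sf.
    have := comp _ x c1; have := comp _ x c2 => cI cR.
    apply/cvg_cnormP; split.
      under eq_fun do rewrite cReM/= mulr0 subr0.
      rewrite cReM/= mulr0 subr0.
      by apply: cvgM => //; exact: cvg_cst.
    under eq_fun do rewrite cImM/= mulr0 add0r.
    rewrite cImM/= mulr0 add0r.
    by apply: cvgM => //; exact: cvg_cst.
  - exact: (integrableZl measurableT M (integrable_cnorm (schwartz_cintegrable sG))).
  - move=> n x; rewrite cnormM ler_wpM2r ?cnorm_ge0//.
    by have := HM (e n *: x); rewrite expr0 mul1r.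
have {}L2 : cnorm (cintegral (fun xi => fourier f xi * G (e n *: xi)) - cintegral (fun x => f 0 * G x)) @[n --> \oo] --> 0.
  by under eq_fun do rewrite KE.
rewrite (cnorm_cvg_unique L1 L2) (cintegralZ _ (schwartz_cintegrable sG)).
rewrite cintegral_gauss mulrCA -rmorphM mulfV ?rmorph1 ?mulr1//.
by rewrite gt_eqF// fconst_gt0.
Qed.

(** The inverse Fourier transform. *)
Definition ifourier f x := fourier f (- x).

(** Translate f so that the point of evaluation becomes 0. *)
Lemma fourierK f : is_schwartz f -> ifourier (fourier f) = f.
Proof.
move=> sf; apply/funext => x; rewrite /ifourier fourierE.
have := fourier_inversion0 (schwartz_translate x sf).
rewrite add0r => <-; congr (_ * _); apply: eq_cintegral => xi.
rewrite fourier_translate; last exact: schwartz_cintegrable.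
by rewrite mulrC dotpNr opprK dotpC.
Qed.

Lemma schwartz_ifourier f : is_schwartz f -> is_schwartz (ifourier f).
Proof. by move=> sf; apply: schwartz_opp; exact: schwartz_fourier. Qed.

Lemma ifourierK f : is_schwartz f -> fourier (ifourier f) = f.
Proof.
move=> sf; rewrite -[RHS](fourierK sf); apply/funext => x.
by rewrite /ifourier fourier_opp//; exact/schwartz_cintegrable/schwartz_fourier.
Qed.

(** By inversion, y |-> f(x - y) is the transform of F f modulated by x; the
    duality formula then moves this transform onto g. *)
Lemma convE f g : is_schwartz f -> is_schwartz g -> conv f g =
  (fun x => ((@fconst R d)^-1)%:C%C * ifourier (fun xi => fourier f xi * fourier g xi) x).
Proof.
move=> sf sg; apply/funext => x; rewrite /conv.
have sF := schwartz_fourier sf.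
have sh := schwartz_expiM (- x) sF.
set h := (fun x0 => _) in sh.
have fh y : f (x - y) = fourier h y.
  rewrite -[in LHS](fourierK sf) /ifourier opprB !fourierE; congr (_ * _).
  apply: eq_cintegral => xi; rewrite /h -mulrA -expiD; congr (_ * expi _).
  by rewrite dotpDr; ring.
under eq_cintegral do rewrite fh.
rewrite (fourier_dual (schwartz_cintegrable sh) (schwartz_cintegrable sg)).
rewrite /ifourier fourierE mulrA -rmorphM mulVf ?rmorph1 ?mul1r; last first.
  by rewrite gt_eqF// fconst_gt0.
by apply: eq_cintegral => xi; rewrite /h mulrAC.
Qed.

Lemma schwartz_convolution f g : is_schwartz f -> is_schwartz g ->
  is_schwartz (conv f g).
Proof.
move=> sf sg; rewrite convE//; apply: schwartzZ; apply: schwartz_ifourier.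
by apply: schwartzM; exact: schwartz_fourier.
Qed.

Lemma fourier_conv f g : is_schwartz f -> is_schwartz g ->
  fourier (conv f g) =
  (fun xi => ((@fconst R d)^-1)%:C%C * (fourier f xi * fourier g xi)).
Proof.
move=> sf sg.
have sFG := schwartzM (schwartz_fourier sf) (schwartz_fourier sg).
rewrite convE// fourierZ; last exact/schwartz_cintegrable/schwartz_ifourier.
by rewrite ifourierK.
Qed.

End inversion.

(** * A monotone class theorem for Schwartz functions *)

Section orthants.
Context {R : realType} {d : nat}.

(** The half-line bounded by c, or the whole line when c is None. With None,
    the whole space is itself an orthant and the orthants are stable under
    intersection. *)
Definition below (c : option R) (t : R) : bool :=
  if c is Some r then t <= r else true.

Definition orthant (a : 'I_d -> option R) : set 'rV[R]_d :=
  [set x | forall i, below (a i) (x 0 i)].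

Definition orthants : set (set 'rV[R]_d) := range orthant.

Lemma orthants_setI_closed : setI_closed orthants.
Proof.
move=> _ _ [a _ <-] [b _ <-].
exists (fun i => match a i, b i with
  | Some r, Some s => Some (Num.min r s) | Some r, None => Some r
  | None, c => c end) => //.
apply/seteqP; split=> x /=.
  move=> h; split=> i; have := h i; rewrite /below; case: (a i) (b i) => [r|] [s|]//.
    by rewrite le_min => /andP[].
  by rewrite le_min => /andP[].
by move=> [h1 h2] i; have := h1 i; have := h2 i; rewrite /below;
  case: (a i) (b i) => [r|] [s|]// h3 h4; rewrite le_min h4.
Qed.

Lemma measurable_orthant a : measurable (orthant a).
Proof.
have -> : orthant a = \bigcap_(i in setT) (rV_coord i @^-1` [set t | below (a i) t]).
  by apply/seteqP; split=> x h i; [move=> _; exact: h|exact: h].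
apply: fin_bigcap_measurable => // i _.
rewrite -[X in measurable X]setTI; apply: measurable_rV_coord => //.
case: (a i) => [r|] /=; last by rewrite (_ : [set _ | _] = setT)//; apply/seteqP.
by rewrite (_ : [set t | t <= r] = `]-oo, r]%classic).
Qed.

Lemma measurable_orthants : @measurable _ 'rV[R]_d = <<s orthants >>.
Proof.
apply/seteqP; split; last first.
  apply: smallest_sub; first exact: sigma_algebra_measurable.
  by move=> _ [a _ <-]; exact: measurable_orthant.
apply: smallest_sub; first exact: smallest_sigma_algebra.
rewrite -bigcup_seq => _ [i _ [C mC <-]] /=; rewrite setTI.
have sa := smallest_sigma_algebra [set: 'rV[R]_d] orthants.
suff : @measurable _ (measurableTypeR R) `<=` [set B | <<s orthants >> (rV_coord i @^-1` B)].
  by apply.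
rewrite [X in X `<=` _]RGenOInfty.measurableE.
apply: smallest_sub.
  split=> [|B mB|F mF] /=.
  - by rewrite preimage_set0; exact: sigma_algebra0.
  - by rewrite setTD; exact: (sigma_algebraC mB).
  - by rewrite preimage_bigcup; exact: sigma_algebra_bigcup.
move=> _ [r ->] /=.
pose a j := if j == i then Some r else None.
have -> : rV_coord i @^-1` `]r, +oo[ = ~` orthant a.
  apply/seteqP; split => x /=; rewrite in_itv/= andbT.
    by move=> rx /(_ i); rewrite /a /below eqxx leNgt rx.
  move=> h; rewrite ltNge; apply/negP => xr; apply: h => j.
  by rewrite /a /below; case: eqP => // ->.
by apply: sigma_algebraC; apply: sub_gen_smallest; exists a.
Qed.

End orthants.

Section cutoff.
Context {R : realType} {d : nat}.
Implicit Types (x : 'rV[R]_d) (a : 'I_d -> option R).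

(** The slope n^2 forces the value towards 0 on t > r, and the shift by n
    towards 1 on t <= r including the end point t = r. *)
Definition cutoff1 (n : nat) (c : option R) (t : R) : R :=
  if c is Some r then logistic (- n%:R ^+ 2 * t + (n%:R ^+ 2 * r + n%:R)) else 1.

Lemma cutoff1_ge0 n c t : 0 <= cutoff1 n c t.
Proof. by case: c => [r|] //=; exact/ltW/logistic_gt0. Qed.

Lemma cutoff1_le1 n c t : cutoff1 n c t <= 1.
Proof. by case: c => [r|] //=; exact: logistic_le1. Qed.

Lemma expRN_nat_le (n : nat) (t : R) : n%:R <= t -> expR (- t) <= n.+1%:R^-1.
Proof.
move=> nt; rewrite expRN lef_pV2 ?posrE ?expR_gt0//.
by rewrite -natr1 (le_trans _ (expR_ge1Dx t))// addrC lerD2l.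
Qed.

Lemma cvg_cutoff1 c (t : R) :
  cutoff1 n c t @[n --> \oo] --> ((below c t)%:R : R).
Proof.
case: c => [r|] /=; last exact: cvg_cst.
suff h : \forall n \near \oo, `|(t <= r)%R%:R - logistic (- n%:R ^+ 2 * t + (n%:R ^+ 2 * r + n%:R))| <= n.+1%:R^-1 :> R.
  apply/cvgrPdist_le => e e0; near=> n.
  apply: (@le_trans _ _ n.+1%:R^-1); first by near: n.
  near: n; have := @cvg_harmonic R => /cvgrPdist_le /(_ e e0).
  by apply: filterS => n /=; rewrite sub0r normrN ger0_norm ?invr_ge0.
have [tr|rt] := leP t r.
  apply: nearW => n; rewrite ger0_norm ?subr_ge0 ?logistic_le1//.
  apply: (le_trans (logistic_ge _)); apply: expRN_nat_le.
  have := mulr_ge0 (sqr_ge0 (n%:R : R)) (_ : 0 <= r - t).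
  rewrite subr_ge0 => /(_ tr); lra.
have rt0 : 0 < t - r by rewrite subr_gt0.
near=> n; rewrite sub0r normrN ger0_norm ?(ltW (logistic_gt0 _))//.
apply: (le_trans (logistic_le _)).
rewrite -[- _ * t + _]opprK; apply: expRN_nat_le.
have nr : 2 / (t - r) <= n%:R.
  by near: n; exact: nbhs_infty_ger.
rewrite ler_pdivrMr// in nr.
have n0 : 0 <= n%:R :> R by [].
have := ler_wpM2l n0 nr; rewrite expr2; lra.
Unshelve. all: by end_near. Qed.

Definition cutoff n a x : R := \prod_(i < d) cutoff1 n (a i) (x 0 i).

Lemma cutoff_ge0 n a x : 0 <= cutoff n a x.
Proof. by apply: prodr_ge0 => i _; exact: cutoff1_ge0. Qed.

Lemma cutoff_le1 n a x : cutoff n a x <= 1.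
Proof. by apply: prodr_ile1 => i _; rewrite cutoff1_ge0 cutoff1_le1. Qed.

Lemma indic_orthant a x : \1_(orthant a) x = \prod_(i < d) (below (a i) (x 0 i))%:R :> R.
Proof.
rewrite indicE; case: (pselect (orthant a x)) => [h|h].
  by rewrite mem_set// big1// => i _; rewrite h.
rewrite memNset//; have /existsNP[i /negP hi] := h.
by rewrite (bigD1 i)//= (negbTE hi) mul0r.
Qed.

Lemma cvg_cutoff a x : cutoff n a x @[n --> \oo] --> (\1_(orthant a) x : R).
Proof.
rewrite indic_orthant /cutoff.
elim: (index_enum _) => [|i s IH].
  by under eq_fun do rewrite big_nil; rewrite big_nil; exact: cvg_cst.
under eq_fun do rewrite big_cons; rewrite big_cons.
by apply: cvgM => //; exact: cvg_cutoff1.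
Qed.

Lemma schwartz_cutoff n a f : is_schwartz f ->
  is_schwartz (fun x => (cutoff n a x)%:C%C * f x).
Proof.
move=> sf; rewrite /cutoff; elim: (index_enum _) => [|i s IH].
  by under eq_fun do rewrite big_nil mul1r.
under eq_fun do rewrite big_cons rmorphM -mulrA.
case: (a i) => [r|] /=; last by under eq_fun do rewrite mul1r.
exact: schwartz_logisticM.
Qed.

End cutoff.

(** The abstract form of approximation by Schwartz functions.  V is the class
    to be enlarged and Dom the class of admissible dominating functions.  All
    approximations carry a Gaussian factor G, which provides the domination
    when nothing but an indicator function is at hand. *)
Section monotone_class.
Context {R : realType} {d : nat}.
Local Notation mu := (@lebesgue_rV R d).
Implicit Types (f g h : 'rV[R]_d -> R[i]) (x : 'rV[R]_d).
Variables (V Dom : ('rV[R]_d -> R[i]) -> Prop).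
Hypothesis V_linear : forall a f g, V f -> V g -> V (fun x => a * f x + g x).
Hypothesis V_schwartz : forall f, is_schwartz f -> V f.
Hypothesis V_lim : forall (f_ : nat -> 'rV[R]_d -> R[i]) f g,
  (forall n, V (f_ n)) -> (forall x, cnorm (f_ n x - f x) @[n --> \oo] --> 0) ->
  (forall n x, cnorm (f_ n x) <= cnorm (g x)) -> Dom g -> V f.
Hypothesis Dom_schwartz : forall f, is_schwartz f -> Dom f.

Let G x : R[i] := (gauss x)%:C%C.
Let sG : is_schwartz G. Proof. exact: schwartz_gauss. Qed.

Let V0 : V (fun=> 0).
Proof. by apply: V_schwartz; exact: is_schwartz0. Qed.

Let VZ a f : V f -> V (fun x => a * f x).
Proof. by move=> Vf; have := V_linear a Vf V0; under eq_fun do rewrite addr0. Qed.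

Let VD f g : V f -> V g -> V (fun x => f x + g x).
Proof. by move=> Vf Vg; have := V_linear 1 Vf Vg; under eq_fun do rewrite mul1r. Qed.

Let cvg_real (u : nat -> R) (l : R) (z : R[i]) : u n @[n --> \oo] --> l ->
  cnorm ((u n)%:C%C * z - l%:C%C * z) @[n --> \oo] --> 0.
Proof.
move=> ul; under eq_fun do rewrite -mulrBl -rmorphB cnormM cnorm_real.
have : `|u n - l| * cnorm z @[n --> \oo] --> `|l - l| * cnorm z.
  apply: cvgM; last exact: cvg_cst.
  by apply: cvg_norm; apply: cvgB => //; exact: cvg_cst.
by rewrite subrr normr0 mul0r.
Qed.

(** Smoothed indicators times a Gaussian are Schwartz functions. *)
Let V_orthant a : V (fun x => (\1_(orthant a) x)%:C%C * G x).
Proof.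
apply: (@V_lim (fun n x => (cutoff n a x)%:C%C * G x) _ G).
- by move=> n; apply: V_schwartz; exact: schwartz_cutoff.
- by move=> x; apply: cvg_real; exact: cvg_cutoff.
- move=> n x; rewrite cnormM cnorm_real ger0_norm ?cutoff_ge0//.
  by rewrite ler_piMl ?cnorm_ge0// cutoff_le1.
- exact: Dom_schwartz.
Qed.

(** The Dynkin pi-lambda theorem for the pi-system of orthants. *)
Let V_indic A : measurable A -> V (fun x => (\1_A x)%:C%C * G x).
Proof.
rewrite measurable_orthants => mA.
apply: (@dynkin_induction _ _ _ [set A | V (fun x => (\1_A x)%:C%C * G x)]
  measurable_orthants orthants_setI_closed) mA => /=.
- have := V_orthant (fun=> None); congr V; apply/funext => x.
  by congr (_%:C%C * _); rewrite !indicE; congr (_%:R); congr nat_of_bool; rewrite !mem_set.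
- by move=> _ [a _ <-]; exact: V_orthant.
- move=> S mS VS; have := V_linear (-1) VS (V_schwartz sG); congr V; apply/funext => x.
  by rewrite !indicE in_setC; case: (x \in S); rewrite /= ?rmorph1 ?rmorph0; ring.
- move=> F mF tF VF.
  pose S n := \big[setU/set0]_(k < n) F k.
  have VS n : V (fun x => (\1_(S n) x)%:C%C * G x).
    elim: n => [|n IH].
      by rewrite /S big_ord0; move: V0; congr V; apply/funext => x; rewrite indic0 mul0r.
    have := VD IH (VF n); congr V; apply/funext => x.
    rewrite /S big_ord_recr/= -mulrDl -rmorphD; congr (_%:C%C * _).
    rewrite !indicE in_setU.
    case: (boolP (x \in F n)) => xn; last by rewrite orbF addr0.
    have -> : (x \in \big[setU/set0]_(k < n) F k) = false; last by rewrite orFb add0r.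
    apply/negbTE; rewrite notin_setE -bigcup_mkord => -[k /= kn Fkx].
    have E : k = n by apply: (tF k n I I); exists x; split => //; exact: set_mem.
    by rewrite E ltnn in kn.
  apply: (@V_lim _ _ G VS); last exact: Dom_schwartz.
    move=> x; apply: cvg_real.
    rewrite indicE; case: (pselect ((\bigcup_k F k) x)) => [[k _ Fkx]|nF].
      rewrite mem_set; last by exists k.
      apply: (cvg_near_cst _); exists k.+1 => // n /= kn.
      rewrite indicE mem_set// /S -bigcup_mkord; exists k => //.
    rewrite memNset//; apply: (cvg_near_cst _); apply: nearW => n.
    rewrite indicE memNset// /S -bigcup_mkord => -[k _ Fkx]; apply: nF; exists k => //.
  move=> n x; rewrite cnormM cnorm_real ger0_norm// ler_piMl ?cnorm_ge0//.
Qed.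

Let V_sum (I : Type) (s : seq I) (h : I -> 'rV[R]_d -> R[i]) :
  (forall i, V (h i)) -> V (fun x => \sum_(i <- s) h i x).
Proof.
move=> Vh; elim: s => [|i s IH]; first by under eq_fun do rewrite big_nil.
by under eq_fun do rewrite big_cons; exact: VD.
Qed.

Let V_nnsfun (s : {nnsfun 'rV[R]_d >-> R}) : V (fun x => (s x)%:C%C * G x).
Proof.
under eq_fun do rewrite (fimfunEord s) rmorph_sum/= mulr_suml.
apply: V_sum => i; under eq_fun do rewrite rmorphM -mulrA.
by apply: VZ; apply: V_indic; exact: measurable_sfunP.
Qed.

(** Approximate k / G from below by simple functions and multiply back by G. *)
Let V_real (k : 'rV[R]_d -> R) g : measurable_fun setT k -> (forall x, 0 <= k x) ->
  (forall x, k x <= cnorm (g x)) -> Dom g -> V (fun x => (k x)%:C%C).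
Proof.
move=> mk k0 kg Dg.
pose q x := k x / gauss x.
have mq : measurable_fun setT (EFin \o q).
  apply/measurable_EFinP; apply: measurable_funM => //.
  apply: continuous_measurable_rV => x.
  have Fx : Filter (nbhs (x : 'rV[R]_d)) by exact: nbhs_filter.
  apply: cvgV; first by rewrite gt_eqF// gauss_gt0.
  exact: continuous_gauss.
have q0 x : (0 <= (EFin \o q) x)%E by rewrite lee_fin divr_ge0// ltW// gauss_gt0.
pose s n := nnsfun_approx measurableT mq n.
have cs x : s n x @[n --> \oo] --> q x.
  have := @cvg_nnsfun_approx _ _ _ _ measurableT _ mq (fun x _ => q0 x) x I.
  by move=> /fine_cvg.
have sq n x : s n x <= q x.
  rewrite -(cvg_lim _ (cs x))//; apply: (nondecreasing_cvgn_le (u_ := fun n => s n x)).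
    by move=> a b ab; have := nd_nnsfun_approx measurableT mq ab => /lefP; exact.
  exact: cvgP (cs x).
apply: (@V_lim _ _ g (fun n => V_nnsfun (s n)) _ _ Dg).
- move=> x; have -> : (k x)%:C%C = (q x)%:C%C * G x :> R[i].
    by rewrite /G -rmorphM /q divfK// gt_eqF// gauss_gt0.
  exact: cvg_real.
- move=> n x; apply: le_trans (kg x).
  rewrite cnormM !cnorm_real !ger0_norm ?(ltW (gauss_gt0 _))//.
  by rewrite -ler_pdivlMr ?gauss_gt0//; exact: sq.
Qed.

Theorem monotone_class f : cmeasurable f -> Dom f -> V f.
Proof.
move=> [f1 f2] Df.
have P (k : 'rV[R]_d -> R) : measurable_fun setT k -> (forall x, `|k x| <= cnorm (f x)) ->
    V (fun x => (k x)%:C%C).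
  move=> mk kf.
  have h1 : V (fun x => (Num.max (k x) 0)%:C%C).
    apply: (V_real _ _ _ Df); first exact: measurable_maxr.
      by move=> x; rewrite le_max lexx orbT.
    by move=> x; rewrite ge_max cnorm_ge0 (le_trans (ler_norm _) (kf x)).
  have h2 : V (fun x => (Num.max (- k x) 0)%:C%C).
    apply: (V_real _ _ _ Df); first by apply: measurable_maxr => //; exact: measurableT_comp.
      by move=> x; rewrite le_max lexx orbT.
    by move=> x; rewrite ge_max cnorm_ge0 (le_trans (ler_norm _))// normrN kf.
  have := V_linear (-1) h2 h1; congr V; apply/funext => x.
  rewrite mulN1r -rmorphN -rmorphD; congr (_%:C)%C.
  have [k0|k0] := leP 0 (k x).
    by rewrite max_r ?oppr_le0// oppr0 add0r.
  by rewrite max_l ?opprK ?addr0// oppr_ge0 ltW.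
have := V_linear ('i)%C (P _ f2 (fun x => normr_Im_le _)) (P _ f1 (fun x => normr_Re_le _)).
congr V; apply/funext => x; apply: complexP; rewrite ?cReD ?cImD ?cReM ?cImM/=; ring.
Qed.

End monotone_class.

(** * Schwartz functions in weighted Lebesgue spaces *)

Section separation.
Context {R : realType} {d : nat}.
Local Notation mu := (@lebesgue_rV R d).
Implicit Types (f g h phi : 'rV[R]_d -> R[i]) (x : 'rV[R]_d).

Lemma schwartz_measurable f : is_schwartz f -> cmeasurable f.
Proof. by move=> sf; apply: ccontinuous_measurable; exact: schwartz_continuous. Qed.

(** The class of f for which h f is integrable with integral 0 is a monotone
    class, so it contains the product of the complex conjugate of h with a
    positive function k, chosen so small that |h|^2 k is bounded by the
    Gaussian. The integral of |h|^2 k then vanishes. *)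
Lemma schwartz_separating h : cmeasurable h ->
  (forall phi, is_schwartz phi -> cintegrable (fun x => h x * phi x)) ->
  (forall phi, is_schwartz phi -> cintegral (fun x => h x * phi x) = 0) ->
  {ae mu, forall x, h x = 0}.
Proof.
move=> mh hi h0.
pose V f := [/\ cmeasurable f, cintegrable (fun x => h x * f x) &
  cintegral (fun x => h x * f x) = 0].
pose Dom g := cintegrable (fun x => h x * g x).
have VDom f : cmeasurable f -> Dom f -> V f.
  apply: monotone_class.
  - move=> a f1 f2 [m1 i1 E1] [m2 i2 E2].
    have E x : h x * (a * f1 x + f2 x) = a * (h x * f1 x) + h x * f2 x by ring.
    split.
    + apply: cmeasurableD => //; apply: cmeasurableM => //; exact: cmeasurable_cst.
    + under eq_fun do rewrite E; exact: cintegrable_linear.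
    + under eq_fun do rewrite E.
      by rewrite cintegral_linear// E1 E2 mulr0 addr0.
  - move=> f1 sf; split; [exact: schwartz_measurable|exact: hi|exact: h0].
  - move=> f_ f1 g Vf cf fg Dg.
    have mf1 : cmeasurable f1 by apply: cmeasurable_lim cf => n; case: (Vf n).
    have fle n x : cnorm (h x * f_ n x) <= cnorm (h x * g x).
      by rewrite !cnormM ler_wpM2l ?cnorm_ge0.
    have c1 x : cnorm (h x * f_ n x - h x * f1 x) @[n --> \oo] --> 0.
      under eq_fun do rewrite -mulrBr cnormM.
      have : cnorm (h x) * cnorm (f_ n x - f1 x) @[n --> \oo] --> cnorm (h x) * 0.
        by apply: cvgM; [exact: cvg_cst|exact: cf].
      by rewrite mulr0.
    have L := cintegral_dct (fun n => cmeasurableM mh (let: And3 m _ _ := Vf n in m)) c1 (integrable_cnorm Dg) fle.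
    split => //.
    + apply: cintegrable_le (integrable_cnorm Dg) _; first exact: cmeasurableM.
      move=> x; have /cvg_cnormP[_ _] := c1 x.
      have cn : cnorm (h x * f_ n x) @[n --> \oo] --> cnorm (h x * f1 x).
        exact: cvg_cnorm.
      rewrite -(cvg_lim _ cn)//; apply: limr_le; first exact: cvgP cn.
      by apply: nearW => n; exact: fle.
    + apply: esym; apply: cnorm_cvg_unique _ L.
      have E n : cintegral (fun x => h x * f_ n x) = 0 by case: (Vf n).
      by under eq_fun do rewrite E subrr cnorm0; exact: cvg_cst.
  - exact: hi.
pose c x := (complex.Re (h x) -i* complex.Im (h x))%C.
pose k x : R := gauss x / (1 + cnorm (h x) ^+ 2).
have mk : measurable_fun setT k.
  apply: measurable_funM.
    by apply: continuous_measurable_rV; exact: continuous_gauss.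
  apply: (measurableT_comp (f := fun t : R => (1 + t ^+ 2)^-1)); last exact: measurable_cnorm.
  by apply: continuous_measurable_fun => t; exact: (@continuous_oneDsqrV R t).
have hk x : h x * (c x * (k x)%:C%C) = (cnorm (h x) ^+ 2 * k x)%:C%C.
  have E : cnorm (h x) ^+ 2 = complex.Re (h x) ^+ 2 + complex.Im (h x) ^+ 2.
    by rewrite cnormE sqr_sqrtr// addr_ge0// sqr_ge0.
  by apply: complexP; rewrite !(cReM, cImM)/= ?E; ring.
have k0 x : 0 < k x by rewrite divr_gt0 ?gauss_gt0// ltr_wpDr ?sqr_ge0.
have mc : cmeasurable c.
  by case: mh => m1 m2; split => //=; exact: measurableT_comp.
have mck : cmeasurable (fun x => c x * (k x)%:C%C).
  by apply: cmeasurableM => //; exact: cmeasurable_real.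
have [|_ i1 E1] := VDom _ mck.
  apply: cintegrable_le (integrable_cnorm (schwartz_cintegrable schwartz_gauss)) _.
    exact: cmeasurableM.
  move=> x; rewrite hk !cnorm_real ger0_norm; last by rewrite mulr_ge0 ?sqr_ge0 ?(ltW (k0 x)).
  rewrite ger0_norm ?(ltW (gauss_gt0 _))// /k mulrA ler_pdivrMr ?ltr_wpDr ?sqr_ge0//.
  by rewrite mulrC ler_wpM2l ?(ltW (gauss_gt0 _))// lerDr.
have [i2 _] := i1.
have R0 : (\int[mu]_x (cnorm (h x) ^+ 2 * k x)%:E = 0)%E.
  have := congr1 (@complex.Re R) E1; rewrite /= /Rintegral.
  under eq_integral do rewrite hk /=.
  move=> H; rewrite -[LHS]fineK ?H//.
  have : mu.-integrable setT (fun x => (cnorm (h x) ^+ 2 * k x)%:E).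
    by move: i2; under eq_fun do rewrite hk/=.
  exact: integrable_fin_num.
have p0 x : 0 <= cnorm (h x) ^+ 2 * k x by rewrite mulr_ge0 ?sqr_ge0 ?(ltW (k0 x)).
have mF : measurable_fun setT (fun x => (cnorm (h x) ^+ 2 * k x)%:E).
  apply/measurable_EFinP; apply: measurable_funM => //.
  by apply: measurable_funX; exact: measurable_cnorm.
have : ae_eq mu setT (fun x => (cnorm (h x) ^+ 2 * k x)%:E) (cst 0%E).
  apply/(ae_eq_integral_abs mu measurableT mF).
  rewrite -[RHS]R0; apply: eq_integral => x _.
  by rewrite gee0_abs// lee_fin.
apply: filterS => x /(_ I)[] /eqP.
by rewrite mulf_eq0 (gt_eqF (k0 x)) orbF sqrf_eq0 => /eqP/cnorm_eq0.
Qed.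

End separation.

Section lnorm.
Context d (T : measurableType d) (R : realType).
Variable mu : {measure set T -> \bar R}.
Local Open Scope ereal_scope.

Lemma le_Lnorm (p : \bar R) (f g : T -> R) : 1 <= p ->
  measurable_fun setT f -> measurable_fun setT g ->
  {ae mu, forall x, (`|f x| <= `|g x|)%R} ->
  'N[mu]_p[EFin \o f] <= 'N[mu]_p[EFin \o g].
Proof.
rewrite unlock; case: p => [p| |]; [|move=> _ mf mg fg|by []]; last first.
  case: ifPn => // _; apply: le_ess_sup.
  by apply: filterS fg => x; rewrite /= lee_fin.
rewrite lee_fin => p1 mf mg fg.
have p0 : (0 < p)%R by exact: lt_le_trans p1.
apply: gt0_ler_poweR; rewrite ?invr_ge0 ?(ltW p0)//.
- by rewrite in_itv/= leey andbT; apply: integral_ge0 => x _; rewrite /= lee_fin powR_ge0.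
- by rewrite in_itv/= leey andbT; apply: integral_ge0 => x _; rewrite /= lee_fin powR_ge0.
apply: ae_ge0_le_integral => //.
- by move=> x _; exact: poweR_ge0.
- apply/measurable_EFinP; apply: (measurableT_comp (measurable_powR _)).
  exact: measurableT_comp.
- by move=> x _; exact: poweR_ge0.
- apply/measurable_EFinP; apply: (measurableT_comp (measurable_powR _)).
  exact: measurableT_comp.
- apply: filterS fg => x fgx _; rewrite /= lee_fin.
  by apply: ge0_ler_powR; rewrite ?nnegrE ?(ltW p0).
Qed.

Lemma ae_eq_Lnorm (p : \bar R) (f g : T -> R) : 1 <= p ->
  measurable_fun setT f -> measurable_fun setT g ->
  {ae mu, forall x, f x = g x} ->
  'N[mu]_p[EFin \o f] = 'N[mu]_p[EFin \o g].
Proof.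
move=> p1 mf mg fg; apply/eqP; rewrite eq_le !le_Lnorm//.
  by apply: filterS fg => x ->.
by apply: filterS fg => x ->.
Qed.

Lemma LnormZ_ge0 (p : \bar R) (c : R) (f : T -> R) : 1 <= p -> (0 <= c)%R ->
  measurable_fun setT f ->
  'N[mu]_p[EFin \o (fun x => c * f x)%R] = c%:E * 'N[mu]_p[EFin \o f].
Proof.
rewrite unlock; case: p => [p| |]; [|move=> _ c0 mf|by []]; last first.
  case: ifPn => [mu0|]; last by rewrite mule0.
  rewrite -(ess_supZl _ mu0 c0); congr ess_sup; apply/funext => x /=.
  by rewrite normrM ger0_norm.
rewrite lee_fin => p1 c0 mf.
have p0 : (0 < p)%R by exact: lt_le_trans p1.
under eq_integral => x _.
  rewrite (_ : `|(EFin \o (fun x => c * f x)%R) x| `^ p = (c `^ p)%:E * (`|(EFin \o f) x| `^ p)); last first.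
    by rewrite /= normrM powRM// ger0_norm.
  over.
rewrite ge0_integralZl//; last 3 first.
- apply/measurable_EFinP; apply: (measurableT_comp (measurable_powR _)).
  exact: measurableT_comp.
- by move=> x _; exact: poweR_ge0.
- by rewrite lee_fin powR_ge0.
rewrite poweRM ?lee_fin ?powR_ge0//; last by apply: integral_ge0 => x _; exact: poweR_ge0.
by rewrite poweR_EFin -powRrM mulfV ?gt_eqF// powRr1.
Qed.

End lnorm.

Section weighted.
Context {R : realType} {d : nat}.
Local Notation mu := (@lebesgue_rV R d).
Implicit Types (f g h phi : 'rV[R]_d -> R[i]) (x : 'rV[R]_d).

Lemma powR_le_self (a r : R) : 0 < a -> a <= 1 -> 1 <= r -> a `^ r <= a.
Proof.
move=> a0 a1 r1; have -> : a `^ r = a * a `^ (r - 1).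
  by rewrite -{2}[a]powRr1 ?(ltW a0)// -powRD ?(gt_eqF a0) ?implybT// addrC subrK.
have E1 : (1 : R) `^ (r - 1) = 1 by rewrite powR1.
rewrite ler_piMr ?(ltW a0)// -[leRHS]E1.
by apply: ge0_ler_powR; rewrite ?nnegrE ?subr_ge0 ?(ltW a0).
Qed.

Lemma lebesgue_rV_gt0 : (0 < mu setT)%E.
Proof.
rewrite lt0e measure_ge0 andbT; apply/eqP => m0.
have : (\int[mu]_x (gauss x)%:E = 0)%E.
  by apply: null_set_integral => //; apply/measurable_EFinP; apply: continuous_measurable_rV; exact: continuous_gauss.
rewrite integral_gauss => -[] /eqP; rewrite gt_eqF// exprn_gt0// sqrtr_gt0.
by rewrite mulr_gt0 ?pi_gt0.
Qed.

Variables (p : \bar R) (w : 'rV[R]_d -> R).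
Hypotheses (p1 : (1 <= p)%E) (w0 : forall x, 0 < w x) (mw : measurable_fun setT w).

(** The norm of the weighted space L^p_(w). *)
Definition wnorm f : \bar R := 'N[mu]_p[(fun x => (cnorm (f x) * w x)%:E)]%E.

Let mfw f : cmeasurable f -> measurable_fun setT (fun x => cnorm (f x) * w x).
Proof. by move=> mf; apply: measurable_funM => //; exact: measurable_cnorm. Qed.

Let fw0 f x : 0 <= cnorm (f x) * w x.
Proof. by rewrite mulr_ge0 ?cnorm_ge0 ?ltW. Qed.

Lemma wnorm_ge0 f : (0 <= wnorm f)%E.
Proof. exact: Lnorm_ge0. Qed.

Lemma wnorm_le (c : R) f g : cmeasurable f -> cmeasurable g -> 0 <= c ->
  {ae mu, forall x, cnorm (f x) <= c * cnorm (g x)} ->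
  (wnorm f <= c%:E * wnorm g)%E.
Proof.
move=> mf mg c0 fg.
rewrite /wnorm -(LnormZ_ge0 mu p1 c0 (mfw mg)).
apply: (le_Lnorm (f := fun x => cnorm (f x) * w x)) => //; first exact: mfw.
  by apply: measurable_funM => //; exact: mfw.
apply: filterS fg => x fgx.
rewrite !ger0_norm ?mulr_ge0 ?cnorm_ge0 ?(ltW (w0 x))//.
by rewrite mulrA ler_wpM2r// ltW.
Qed.

Lemma ae_eq_wnorm f g : cmeasurable f -> cmeasurable g ->
  {ae mu, forall x, f x = g x} -> wnorm f = wnorm g.
Proof.
move=> mf mg fg.
apply: (ae_eq_Lnorm (f := fun x => cnorm (f x) * w x) (g := fun x => cnorm (g x) * w x)) => //; try exact: mfw.
by apply: filterS fg => x ->.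
Qed.

Lemma wnormD_le f g : cmeasurable f -> cmeasurable g ->
  (wnorm (fun x => f x + g x)%R <= wnorm f + wnorm g)%E.
Proof.
move=> mf mg; have := eminkowski mu (mfw mf) (mfw mg) p1; apply: le_trans.
apply: (le_Lnorm (f := fun x => cnorm (f x + g x) * w x)
  (g := (fun x => cnorm (f x) * w x) \+ (fun x => cnorm (g x) * w x))) => //.
- by apply: mfw; exact: cmeasurableD.
- by apply: measurable_funD; exact: mfw.
- apply: nearW => x /=.
  rewrite ger0_norm ?mulr_ge0 ?cnorm_ge0 ?(ltW (w0 x))// ger0_norm ?addr_ge0//.
  by rewrite -mulrDl ler_wpM2r ?cnormD// ltW.
Qed.

Lemma wnormZ_le (c : R[i]) f : cmeasurable f ->
  (wnorm (fun x => c * f x)%R <= (cnorm c)%:E * wnorm f)%E.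
Proof.
move=> mf; apply: wnorm_le => //; last by apply: nearW => x; rewrite cnormM.
  by apply: cmeasurableM => //; exact: cmeasurable_cst.
exact: cnorm_ge0.
Qed.

Lemma wnormN f : wnorm (fun x => - f x) = wnorm f.
Proof. by rewrite /wnorm; under eq_fun do rewrite cnormN. Qed.

Lemma wnorm_eq0 f : cmeasurable f -> wnorm f = 0%E -> {ae mu, forall x, f x = 0}.
Proof.
move=> mf f0.
have mf' : measurable_fun setT (fun x => (cnorm (f x) * w x)%:E).
  by apply/measurable_EFinP; exact: mfw.
have := Lnorm_eq0_eq0 mf' (lt_le_trans lte01 p1) f0.
apply: filterS => x /(_ I)[] /eqP; rewrite mulf_eq0 (gt_eqF (w0 x)) orbF.
by move=> /eqP/cnorm_eq0.
Qed.

(** For p = oo use that decay is bounded, for p < oo that decay^p <= decay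
    is integrable. *)
Lemma wnorm_decay_lty f (M : R) : cmeasurable f ->
  (forall x, cnorm (f x) * w x <= M * decay x) -> (wnorm f < +oo)%E.
Proof.
move=> mf fM.
have M0 : 0 <= M.
  by have := le_trans (fw0 f 0) (fM 0); rewrite pmulr_lge0// decay_gt0.
rewrite /wnorm unlock; case: p p1 => [r|_|//]; last first.
  case: ifPn => _; last exact: ltry.
  apply: (@le_lt_trans _ _ M%:E); last exact: ltry.
  apply/ess_supP; apply: nearW => x /=; rewrite lee_fin ger0_norm//.
  apply: (le_trans (fM x)); rewrite ler_piMr//; exact: decay_le1.
rewrite lee_fin => r1; apply: poweR_lty.
have r0 : 0 < r by exact: lt_le_trans r1.
apply: (@le_lt_trans _ _ (\int[mu]_x (M `^ r * decay x)%:E)%E); last first.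
  apply: (integrable_lty measurableT).
  exact: (integrableZl measurableT (M `^ r) (@integrable_decay R d)).
apply: ge0_le_integral => //.
- by move=> x _; exact: poweR_ge0.
- apply/measurable_EFinP; apply: (measurableT_comp (measurable_powR _)).
  by apply: measurableT_comp => //; exact: mfw.
- by apply/measurable_EFinP; apply: measurable_funM => //; exact: measurable_decay.
- move=> x _; rewrite /= lee_fin ger0_norm//.
  have d0 := ltW (decay_gt0 x).
  apply: (@le_trans _ _ ((M * decay x) `^ r)).
    by apply: ge0_ler_powR; rewrite ?nnegrE ?(ltW r0) ?mulr_ge0 ?cnorm_ge0 ?(ltW (w0 x)).
  rewrite powRM// ler_wpM2l ?powR_ge0//.
  exact: powR_le_self (decay_gt0 x) (decay_le1 x) r1.
Qed.

(** A cheap substitute for the inequality of Hoelder: u decay is bounded by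
    decay where u <= 1 and by u^p where u > 1. If p = oo, then u is bounded. *)
Lemma wnorm_integrable f : cmeasurable f -> (wnorm f < +oo)%E ->
  mu.-integrable setT (fun x => (cnorm (f x) * w x * decay x)%:E).
Proof.
move=> mf fo.
have mF : measurable_fun setT (fun x => (cnorm (f x) * w x * decay x)%:E).
  apply/measurable_EFinP; apply: measurable_funM; first exact: mfw.
  exact: measurable_decay.
apply/integrableP; split => //.
move: p1 fo; rewrite /wnorm unlock; case: p => [r r1|_|//]; last first.
  rewrite lebesgue_rV_gt0 => fo.
  set B := ess_sup_inf.ess_sup _ _ in fo.
  have B0 : (0 <= B)%E by apply: ess_sup_gee; [exact: lebesgue_rV_gt0|apply: nearW => x; exact: abse_ge0].
  have Bf : B = (fine B)%:E by rewrite fineK// ge0_fin_numE.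
  apply: (@le_lt_trans _ _ (\int[mu]_x (fine B * decay x)%:E)%E); last first.
    apply: (integrable_lty measurableT).
    exact: (integrableZl measurableT (fine B) (@integrable_decay R d)).
  apply: ae_ge0_le_integral => //.
  - exact: measurableT_comp.
  - by move=> x _; rewrite lee_fin mulr_ge0 ?fine_ge0// ltW// decay_gt0.
  - by apply/measurable_EFinP; apply: measurable_funM => //; exact: measurable_decay.
  have := @ess_sup_ge _ _ _ mu (abse \o (fun x => (cnorm (f x) * w x)%:E)).
  rewrite -/B Bf; apply: filterS => x /=; rewrite !lee_fin => h _.
  rewrite ger0_norm ?mulr_ge0 ?cnorm_ge0 ?(ltW (w0 x)) ?(ltW (decay_gt0 x))// ler_wpM2r ?(ltW (decay_gt0 x))//.
  by rewrite (le_trans _ h)// ler_norm.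
rewrite lee_fin in r1; have r0 : 0 < r by exact: lt_le_trans r1.
move=> /lty_poweRy; rewrite invr_eq0 (gt_eqF r0) => /(_ isT) fo.
apply: (@le_lt_trans _ _ (\int[mu]_x ((decay x)%:E + `|(cnorm (f x) * w x)%:E| `^ r))%E).
  apply: ge0_le_integral => //.
  - exact: measurableT_comp.
  - apply/measurable_EFinP; apply: measurable_funD; first exact: measurable_decay.
    apply: (measurableT_comp (measurable_powR _)).
    by apply: measurableT_comp => //; exact: mfw.
  - move=> x _; rewrite /= lee_fin.
    have d0 := ltW (decay_gt0 x); have d1 := decay_le1 x.
    have u0 := fw0 f x.
    rewrite !ger0_norm ?mulr_ge0 ?cnorm_ge0 ?(ltW (w0 x))//.
    set u := cnorm (f x) * w x in u0 *.
    have [u1|u1] := leP u 1.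
      by rewrite (@le_trans _ _ (decay x))// ?ler_piMl// lerDl powR_ge0.
    apply: (@le_trans _ _ u); first by rewrite ler_piMr.
    apply: (@le_trans _ _ (u `^ r)); last by rewrite lerDr.
    rewrite -[leLHS]powRr1//; apply: ler_powR => //; exact: ltW.
rewrite ge0_integralD//; last 4 first.
- by move=> x _; rewrite lee_fin ltW// decay_gt0.
- by apply/measurable_EFinP; exact: measurable_decay.
- by move=> x _; rewrite /= lee_fin powR_ge0.
- apply/measurable_EFinP; apply: (measurableT_comp (measurable_powR _)).
  by apply: measurableT_comp => //; exact: mfw.
rewrite lte_add_pinfty//; exact: (integrable_lty measurableT (@integrable_decay R d)).
Qed.

Lemma schwartz_wnorm_lty (w_poly : exists k (C : R), forall x, w x <= C * (1 + `|x|) ^+ k) f :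
  is_schwartz f -> (wnorm f < +oo)%E.
Proof.
move=> sf; have [k [C wC]] := w_poly.
have [M HM] := schwartz_rapid sf (k + 2 * d).
apply: (@wnorm_decay_lty _ (`|C| * M)); first exact: schwartz_measurable.
move=> x; have pk : 0 <= (1 + `|x|) ^+ k by rewrite exprn_ge0// addr_ge0.
apply: (@le_trans _ _ (`|C| * (cnorm (f x) * (1 + `|x|) ^+ k))).
  rewrite mulrCA ler_wpM2l ?cnorm_ge0// (le_trans (wC x))//.
  by rewrite ler_wpM2r// ler_norm.
rewrite -mulrA ler_wpM2l//.
have := HM x; rewrite exprD -mulrA => {}HM.
have := @le_decay R d (fun x => f x * ((1 + `|x|) ^+ k)%:C%C) x M.
rewrite cnormM cnorm_real (ger0_norm pk); apply.
by apply: le_trans HM; rewrite le_eqVlt; apply/orP; left; apply/eqP; ring.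
Qed.

End weighted.

Section density.
Context {R : realType} {d : nat}.
Local Notation mu := (@lebesgue_rV R d).
Implicit Types (f g h phi : 'rV[R]_d -> R[i]) (x : 'rV[R]_d).
Variables (p : R) (w : 'rV[R]_d -> R).
Hypotheses (p1 : 1 <= p) (w0 : forall x, 0 < w x) (mw : measurable_fun setT w).
Hypothesis w_poly : exists k (C : R), forall x, w x <= C * (1 + `|x|) ^+ k.

Let p1' : (1 <= p%:E)%E. Proof. by rewrite lee_fin. Qed.
Let p0 : 0 < p. Proof. exact: lt_le_trans p1. Qed.
Let mfw f : cmeasurable f -> measurable_fun setT (fun x => cnorm (f x) * w x).
Proof. by move=> mf; apply: measurable_funM => //; exact: measurable_cnorm. Qed.

(** Dominated convergence for the p-th powers. *)
Lemma wnorm_cvg0 (f_ : nat -> 'rV[R]_d -> R[i]) f g :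
  (forall n, cmeasurable (f_ n)) -> cmeasurable f -> cmeasurable g ->
  (forall x, cnorm (f_ n x - f x) @[n --> \oo] --> 0) ->
  (forall n x, cnorm (f_ n x) <= cnorm (g x)) -> (wnorm p%:E w g < +oo)%E ->
  forall e : R, 0 < e ->
  exists n, (wnorm p%:E w (fun x => f_ n x - f x)%R < e%:E)%E.
Proof.
move=> mf_ mf mg cf fg gp e e0.
have gi : mu.-integrable setT (fun x => ((2 * (cnorm (g x) * w x)) `^ p)%:E).
  have : mu.-integrable setT (fun x => ((cnorm (g x) * w x) `^ p)%:E).
    apply/integrableP; split.
      by apply/measurable_EFinP; apply: (measurableT_comp (measurable_powR _)); exact: mfw.
    move: gp; rewrite /wnorm unlock => /lty_poweRy; rewrite invr_eq0 (gt_eqF p0) => /(_ isT).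
    congr (_ < _)%E; apply: eq_integral => x _ /=.
    by rewrite ger0_norm ?mulr_ge0 ?cnorm_ge0 ?(ltW (w0 x))// ger0_norm ?powR_ge0.
  move=> /(integrableZl measurableT (2 `^ p)); congr integrable.
  apply/funext => x; by rewrite [in RHS]powRM ?mulr_ge0 ?cnorm_ge0 ?(ltW (w0 x)).
have fg' x : cnorm (f x) <= cnorm (g x).
  have cn := cvg_cnorm (cf x).
  rewrite -(cvg_lim _ cn)//; apply: limr_le; first exact: cvgP cn.
  by apply: nearW => n; exact: fg.
pose F n x := (cnorm (f_ n x - f x) * w x) `^ p.
have L : \int[mu]_x F n x @[n --> \oo] --> \int[mu]_x (0 : R).
  apply: (Rintegral_dct _ _ gi).
  - move=> n; apply: (measurableT_comp (measurable_powR _)); apply: mfw.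
    by apply: cmeasurableB; [exact: mf_|exact: mf].
  - move=> x; have u0 n : 0 <= cnorm (f_ n x - f x) * w x.
      by rewrite mulr_ge0 ?cnorm_ge0 ?(ltW (w0 x)).
    have cu : cnorm (f_ n x - f x) * w x @[n --> \oo] --> 0 * w x.
      by apply: cvgM; [exact: cf|exact: cvg_cst].
    rewrite mul0r in cu; move/cvgrPdist_le : cu => cu.
    apply/cvgrPdist_le => d1 d10.
    have : 0 < Num.min 1 d1 by rewrite lt_min ltr01.
    move=> /cu; apply: filterS => n; rewrite !sub0r !normrN.
    rewrite ger0_norm// ger0_norm ?powR_ge0// le_min => /andP[un1 und].
    have [z|nz] := eqVneq (cnorm (f_ n x - f x) * w x) 0.
      by rewrite /F z powR0 ?gt_eqF// ltW.
    by apply: le_trans und; apply: powR_le_self => //; rewrite lt0r nz u0.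
  - move=> n x; rewrite ger0_norm ?powR_ge0//.
    apply: ge0_ler_powR; rewrite ?nnegrE ?(ltW p0) ?mulr_ge0 ?cnorm_ge0 ?(ltW (w0 x))//.
    rewrite mulrA ler_wpM2r ?(ltW (w0 x))//.
    have := cnormD (f_ n x) (- f x); rewrite cnormN.
    by have := fg n x; have := fg' x; lra.
rewrite Rintegral_cst// mul0r in L.
have ep : 0 < e `^ p by rewrite powR_gt0.
have /cvgrPdist_lt/(_ _ ep)[n _ /(_ n (leqnn n))] := L.
rewrite sub0r normrN => Fn; exists n.
have Fi : mu.-integrable setT (fun x => (F n x)%:E).
  apply: (le_integrable measurableT _ _ gi).
    apply/measurable_EFinP; apply: (measurableT_comp (measurable_powR _)).
    by apply: mfw; apply: cmeasurableB; [exact: mf_|exact: mf].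
  move=> x _; rewrite /= lee_fin !ger0_norm ?powR_ge0//.
  apply: ge0_ler_powR; rewrite ?nnegrE ?(ltW p0) ?mulr_ge0 ?cnorm_ge0 ?(ltW (w0 x))//.
  rewrite mulrA ler_wpM2r ?(ltW (w0 x))//.
  have := cnormD (f_ n x) (- f x); rewrite cnormN.
  by have := fg n x; have := fg' x; lra.
have E : (\int[mu]_x (`|(cnorm (f_ n x - f x) * w x)%R%:E| `^ p))%E = (\int[mu]_x F n x)%:E.
  rewrite /Rintegral fineK; last exact: integrable_fin_num.
  apply: eq_integral => x _ /=.
  by rewrite ger0_norm// mulr_ge0 ?cnorm_ge0 ?(ltW (w0 x)).
rewrite /wnorm unlock E poweR_EFin lte_fin.
have I0 : 0 <= \int[mu]_x F n x by apply: Rintegral_ge0 => x _; exact: powR_ge0.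
rewrite ger0_norm// in Fn.
rewrite -[ltRHS]powRr1 ?(ltW e0)// -(mulfV (lt0r_neq0 p0)) powRrM.
by rewrite gt0_ltr_powR// ?invr_gt0// nnegrE powR_ge0.
Qed.

(** The functions that can be approximated in norm form a monotone class, by
    wnorm_cvg0. *)
Lemma schwartz_dense f : cmeasurable f -> (wnorm p%:E w f < +oo)%E ->
  forall e : R, 0 < e -> exists2 phi, is_schwartz phi &
    (wnorm p%:E w (fun x => phi x - f x)%R < e%:E)%E.
Proof.
pose V f := cmeasurable f /\ forall e : R, 0 < e -> exists2 phi, is_schwartz phi &
    (wnorm p%:E w (fun x => phi x - f x)%R < e%:E)%E.
pose Dom g := cmeasurable g /\ (wnorm p%:E w g < +oo)%E.
have h : forall f, cmeasurable f -> Dom f -> V f.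
  apply: monotone_class.
  - move=> a f1 f2 [m1 h1] [m2 h2]; split.
      apply: cmeasurableD => //; apply: cmeasurableM => //; exact: cmeasurable_cst.
    move=> e e0; have ca := cnorm_ge0 a.
    have [phi1 s1 n1] := h1 (e / (2 * (cnorm a + 1))) (divr_gt0 e0 (mulr_gt0 (ltr0n R 2) (ltr_wpDl ca ltr01))).
    have [phi2 s2 n2] := h2 (e / 2) (divr_gt0 e0 (ltr0n R 2)).
    exists (fun x => a * phi1 x + phi2 x); first exact: is_schwartz_linear.
    have E : (fun x => a * phi1 x + phi2 x - (a * f1 x + f2 x)) =
        (fun x => a * (phi1 x - f1 x) + (phi2 x - f2 x)).
      by apply/funext => x; ring.
    have mm1 : cmeasurable (fun x => phi1 x - f1 x).
      by apply: cmeasurableB => //; exact: schwartz_measurable.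
    have mm2 : cmeasurable (fun x => phi2 x - f2 x).
      by apply: cmeasurableB => //; exact: schwartz_measurable.
    rewrite E; apply: le_lt_trans (wnormD_le p1' w0 mw _ mm2) _.
      by apply: cmeasurableM => //; exact: cmeasurable_cst.
    have -> : e%:E = ((e / 2)%:E + (e / 2)%:E)%E by rewrite -EFinD -splitr.
    apply: lteD => //.
    apply: le_lt_trans (wnormZ_le p1' w0 mw a mm1) _.
    apply: (@le_lt_trans _ _ ((cnorm a)%:E * (e / (2 * (cnorm a + 1)))%:E)%E).
      by apply: lee_wpmul2l; [rewrite lee_fin|exact: ltW].
    rewrite -EFinM lte_fin.
    have a1 : 0 < cnorm a + 1 by rewrite ltr_wpDl.
    have -> : cnorm a * (e / (2 * (cnorm a + 1))) = (e / 2) * (cnorm a / (cnorm a + 1)).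
      by field; rewrite gt_eqF.
    by rewrite gtr_pMr ?divr_gt0// ltr_pdivrMr// mul1r ltrDl.
  - move=> f1 sf; split; first exact: schwartz_measurable.
    move=> e e0; exists f1 => //.
    under eq_fun do rewrite subrr.
    have := @wnormZ_le _ _ _ _ p1' w0 mw 0 _ (schwartz_measurable sf).
    under eq_fun do rewrite mul0r.
    by rewrite cnorm0 mul0e => /le_lt_trans; apply; rewrite lte_fin.
  - move=> f_ f1 g Vf cf fg [mg gp].
    have mf_ n : cmeasurable (f_ n) by case: (Vf n).
    have mf1 : cmeasurable f1 by exact: cmeasurable_lim cf.
    split => // e e0; have e2 : 0 < e / 2 by rewrite divr_gt0.
    have [n nn] := wnorm_cvg0 mf_ mf1 mg cf fg gp e2.
    have [_ /(_ _ e2)[phi sphi np]] := Vf n.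
    exists phi => //.
    have E : (fun x => phi x - f1 x) = (fun x => (phi x - f_ n x) + (f_ n x - f1 x)).
      by apply/funext => x; ring.
    rewrite E; apply: le_lt_trans (wnormD_le p1' w0 mw _ _) _.
    + by apply: cmeasurableB; [exact: schwartz_measurable|exact: mf_].
    + by apply: cmeasurableB; [exact: mf_|exact: mf1].
    have -> : e%:E = ((e / 2)%:E + (e / 2)%:E)%E by rewrite -EFinD -splitr.
    exact: lteD.
  - move=> f1 sf; split; first exact: schwartz_measurable.
    exact: (schwartz_wnorm_lty p1' w0 mw w_poly).
by move=> mf fp; have [] := h f mf (conj mf fp).
Qed.

End density.

(** * Moderate weights and the inequality of Hoelder *)

Section weights.
Context {R : realType} {d : nat}.
Implicit Types (w : 'rV[R]_d -> R) (x y : 'rV[R]_d).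

(** By induction on a list of monomials. *)
Lemma meval_le (v : mpoly.mpoly d R) : exists k (C : R), 0 <= C /\
  forall y, `|mpoly.meval (fun i => y 0 i) v| <= C * (1 + `|y|) ^+ k.
Proof.
suff h T (s : seq T) (c : T -> R) (e : T -> 'I_d -> nat) :
    exists k (C : R), 0 <= C /\ forall y,
      `|\sum_(m <- s) c m * \prod_i y 0 i ^+ e m i| <= C * (1 + `|y|) ^+ k.
  have [k [C [C0 hC]]] := h _ (mpoly.msupp v) (fun m => mpoly.mcoeff m v)
    (@mpoly.fun_of_multinom d).
  by exists k, C; split=> // y; rewrite mpoly.mevalE.
elim: s => [|m s [k [C [C0 hC]]]].
  by exists 0%N, 0; split=> // y; rewrite big_nil normr0 mul0r.
pose n := (\sum_i e m i)%N; exists (maxn n k), (`|c m| + C).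
split=> [|y]; first by rewrite addr_ge0.
have y1 : 1 <= 1 + `|y| by rewrite lerDl.
have y0 : 0 <= 1 + `|y| by rewrite (le_trans ler01).
rewrite big_cons mulrDl; apply: le_trans (ler_normD _ _) (lerD _ _).
  rewrite normrM ler_wpM2l//.
  apply: (@le_trans _ _ ((1 + `|y|) ^+ n)); last by rewrite ler_weXn2l// leq_maxl.
  rewrite normr_prod -prodrXr; apply: ler_prod => i _; rewrite normr_ge0 normrX/=.
  by rewrite lerXn2r ?nnegrE// (le_trans (normrV_coord y i))// lerDr.
by apply: le_trans (hC y) _; rewrite ler_wpM2l// ler_weXn2l// leq_maxr.
Qed.

Lemma moderate_le w : moderate_weight w -> exists k (C : R),
  forall x, w x <= C * (1 + `|x|) ^+ k.
Proof.
move=> [w0 mw _ [v [C wC]]]; have [k [B [B0 vB]]] := meval_le v.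
have C0 : 0 <= `|C| * w 0 by rewrite mulr_ge0// ltW.
exists k, (`|C| * w 0 * B) => x.
have := wC 0 x; rewrite add0r => /le_trans; apply.
apply: (@le_trans _ _ (`|C| * w 0 * `|mpoly.meval (fun i => x 0 i) v|)).
  by rewrite (le_trans (ler_norm _))// !normrM (gtr0_norm (w0 0)).
by rewrite -[leRHS]mulrA ler_wpM2l.
Qed.

(** Apply the moderation inequality with y = - x: it bounds w(0) by w(x)
    times a polynomial. *)
Lemma moderate_ge w : moderate_weight w -> exists k (C : R), 0 <= C /\
  forall x, 1 <= C * w x * (1 + `|x|) ^+ k.
Proof.
move=> [w0 mw _ [v [C wC]]]; have [k [B [B0 vB]]] := meval_le v.
have C0 x : 0 <= `|C| * w x by rewrite mulr_ge0// ltW.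
exists k, (`|C| * B / w 0); split.
  by rewrite divr_ge0 ?mulr_ge0// ltW.
move=> x.
have -> : `|C| * B / w 0 * w x * (1 + `|x|) ^+ k = (`|C| * w x * (B * (1 + `|x|) ^+ k)) / w 0.
  by ring.
rewrite ler_pdivlMr// mul1r.
have := wC x (- x); rewrite subrr => /le_trans; apply.
apply: (@le_trans _ _ (`|C| * w x * `|mpoly.meval (fun i => (- x) 0 i) v|)).
  by rewrite (le_trans (ler_norm _))// !normrM (gtr0_norm (w0 x)).
by rewrite ler_wpM2l//; have := vB (- x); rewrite normrN.
Qed.

End weights.

Section hoelder_product.
Context {R : realType} {d : nat}.
Local Notation mu := (@lebesgue_rV R d).
Local Open Scope ereal_scope.
Implicit Types (f g : 'rV[R]_d -> R).

(** Rescaling exponents, to bring the general inequality of Hoelder to the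
    case of conjugate exponents. *)
Lemma Lnorm_poweR (p r : R) f : (0 < r)%R -> (0 < p)%R -> measurable_fun setT f ->
  'N[mu]_(p / r)%:E[EFin \o (fun x => `|f x| `^ r)%R] = 'N[mu]_p%:E[EFin \o f] `^ r.
Proof.
move=> r0 p0 mf; have E x : `|(EFin \o (fun x => `|f x| `^ r)%R) x| `^ (p / r) = `|(EFin \o f) x| `^ p.
  rewrite /=; congr EFin.
  by rewrite ger0_norm ?powR_ge0// -powRrM mulrCA mulfV ?gt_eqF// mulr1.
rewrite unlock invf_div; under eq_integral do rewrite E.
by rewrite -poweRrM [(p^-1 * r)%R]mulrC.
Qed.

Lemma Lnorm_bounded_mul (p : \bar R) f g : 1 <= p ->
  measurable_fun setT f -> measurable_fun setT g ->
  'N[mu]_+oo[EFin \o f] < +oo ->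
  'N[mu]_p[EFin \o (f \* g)%R] <= 'N[mu]_+oo[EFin \o f] * 'N[mu]_p[EFin \o g].
Proof.
move=> p1 mf mg foo.
have B0 : 0 <= 'N[mu]_+oo[EFin \o f] by exact: Lnorm_ge0.
set B := 'N[mu]_+oo[EFin \o f] in foo B0 *.
have BE : B = (fine B)%:E by rewrite fineK// ge0_fin_numE.
rewrite BE -LnormZ_ge0//; last exact: fine_ge0.
apply: le_Lnorm => //; [exact: measurable_funM|exact: measurable_funM|].
have := @ess_sup_ge _ _ _ mu (abse \o (EFin \o f)).
have -> : ess_sup mu (abse \o (EFin \o f)) = (fine B)%:E.
  by rewrite -BE /B unlock lebesgue_rV_gt0.
apply: filterS => x /=; rewrite lee_fin => h.
by rewrite !normrM (ger0_norm (fine_ge0 B0)) ler_wpM2r.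
Qed.

(** If one exponent is infinite, the other one equals q. Otherwise q is
    finite and the case of conjugate exponents q1 / q, q2 / q applies to
    |f|^q and |g|^q. *)
Lemma Lnorm_mul (q q1 q2 : \bar R) f g : 1 <= q -> 1 <= q1 -> 1 <= q2 ->
  q1^-1 + q2^-1 = q^-1 ->
  measurable_fun setT f -> measurable_fun setT g ->
  'N[mu]_q1[EFin \o f] < +oo -> 'N[mu]_q2[EFin \o g] < +oo ->
  'N[mu]_q[EFin \o (f \* g)%R] <= 'N[mu]_q1[EFin \o f] * 'N[mu]_q2[EFin \o g].
Proof.
case: q1 => [r1| |]; [|move=> q1'' _ q2'' E mf mg foo goo|by []]; last first.
  rewrite invey add0e in E.
  have <- : q2 = q by rewrite -[q2]inveK E inveK.
  exact: Lnorm_bounded_mul.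
case: q2 => [r2| |]; [|move=> _ p1' _ E mf mg foo goo|by []]; last first.
  rewrite invey adde0 in E.
  have <- : r1%:E = q by rewrite -[r1%:E]inveK E inveK.
  rewrite muleC (_ : (f \* g)%R = (g \* f)%R); last by apply/funext => x /=; rewrite mulrC.
  exact: Lnorm_bounded_mul.
rewrite !lee_fin => q1 p1 p2 E mf mg foo goo.
have p10 : (0 < r1)%R by exact: lt_le_trans p1.
have p20 : (0 < r2)%R by exact: lt_le_trans p2.
rewrite !inver !gt_eqF// -EFinD in E.
case: q q1 E => [r| |//]; last first.
  move=> _; rewrite invey => -[] /eqP; rewrite gt_eqF// addr_gt0 ?invr_gt0//.
rewrite lee_fin => r1'; have r0 : (0 < r)%R by exact: lt_le_trans r1'.
rewrite inver gt_eqF// => -[E].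
have mp (h : 'rV[R]_d -> R) : measurable_fun setT h -> measurable_fun setT (fun x => `|h x| `^ r)%R.
  move=> mh; apply: (measurableT_comp (measurable_powR _)).
  exact: measurableT_comp.
have rE : ((r1 / r)^-1 + (r2 / r)^-1 = 1)%R.
  by rewrite !invf_div -mulrDr E mulfV ?gt_eqF.
have := hoelder mu (mp _ mf) (mp _ mg) (divr_gt0 p10 r0) (divr_gt0 p20 r0) rE.
rewrite !Lnorm_poweR// -poweRM ?Lnorm_ge0//.
have -> : ((fun x => `|f x| `^ r) \* (fun x => `|g x| `^ r))%R = (fun x => `|(f \* g)%R x| `^ r)%R.
  by apply/funext => x /=; rewrite normrM powRM.
have := Lnorm_poweR r0 r0 (measurable_funM mf mg).
rewrite divff ?gt_eqF// => ->.
move=> /(gt0_ler_poweR (r := r^-1)%R); rewrite -!poweRrM mulfV ?gt_eqF// !poweRe1 ?mule_ge0 ?Lnorm_ge0//.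
apply; rewrite ?in_itv/= ?leey ?andbT ?poweR_ge0//.
by rewrite invr_ge0 ltW.
Qed.

Lemma wnorm_mul (q q1 q2 : \bar R) (w w1 w2 : 'rV[R]_d -> R) (C : R)
    (g1 g2 : 'rV[R]_d -> R[i]) :
  1 <= q -> 1 <= q1 -> 1 <= q2 -> q1^-1 + q2^-1 = q^-1 ->
  (forall x, 0 < w x)%R -> (forall x, 0 < w1 x)%R -> (forall x, 0 < w2 x)%R ->
  measurable_fun setT w -> measurable_fun setT w1 -> measurable_fun setT w2 ->
  (0 <= C)%R -> (forall x, w x <= C * (w1 x * w2 x))%R ->
  cmeasurable g1 -> cmeasurable g2 ->
  wnorm q1 w1 g1 < +oo -> wnorm q2 w2 g2 < +oo ->
  wnorm q w (fun x => g1 x * g2 x)%R <= C%:E * (wnorm q1 w1 g1 * wnorm q2 w2 g2).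
Proof.
move=> q_1 q1_1 q2_1 E w0 w10 w20 mw mw1 mw2 C0 wC mg1 mg2 g1oo g2oo.
have mfw (g : 'rV[R]_d -> R[i]) (v : 'rV[R]_d -> R) : cmeasurable g ->
    measurable_fun setT v -> measurable_fun setT (fun x => cnorm (g x) * v x)%R.
  by move=> mg mv; apply: measurable_funM => //; exact: measurable_cnorm.
have := Lnorm_mul q_1 q1_1 q2_1 E (mfw _ _ mg1 mw1) (mfw _ _ mg2 mw2) g1oo g2oo.
move=> /(lee_wpmul2l (x := C%:E)); rewrite lee_fin => /(_ C0); apply: le_trans.
rewrite -LnormZ_ge0//; last by apply: measurable_funM; exact: mfw.
apply: (le_Lnorm (f := fun x => cnorm (g1 x * g2 x) * w x)%R) => //.
- by apply: mfw => //; exact: cmeasurableM.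
- by apply: measurable_funM => //; apply: measurable_funM; exact: mfw.
- apply: nearW => x /=.
  rewrite ger0_norm ?mulr_ge0 ?cnorm_ge0 ?(ltW (w0 x))//.
  rewrite ger0_norm ?mulr_ge0 ?cnorm_ge0 ?(ltW (w10 x)) ?(ltW (w20 x))//.
  rewrite cnormM.
  have -> : (C * (cnorm (g1 x) * w1 x * (cnorm (g2 x) * w2 x)) = cnorm (g1 x) * cnorm (g2 x) * (C * (w1 x * w2 x)))%R by ring.
  by rewrite ler_wpM2l ?mulr_ge0 ?cnorm_ge0.
Qed.

End hoelder_product.

(** * Distributions whose Fourier transform is a function *)

Section functionals.
Context {R : realType} {d : nat}.
Local Notation mu := (@lebesgue_rV R d).
Implicit Types (phi psi : schwartz R d) (u v : functional R d).
Implicit Types (f g h : 'rV[R]_d -> R[i]) (x : 'rV[R]_d).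

Lemma schwartzP phi : is_schwartz phi.
Proof. by case: phi => f fS; apply/asboolP; move: fS; rewrite inE. Qed.

Lemma to_schwartzE f : is_schwartz f -> (to_schwartz f : _ -> R[i]) = f.
Proof.
move=> sf; have fS : (f : _ -> R[i]^o) \in @schwartz_pred R d by rewrite inE.
exact: (insubdK (0 : schwartz R d) fS).
Qed.

Lemma schwartz_eq phi psi : (phi : _ -> R[i]) = psi -> phi = psi.
Proof. by move=> E; apply: val_inj. Qed.

Lemma schwartz_normE N phi : exists M : R, schwartz_norm N phi = M%:E /\
  forall (s : seq 'I_d) x, (size s <= N)%N ->
    (1 + `|x|) ^+ N * cnorm (cpderivs s phi x) <= M.
Proof.
have [_ _ /(_ N) Noo] := schwartzP phi.
have le_norm s x : (size s <= N)%N -> (((1 + `|x|) ^+ N * cnorm (cpderivs s phi x))%:E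
    <= schwartz_norm N phi)%E.
  by move=> sN; apply: ereal_sup_ubound; exists s => //; exists x.
have E : schwartz_norm N phi = (fine (schwartz_norm N phi))%:E.
  rewrite fineK// fin_numElt Noo andbT.
  by apply: lt_le_trans (le_norm [::] 0 _); first exact: ltNyr.
by exists (fine (schwartz_norm N phi)); split=> // s x sN; rewrite -lee_fin -E le_norm.
Qed.

Lemma is_density_ae u g h : is_density u g -> is_density u h ->
  {ae mu, forall x, g x = h x}.
Proof.
move=> [mg gi ->] [mh hi E].
have : {ae mu, forall x, g x - h x = 0}.
  apply: schwartz_separating; first exact: cmeasurableB.
    move=> phi sphi; under eq_fun do rewrite mulrBl -[in X in X - _](to_schwartzE sphi) -[in X in _ - X](to_schwartzE sphi) addrC -mulN1r.
    exact: cintegrable_linear.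
  move=> phi sphi.
  under eq_cintegral do rewrite mulrBl -[in X in X - _](to_schwartzE sphi) -[in X in _ - X](to_schwartzE sphi) addrC -mulN1r.
  rewrite cintegral_linear// mulN1r addrC; apply/eqP; rewrite subr_eq0; apply/eqP.
  by rewrite -[LHS]/(regular g _) E.
by apply: filterS => x /eqP; rewrite subr_eq0 => /eqP.
Qed.

Lemma is_density_sub u v g h : is_density u g -> is_density v h ->
  is_density (u - v) (fun x => g x - h x).
Proof.
move=> [mg gi ->] [mh hi ->].
have E phi x : (g x - h x) * phi x = -1 * (h x * phi x) + g x * phi x by ring.
split; first exact: cmeasurableB.
  by move=> phi; under eq_fun do rewrite E; exact: cintegrable_linear.
apply/funext => phi; rewrite [LHS]/= /regular; under [RHS]eq_cintegral do rewrite E.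
by rewrite cintegral_linear// mulN1r addrC.
Qed.

(** Fourier inversion on the test function: a distribution is determined by
    its Fourier transform. *)
Lemma fourier_distE u phi :
  u phi = fourier_dist u (to_schwartz (ifourier phi)).
Proof.
rewrite /fourier_dist; congr (u _); apply: schwartz_eq.
have sphi := schwartzP phi; have si := schwartz_ifourier sphi.
have E := etrans (congr1 fourier (to_schwartzE si)) (ifourierK sphi).
exact: esym (etrans (congr1 (fun f => schwartz_fun (to_schwartz f)) E) (to_schwartzE sphi)).
Qed.

(** This is how all equalities between distributions below are obtained. *)
Lemma density_inj u v g h : is_density (fourier_dist u) g ->
  is_density (fourier_dist v) h -> {ae mu, forall x, g x = h x} -> u = v.
Proof.
move=> [mg gi Eu] [mh hi Ev] gh; apply/funext => phi.
rewrite fourier_distE [RHS]fourier_distE Eu Ev; apply: ae_eq_cintegral.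
- by apply: cmeasurableM => //; apply: schwartz_measurable; exact: schwartzP.
- by apply: cmeasurableM => //; apply: schwartz_measurable; exact: schwartzP.
- by apply: filterS gh => x ->.
Qed.

Lemma regular_density f : is_schwartz f -> is_density (fourier_dist (regular f)) (fourier f).
Proof.
move=> sf; have sF := schwartz_fourier sf.
split; first exact: schwartz_measurable.
  move=> phi; apply: schwartz_cintegrable; apply: schwartzM => //; exact: schwartzP.
apply/funext => phi; rewrite /fourier_dist /regular.
rewrite to_schwartzE; last by apply: schwartz_fourier; exact: schwartzP.
by rewrite fourier_dual//; apply: schwartz_cintegrable => //; exact: schwartzP.
Qed.

(** With F the Fourier transform, the test function on the left is the
    transform of a function that is computed by the convolution theorem as
    (2 pi)^(d/2) F f times the given test function. *)
Lemma conv_dist_density f u g : is_schwartz f -> is_density (fourier_dist u) g ->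
  is_density (fourier_dist (conv_dist (to_schwartz f) u))
    (fun x => ((@fconst R d)^-1)%:C%C * (fourier f x * g x)).
Proof.
move=> sf [mg gi Eu]; have sF := schwartz_fourier sf.
split.
- apply: cmeasurableM; first exact: cmeasurable_cst.
  by apply: cmeasurableM => //; exact: schwartz_measurable.
- move=> phi.
  have sp : is_schwartz (fun x => fourier f x * phi x) by apply: schwartzM => //; exact: schwartzP.
  have E x : ((@fconst R d)^-1)%:C%C * (fourier f x * g x) * phi x =
      ((@fconst R d)^-1)%:C%C * (g x * (to_schwartz (fun x => fourier f x * phi x)) x).
    by rewrite to_schwartzE//; ring.
  by under eq_fun do rewrite E; apply: cintegrableZ; exact: gi.
- apply/funext => phi; have sphi := schwartzP phi.
  have sFphi := schwartz_fourier sphi; have sfo := schwartz_opp sf.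
  have sc := schwartz_convolution sfo sFphi.
  have si := schwartz_ifourier sc.
  rewrite {1}/fourier_dist /conv_dist fourier_distE Eu /regular !to_schwartzE//.
  apply: eq_cintegral => x.
  rewrite /ifourier fourier_conv// fourier_opp ?opprK; last exact: schwartz_cintegrable.
  by rewrite -[fourier (fourier phi) (- x)]/(ifourier (fourier phi) x) fourierK//; ring.
Qed.

End functionals.

Section FL_theory.
Context {R : realType} {d : nat}.
Local Notation mu := (@lebesgue_rV R d).
Implicit Types (phi psi : schwartz R d) (u v : functional R d).
Implicit Types (f g h : 'rV[R]_d -> R[i]) (x : 'rV[R]_d).
Variables (q : \bar R) (w : 'rV[R]_d -> R).
Hypotheses (q1 : (1 <= q)%E) (wm : moderate_weight w).

Let w0 x : 0 < w x. Proof. by case: wm. Qed.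
Let mw : measurable_fun setT w. Proof. by case: wm. Qed.

(** The integrand is g w decay, which is integrable, times a factor bounded
    by a seminorm of f: 1 / w is bounded by a power of 1 + |x|, and so is 1
    / decay. *)
Lemma wnorm_pairing g : cmeasurable g -> (wnorm q w g < +oo)%E ->
  exists N (C : R), 0 <= C /\ forall f (M : R), cmeasurable f ->
    (forall x, (1 + `|x|) ^+ N * cnorm (f x) <= M) ->
    cintegrable (fun x => g x * f x) /\
    cnorm (cintegral (fun x => g x * f x)) <= C * M.
Proof.
move=> mg goo; have gi := wnorm_integrable q1 w0 mw mg goo.
have [k [B [B0 wB]]] := moderate_ge wm.
pose b x := cnorm (g x) * w x * decay x.
have b0 x : 0 <= b x by rewrite !mulr_ge0 ?cnorm_ge0 ?(ltW (w0 x)) ?(ltW (decay_gt0 x)).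
exists (k + 2 * d)%N, (2 * (B * \int[mu]_x b x)); split.
  by rewrite !mulr_ge0//; apply: Rintegral_ge0 => x _; exact: b0.
move=> f M mf fM.
have gf x : cnorm (g x * f x) <= (B * M) * b x.
  have x0 : 0 <= 1 + `|x| by rewrite addr_ge0.
  rewrite cnormM.
  have D0 := ltW (decay_gt0 x); have W0 := ltW (w0 x); have g0 := cnorm_ge0 (g x); have f0 := cnorm_ge0 (f x).
  apply: (@le_trans _ _ (cnorm (g x) * cnorm (f x) * (B * w x * (1 + `|x|) ^+ k) * ((1 + `|x|) ^+ (2 * d) * decay x))).
    rewrite -[leLHS]mulr1 -[leLHS]mulr1; apply: ler_pM; rewrite ?mulr_ge0 ?ler01 ?exprn_ge0//.
      by rewrite ler_wpM2l// mulr_ge0.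
    exact: decay_ge.
  have -> : cnorm (g x) * cnorm (f x) * (B * w x * (1 + `|x|) ^+ k) * ((1 + `|x|) ^+ (2 * d) * decay x) =
     B * (cnorm (g x) * w x * decay x) * ((1 + `|x|) ^+ (k + 2 * d) * cnorm (f x)).
    by rewrite exprD; ring.
  by rewrite [leRHS]mulrAC ler_wpM2l// mulr_ge0// b0.
have bi : mu.-integrable setT (EFin \o (fun x => (B * M) * b x)).
  exact: (integrableZl measurableT (B * M) gi).
have ci : cintegrable (fun x => g x * f x).
  by apply: cintegrable_le bi gf; exact: cmeasurableM.
split=> //; apply: le_trans (cnorm_cintegral_le ci bi gf) _.
by rewrite RintegralZl// le_eqVlt; apply/orP; left; apply/eqP; ring.
Qed.

Lemma wnorm_schwartz_integrable g f : cmeasurable g -> (wnorm q w g < +oo)%E ->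
  is_schwartz f -> cintegrable (fun x => g x * f x).
Proof.
move=> mg goo sf; have [N [C [_ h]]] := wnorm_pairing mg goo.
have [M fM] := schwartz_rapid sf N.
by have [] := h f M (schwartz_measurable sf) fM.
Qed.

(** The distribution with Fourier transform g. *)
Definition inv_fourier_dist g : functional R d :=
  fun phi => cintegral (fun x => g x * ifourier phi x).

Lemma inv_fourier_dist_density g : cmeasurable g -> (wnorm q w g < +oo)%E ->
  is_density (fourier_dist (inv_fourier_dist g)) g.
Proof.
move=> mg goo; split => //.
  by move=> phi; apply: wnorm_schwartz_integrable => //; exact: schwartzP.
apply/funext => phi; rewrite /fourier_dist /inv_fourier_dist.
have sphi := schwartzP phi.
by rewrite to_schwartzE ?fourierK//; exact: schwartz_fourier.
Qed.

Lemma inv_fourier_dist_tempered g : cmeasurable g -> (wnorm q w g < +oo)%E ->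
  tempered (inv_fourier_dist g).
Proof.
move=> mg goo; split.
  move=> a phi psi; rewrite /inv_fourier_dist.
  have si chi : is_schwartz (ifourier (chi : schwartz R d)).
    by apply: schwartz_ifourier; exact: schwartzP.
  have E x : g x * ifourier (a *: phi + psi) x = a * (g x * ifourier phi x) + g x * ifourier psi x.
    rewrite {1}/ifourier [X in fourier X](_ : _ = (fun x => a * phi x + psi x))//.
    rewrite fourier_linear; try by apply: schwartz_cintegrable; exact: schwartzP.
    by rewrite /ifourier; ring.
  under eq_cintegral do rewrite E.
  by apply: cintegral_linear; exact: wnorm_schwartz_integrable.
have [N [C [C0 h]]] := wnorm_pairing mg goo.
have [C' h'] := @fourier_decay R d N.
exists (N + 2 * d)%N, (C * C') => phi.
have [M [-> hM]] := schwartz_normE (N + 2 * d) phi.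
rewrite -EFinM lee_fin -mulrA.
have si : is_schwartz (ifourier phi) by apply: schwartz_ifourier; exact: schwartzP.
have [|//] := h (ifourier phi) (C' * M) (schwartz_measurable si) _.
move=> x; have := h' phi M (schwartzP phi) hM (- x).
by rewrite normrN.
Qed.

(** The infimum in the definition of FLnorm ranges over a single value. *)
Lemma FLnormE u g : is_density (fourier_dist u) g -> FLnorm q w u = wnorm q w g.
Proof.
move=> ug; rewrite /FLnorm -[RHS]ereal_inf1; congr ereal_inf.
apply/seteqP; split=> [_ [h uh <-]|_ ->] /=; last by exists g.
have mh : cmeasurable h by case: uh.
have mg : cmeasurable g by case: ug.
by apply: (ae_eq_wnorm q1 mw mh mg); exact: is_density_ae uh ug.
Qed.

Lemma FL_density u : FL q w u -> exists g,
  [/\ is_density (fourier_dist u) g, cmeasurable g & (wnorm q w g < +oo)%E].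
Proof.
move=> [_ /ereal_inf_lt[_ [g ug <-] goo]]; exists g; split => //.
by case: ug.
Qed.

Lemma density_FL u g : tempered u -> is_density (fourier_dist u) g ->
  (wnorm q w g < +oo)%E -> FL q w u.
Proof. by move=> ut ug goo; split=> //=; rewrite (FLnormE ug). Qed.

Lemma FL_inv_fourier_dist g : cmeasurable g -> (wnorm q w g < +oo)%E ->
  FL q w (inv_fourier_dist g).
Proof.
move=> mg goo; exact: (density_FL (inv_fourier_dist_tempered mg goo) (inv_fourier_dist_density mg goo) goo).
Qed.

Lemma FL_regular f : is_schwartz f -> FL q w (regular f).
Proof.
move=> sf; have sF := schwartz_fourier sf.
have [k [C wC]] := moderate_le wm.
have foo g : is_schwartz g -> (wnorm q w g < +oo)%E.
  by apply: schwartz_wnorm_lty => //; exists k, C.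
have mF := schwartz_measurable sF.
rewrite (_ : regular f = inv_fourier_dist (fourier f)).
  by apply: FL_inv_fourier_dist => //; exact: foo.
apply: density_inj (regular_density sf) (inv_fourier_dist_density mF (foo _ sF)) _.
exact: nearW.
Qed.

Lemma FLnorm_self u : FL q w u -> FLnorm q w (u - u) = 0%E.
Proof.
move=> /FL_density[g [ug mg goo]].
rewrite (FLnormE (is_density_sub ug ug)); apply/eqP; rewrite eq_le wnorm_ge0 andbT.
have := wnormZ_le q1 w0 mw 0 mg; rewrite cnorm0 mul0e; congr (wnorm q w _ <= _)%E.
by apply/funext => x; rewrite subrr mul0r.
Qed.

Lemma FLnorm_dist_le u v t : FL q w u -> FL q w v -> FL q w t ->
  (FLnorm q w (u - v)%R <= FLnorm q w (t - u)%R + FLnorm q w (t - v)%R)%E.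
Proof.
move=> /FL_density[a [ua ma _]] /FL_density[b [vb mb _]] /FL_density[c [tc mc _]].
rewrite (FLnormE (is_density_sub ua vb)) (FLnormE (is_density_sub tc ua)).
rewrite (FLnormE (is_density_sub tc vb)) -(wnormN q w (fun x => c x - a x)).
rewrite [leLHS](_ : _ = wnorm q w (fun x => - (c x - a x) + (c x - b x))).
  by apply: wnormD_le => //; [apply: cmeasurableN; exact: cmeasurableB|exact: cmeasurableB].
by congr wnorm; apply/funext => x; ring.
Qed.

Lemma FLnorm_eq0 u v : FL q w u -> FL q w v -> FLnorm q w (u - v) = 0%E -> u = v.
Proof.
move=> /FL_density[a [ua ma _]] /FL_density[b [vb mb _]].
rewrite (FLnormE (is_density_sub ua vb)) => /(wnorm_eq0 q1 w0 mw (cmeasurableB ma mb)) h.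
by apply: density_inj ua vb _; apply: filterS h => x /eqP; rewrite subr_eq0 => /eqP.
Qed.

(** Approximate the density of u by a Schwartz function in the weighted L^q
    norm and take its inverse Fourier transform. *)
Lemma FL_schwartz_dense u : (q < +oo)%E -> FL q w u -> forall e : R, 0 < e ->
  exists f : schwartz R d, (FLnorm q w (regular f - u)%R < e%:E)%E.
Proof.
move=> qoo /FL_density[g [ug mg goo]] e e0.
have [psi spsi psie] : exists2 psi, is_schwartz psi &
    (wnorm q w (fun x => psi x - g x)%R < e%:E)%E.
  case: q q1 qoo goo => [p| |]//; rewrite lee_fin => p1 _ goo.
  have [k [C wC]] := moderate_le wm.
  by apply: schwartz_dense => //; exists k, C.
have si := schwartz_ifourier spsi.
exists (to_schwartz (ifourier psi)); rewrite to_schwartzE//.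
have := regular_density si; rewrite ifourierK// => rd.
by rewrite (FLnormE (is_density_sub rd ug)).
Qed.

End FL_theory.

(** * The convolution map *)

Section convolution.
Context {R : realType} {d : nat}.
Local Notation mu := (@lebesgue_rV R d).
Implicit Types (u v : functional R d) (f g h : 'rV[R]_d -> R[i]) (x : 'rV[R]_d).
Variables (q q1 q2 : \bar R) (w w1 w2 : 'rV[R]_d -> R).
Hypotheses (q_ge1 : (1 <= q)%E) (q1_ge1 : (1 <= q1)%E) (q2_ge1 : (1 <= q2)%E).
Hypotheses (w_moderate : moderate_weight w)
  (w1_moderate : moderate_weight w1) (w2_moderate : moderate_weight w2).
Hypothesis q1q2 : (q1^-1 + q2^-1 = q^-1)%E.
Hypothesis w1w2 : exists2 C : R, 0 < C & forall xi, w xi <= C * (w1 xi * w2 xi).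

(** Any choice will do, as conv_FLP shows. *)
Definition fourier_density u : 'rV[R]_d -> R[i] :=
  xget (fun=> 0 : R[i]) (is_density (fourier_dist u)).

(** The density prescribed by the convolution theorem: fconst^-1 is (2
    pi)^(d/2). *)
Definition conv_prod g1 g2 x : R[i] := ((@fconst R d)^-1)%:C%C * (g1 x * g2 x).

Definition conv_FL u v : functional R d :=
  inv_fourier_dist (conv_prod (fourier_density u) (fourier_density v)).

Lemma cmeasurable_conv_prod g1 g2 : cmeasurable g1 -> cmeasurable g2 ->
  cmeasurable (conv_prod g1 g2).
Proof.
move=> m1 m2; apply: cmeasurableM; first exact: cmeasurable_cst.
exact: cmeasurableM.
Qed.

Lemma wnorm_conv_prod : exists2 K : R, 0 < K & forall g1 g2,
  cmeasurable g1 -> cmeasurable g2 ->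
  (wnorm q1 w1 g1 < +oo)%E -> (wnorm q2 w2 g2 < +oo)%E ->
  (wnorm q w (conv_prod g1 g2) <= K%:E * (wnorm q1 w1 g1 * wnorm q2 w2 g2))%E.
Proof.
have [C C0 wC] := w1w2.
have [w0 mw _ _] := w_moderate; have [w10 mw1 _ _] := w1_moderate.
have [w20 mw2 _ _] := w2_moderate.
have c0 : 0 < (@fconst R d)^-1 by rewrite invr_gt0 fconst_gt0.
exists ((@fconst R d)^-1 * C); first exact: mulr_gt0.
move=> g1 g2 m1 m2 o1 o2.
apply: le_trans (wnormZ_le q_ge1 w0 mw _ (cmeasurableM m1 m2)) _.
rewrite cnorm_real gtr0_norm// EFinM -muleA lee_wpmul2l ?lee_fin ?(ltW c0)//.
exact: (wnorm_mul q_ge1 q1_ge1 q2_ge1 q1q2 w0 w10 w20 mw mw1 mw2 (ltW C0) wC).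
Qed.

Lemma wnorm_conv_prod_lty g1 g2 :
  cmeasurable g1 -> cmeasurable g2 ->
  (wnorm q1 w1 g1 < +oo)%E -> (wnorm q2 w2 g2 < +oo)%E ->
  (wnorm q w (conv_prod g1 g2) < +oo)%E.
Proof.
move=> m1 m2 o1 o2; have [K K0 h] := wnorm_conv_prod.
apply: le_lt_trans (h _ _ m1 m2 o1 o2) _.
rewrite lte_mul_pinfty ?lee_fin ?(ltW K0)//.
by rewrite lte_mul_pinfty ?wnorm_ge0// ge0_fin_numE ?wnorm_ge0.
Qed.

Lemma conv_FLP u v : FL q1 w1 u -> FL q2 w2 v ->
  FL q w (conv_FL u v) /\ forall g1 g2, is_density (fourier_dist u) g1 ->
    is_density (fourier_dist v) g2 ->
    is_density (fourier_dist (conv_FL u v)) (conv_prod g1 g2).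
Proof.
move=> uF vF.
have [a [ua ma aoo]] := FL_density uF; have [b [vb mb boo]] := FL_density vF.
have ud : is_density (fourier_dist u) (fourier_density u) by apply: xgetPex; exists a.
have vd : is_density (fourier_dist v) (fourier_density v) by apply: xgetPex; exists b.
have mu' : cmeasurable (fourier_density u) by case: ud.
have mv' : cmeasurable (fourier_density v) by case: vd.
have [_ mw1 _ _] := w1_moderate; have [_ mw2 _ _] := w2_moderate.
have uoo : (wnorm q1 w1 (fourier_density u) < +oo)%E.
  by rewrite -(FLnormE q1_ge1 w1_moderate ud); case: uF.
have voo : (wnorm q2 w2 (fourier_density v) < +oo)%E.
  by rewrite -(FLnormE q2_ge1 w2_moderate vd); case: vF.
have poo := wnorm_conv_prod_lty mu' mv' uoo voo.
have mp := cmeasurable_conv_prod mu' mv'.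
split; first exact: (FL_inv_fourier_dist q_ge1 w_moderate mp poo).
move=> g1 g2 ug1 vg2.
have m1 : cmeasurable g1 by case: ug1.
have m2 : cmeasurable g2 by case: vg2.
have o1 : (wnorm q1 w1 g1 < +oo)%E.
  by rewrite -(FLnormE q1_ge1 w1_moderate ug1); case: uF.
have o2 : (wnorm q2 w2 g2 < +oo)%E.
  by rewrite -(FLnormE q2_ge1 w2_moderate vg2); case: vF.
have p2oo := wnorm_conv_prod_lty m1 m2 o1 o2.
have mp2 := cmeasurable_conv_prod m1 m2.
rewrite (_ : conv_FL u v = inv_fourier_dist (conv_prod g1 g2)).
  exact: (inv_fourier_dist_density q_ge1 w_moderate mp2 p2oo).
apply: density_inj (inv_fourier_dist_density q_ge1 w_moderate mp poo) (inv_fourier_dist_density q_ge1 w_moderate mp2 p2oo) _.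
have := is_density_ae ud ug1; have := is_density_ae vd vg2.
by apply: filterS2 => x; rewrite /conv_prod => -> ->.
Qed.

(** With densities a_i of f_i, b_i of g_i and c_i = b_i - a_i, the
    difference b1 b2 - a1 a2 is c1 b2 + a1 c2, and the norm of b2 is at most
    that of a2 plus 1 as soon as delta <= 1. *)
Lemma conv_FL_continuous : continuous_FL q1 q2 q w1 w2 w conv_FL.
Proof.
move=> f1 f2 F1 F2 e e0.
have [a1 [da1 ma1 oa1]] := FL_density F1; have [a2 [da2 ma2 oa2]] := FL_density F2.
have [K K0 hK] := wnorm_conv_prod.
have [w10 mw1 _ _] := w1_moderate; have [w20 mw2 _ _] := w2_moderate.
have [w0 mw _ _] := w_moderate.
have E1 : wnorm q1 w1 a1 = (fine (wnorm q1 w1 a1))%:E by rewrite fineK// ge0_fin_numE ?wnorm_ge0.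
have E2 : wnorm q2 w2 a2 = (fine (wnorm q2 w2 a2))%:E by rewrite fineK// ge0_fin_numE ?wnorm_ge0.
have A10 : 0 <= fine (wnorm q1 w1 a1) by rewrite fine_ge0// wnorm_ge0.
have A20 : 0 <= fine (wnorm q2 w2 a2) by rewrite fine_ge0// wnorm_ge0.
set A1 := fine _ in E1 A10; set A2 := fine _ in E2 A20.
have S0 : 0 < K * (A1 + A2 + 1) by rewrite mulr_gt0// ltr_wpDl ?addr_ge0.
exists (Num.min 1 (e / (K * (A1 + A2 + 1)))); first by rewrite lt_min ltr01 divr_gt0.
move=> g1 g2 G1 G2; set del := Num.min _ _.
have [b1 [db1 mb1 ob1]] := FL_density G1; have [b2 [db2 mb2 ob2]] := FL_density G2.
have mc1 := cmeasurableB mb1 ma1; have mc2 := cmeasurableB mb2 ma2.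
rewrite (FLnormE q1_ge1 w1_moderate (is_density_sub db1 da1)).
rewrite (FLnormE q2_ge1 w2_moderate (is_density_sub db2 da2)).
set c1 := (fun x => b1 x - a1 x) in mc1 *; set c2 := (fun x => b2 x - a2 x) in mc2 *.
move=> lt1 lt2.
have o1 : (wnorm q1 w1 c1 < +oo)%E by apply: lt_trans lt1 _; rewrite ltry.
have o2 : (wnorm q2 w2 c2 < +oo)%E by apply: lt_trans lt2 _; rewrite ltry.
have [_ dT] := conv_FLP G1 G2; have [_ dT'] := conv_FLP F1 F2.
rewrite (FLnormE q_ge1 w_moderate (is_density_sub (dT _ _ db1 db2) (dT' _ _ da1 da2))).
have -> : (fun x => conv_prod b1 b2 x - conv_prod a1 a2 x) =
    (fun x => conv_prod c1 b2 x + conv_prod a1 c2 x).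
  by apply/funext => x; rewrite /conv_prod /c1 /c2; ring.
apply: le_lt_trans (wnormD_le q_ge1 w0 mw (cmeasurable_conv_prod mc1 mb2) (cmeasurable_conv_prod ma1 mc2)) _.
apply: le_lt_trans (leeD (hK _ _ mc1 mb2 o1 ob2) (hK _ _ ma1 mc2 oa1 o2)) _.
have eb2 : (wnorm q2 w2 b2 <= wnorm q2 w2 c2 + wnorm q2 w2 a2)%E.
  have := wnormD_le q2_ge1 w20 mw2 mc2 ma2; congr (wnorm _ _ _ <= _)%E.
  by apply/funext => x; rewrite /c2 subrK.
have D1 : wnorm q1 w1 c1 = (fine (wnorm q1 w1 c1))%:E by rewrite fineK// ge0_fin_numE ?wnorm_ge0.
have D2 : wnorm q2 w2 c2 = (fine (wnorm q2 w2 c2))%:E by rewrite fineK// ge0_fin_numE ?wnorm_ge0.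
have B2 : wnorm q2 w2 b2 = (fine (wnorm q2 w2 b2))%:E by rewrite fineK// ge0_fin_numE ?wnorm_ge0.
have n1 : 0 <= fine (wnorm q1 w1 c1) by rewrite fine_ge0// wnorm_ge0.
have n2 : 0 <= fine (wnorm q2 w2 c2) by rewrite fine_ge0// wnorm_ge0.
have nb : 0 <= fine (wnorm q2 w2 b2) by rewrite fine_ge0// wnorm_ge0.
move: lt1 lt2 eb2; rewrite D1 D2 B2 E1 E2 -!EFinM -!EFinD !lte_fin !lee_fin.
set s := fine (wnorm q1 w1 c1) in n1 *; set t := fine (wnorm q2 w2 c2) in n2 *.
set b := fine (wnorm q2 w2 b2) in nb *.
rewrite /del !lt_min => /andP[s1 se] /andP[t1 te] bt.
rewrite ltr_pdivlMr// in se; rewrite ltr_pdivlMr// in te.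
rewrite -mulrDr.
have h1 : s * b <= s * (A2 + 1) by rewrite ler_wpM2l//; lra.
apply: (@le_lt_trans _ _ (K * (s * (A2 + 1) + A1 * t))).
  by rewrite ler_wpM2l ?(ltW K0)//; lra.
have [st|ts] := leP s t.
  apply: le_lt_trans te; rewrite [leRHS]mulrCA ler_wpM2l ?(ltW K0)//.
  have : s * (A2 + 1) <= t * (A2 + 1) by rewrite ler_wpM2r//; lra.
  lra.
apply: le_lt_trans se; rewrite [leRHS]mulrCA ler_wpM2l ?(ltW K0)//.
have : A1 * t <= A1 * s by rewrite ler_wpM2l// ltW.
lra.
Qed.

(** In each clause both sides are identified by their Fourier densities. *)
Lemma conv_FL_extension : conv_extension q1 q2 q w1 w2 w conv_FL.
Proof.
split.
- by move=> f1 f2 F1 F2; have [] := conv_FLP F1 F2.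
- exact: conv_FL_continuous.
- move=> f1 f2; have s1 := schwartzP f1; have s2 := schwartzP f2.
  have sc := schwartz_convolution s1 s2.
  have [_ h] := conv_FLP (FL_regular q1_ge1 w1_moderate s1) (FL_regular q2_ge1 w2_moderate s2).
  have := h _ _ (regular_density s1) (regular_density s2).
  rewrite /schwartz_conv to_schwartzE//.
  move=> /density_inj; apply; first exact: regular_density.
  by rewrite fourier_conv//; exact: nearW.
- move=> _ f1 f2 F2; have s1 := schwartzP f1; have [g2 [dg2 _ _]] := FL_density F2.
  have [_ h] := conv_FLP (FL_regular q1_ge1 w1_moderate s1) F2.
  apply: density_inj (h _ _ (regular_density s1) dg2) _ _.
    have := conv_dist_density s1 dg2.
    rewrite (_ : to_schwartz f1 = f1); first exact.
    by apply: schwartz_eq; rewrite to_schwartzE.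
  exact: nearW.
- move=> _ f1 f2 F1; have s2 := schwartzP f2; have [g1 [dg1 _ _]] := FL_density F1.
  have [_ h] := conv_FLP F1 (FL_regular q2_ge1 w2_moderate s2).
  apply: density_inj (h _ _ dg1 (regular_density s2)) _ _.
    have := conv_dist_density s2 dg1.
    rewrite (_ : to_schwartz f2 = f2); first exact.
    by apply: schwartz_eq; rewrite to_schwartzE.
  by apply: nearW => x; rewrite /conv_prod [fourier _ _ * _]mulrC.
Qed.

(** The arguments are approximated by pairs on which both extensions are
    prescribed. By continuity the two values at (f1, f2) are then at
    distance less than every e > 0. *)
Lemma conv_extension_unique (T T' : functional R d -> functional R d -> functional R d) :
  ((q1 < +oo)%E \/ (q2 < +oo)%E) ->
  conv_extension q1 q2 q w1 w2 w T -> conv_extension q1 q2 q w1 w2 w T' ->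
  forall f1 f2 : functional R d, FL q1 w1 f1 -> FL q2 w2 f2 -> T f1 f2 = T' f1 f2.
Proof.
move=> qoo [TF Tc Te T2 T1] [TF' Tc' Te' T2' T1'] f1 f2 F1 F2.
have agree (e : R) : 0 < e -> exists u1 u2, [/\ FL q1 w1 u1, FL q2 w2 u2,
    (FLnorm q1 w1 (u1 - f1)%R < e%:E)%E, (FLnorm q2 w2 (u2 - f2)%R < e%:E)%E &
    T u1 u2 = T' u1 u2].
  move=> e0.
  have dense1 := FL_schwartz_dense q1_ge1 w1_moderate.
  have dense2 := FL_schwartz_dense q2_ge1 w2_moderate.
  have r1 (f : schwartz R d) := FL_regular q1_ge1 w1_moderate (schwartzP f).
  have r2 (f : schwartz R d) := FL_regular q2_ge1 w2_moderate (schwartzP f).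
  have [q1oo|] := ltP q1 +oo%E.
    have [g1 g1e] := dense1 _ q1oo F1 _ e0.
    have [q2oo|] := ltP q2 +oo%E.
      have [g2 g2e] := dense2 _ q2oo F2 _ e0.
      by exists (regular g1), (regular g2); split=> //; rewrite Te Te'.
    rewrite leye_eq => /eqP q2oo; exists (regular g1), f2; split=> //.
      by rewrite FLnorm_self ?lte_fin.
    by rewrite (T2 q2oo) ?(T2' q2oo).
  rewrite leye_eq => /eqP q1oo.
  have q2oo : (q2 < +oo)%E by case: qoo => //; rewrite q1oo ltxx.
  have [g2 g2e] := dense2 _ q2oo F2 _ e0.
  exists f1, (regular g2); split=> //; first by rewrite FLnorm_self ?lte_fin.
  by rewrite (T1 q1oo) ?(T1' q1oo).
apply: (FLnorm_eq0 q_ge1 w_moderate (TF _ _ F1 F2) (TF' _ _ F1 F2)).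
apply/eqP; rewrite eq_le; apply/andP; split; last first.
  have [a [da _ _]] := FL_density (TF _ _ F1 F2).
  have [b [db _ _]] := FL_density (TF' _ _ F1 F2).
  by rewrite (FLnormE q_ge1 w_moderate (is_density_sub da db)) wnorm_ge0.
apply/lee_addgt0Pr => e e0; rewrite add0e.
have e2 : 0 < e / 2 by rewrite divr_gt0.
have [d1 d10 h1] := Tc _ _ F1 F2 _ e2; have [d2 d20 h2] := Tc' _ _ F1 F2 _ e2.
have d0 : 0 < Num.min d1 d2 by rewrite lt_min d10.
have [u1 [u2 [U1 U2 le1 le2 E]]] := agree _ d0.
have le_min (x : \bar R) : (x < (Num.min d1 d2)%:E -> x < d1%:E /\ x < d2%:E)%E.
  by move=> xd; split; apply: lt_le_trans xd _; rewrite lee_fin ge_min lexx ?orbT.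
have [l11 l12] := le_min _ le1; have [l21 l22] := le_min _ le2.
have := FLnorm_dist_le q_ge1 w_moderate (TF _ _ F1 F2) (TF' _ _ F1 F2) (TF _ _ U1 U2).
move=> /le_trans; apply.
rewrite [e in leRHS]splitr EFinD; apply: leeD; first exact/ltW/h1.
by rewrite E; exact/ltW/h2.
Qed.

End convolution.

Theorem lemma3p1 (R : realType) (d : nat) (q q1 q2 : \bar R)
    (w w1 w2 : 'rV[R]_d -> R)
    (q_ge1 : (1 <= q)%E) (q1_ge1 : (1 <= q1)%E) (q2_ge1 : (1 <= q2)%E)
    (w_moderate : moderate_weight w)
    (w1_moderate : moderate_weight w1) (w2_moderate : moderate_weight w2)
    (q1q2 : (q1^-1 + q2^-1 = q^-1)%E)
    (w1w2 : exists2 C : R, 0 < C & forall xi, w xi <= C * (w1 xi * w2 xi)) :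
  (exists T, conv_extension q1 q2 q w1 w2 w T) /\
  ((q1 < +oo)%E \/ (q2 < +oo)%E ->
    forall T T' : functional R d -> functional R d -> functional R d,
      conv_extension q1 q2 q w1 w2 w T ->
      conv_extension q1 q2 q w1 w2 w T' ->
      forall f1 f2, FL q1 w1 f1 -> FL q2 w2 f2 -> T f1 f2 = T' f1 f2).
Proof.
split; first by exists conv_FL; exact: conv_FL_extension.
by move=> qoo T T'; exact: conv_extension_unique.
Qed.
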